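(* Let $d\ge16$ be an integer, $g(\theta)=d\theta\ (\mathrm{mod}\ 1)$ on $S^1$, and let $a_0\in(0,2]$ be such that $h(x)=a_0-x^2$ is hyperbolic. Consider the skew-product $\varphi_\alpha:S^1\times I\to S^1\times I$ given by $\varphi_\alpha(\theta,x)=(g(\theta),f_\alpha(\theta,x))$, where $f_\alpha(\theta,x)=a_0+\alpha\sin(2\pi\theta)-x^2$. Then for every sufficiently small $\alpha>0$ the map $\varphi_\alpha$ has an SRB measure $\nu$, and $\nu$ is hyperbolic and supported in a proper attractor. Moreover, the same property holds for every $\varphi$ that is $C^3$-close enough to $\varphi_\alpha$.
   Context: $I$ is a compact interval such that $\varphi_\alpha(S^1\times I)\subset S^1\times I$ for every small $\alpha>0$. The circle $S^1$ is identified with $(0,1]$. A $C^1$ endomorphism of a compact interval is hyperbolic if it has finitely many hyperbolic attracting periodic points and the complement of their basins of attraction is a hyperbolic (uniformly expanding) set. An SRB measure for a map $\varphi$ is a $\varphi$-invariant and ergodic probability measure $\nu$ whose basin of attraction $B(\nu)=\{z:\frac1n\sum_{j=0}^{n-1}\delta_{\varphi^j(z)}\to\nu\text{ weak}^*\}$ has positive Lebesgue measure. An ergodic measure is hyperbolic if it has only nonzero Lyapunov exponents and not all of the same sign. ''Supported in a proper attractor'' means that $\nu$ gives full measure to a set $\mathcal G=\bigcap_{n\ge0}\varphi^n(\mathcal U)$, where $\mathcal U=S^1\times U$ is a proper open subset of $S^1\times I$ ($U\subset I$ a finite union of open intervals) that is positively invariant under $\varphi^N$ for some $N\ge1$. Markov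 expanding map: a piecewise $C^3$ map $g:(0,1]\to(0,1]$ with an at most countable partition $\{\omega_i\}_{i\in S}$ of $(0,1]$ into subintervals such that $g(\omega_i)=(0,1]$ and $g|_{\omega_i}$ is a $C^3$ diffeomorphism with a $C^3$ extension to the closure, $|g'|\ge d\ge16$, and $|g''|\le K|g'|^2$ for some $K>0$; moreover $\log|g'|\in L^1(\mathrm{Leb})$ is assumed. ''$\varphi$ is $C^3$-close enough to $\varphi_\alpha$'' means that $\varphi$ is $\varepsilon$-$C^3$-close to $\varphi_\alpha$ for a sufficiently small $\varepsilon>0$, where: a piecewise $C^3$ skew-product $\varphi(\theta,x)=(\tilde g(\theta),\tilde f(\theta,x))$ is $\varepsilon$-$C^3$-close to $(\theta,x)\mapsto(g(\theta),f(\theta,x))$ if (i) $\varphi((0,1]\times I)\subset(0,1]\times I$ and $\tilde g$ is a Markov expanding map; (ii) $(0,1]=\bigcup_{i\in S}\tilde\omega_i$ is a Markov partition for $\tilde g$ (same index set $S$ as the Markov partition $\{\omega_i\}$ of $g$), each $\tilde g|_{\tilde\omega_i}:\tilde\omega_i\to(0,1]$ being a diffeomorphism with a $C^3$ extension to the boundary; (iii) with $A_i(\theta)=\tilde\theta_{i+1}+\frac{|\tilde\omega_i|}{|\omega_i|}(\theta-\theta_{i+1})$ the affine map from $\omega_i$ onto $\tilde\omega_i$ ($\theta_{i+1}$, $\tilde\theta_{i+1}$ being corresponding boundary points), one has $\|g|_{\omega_i}-\tilde g\circ A_i\|_{C^3}<\varepsilon$ and $\|f|_{\omega_i\times\mathbb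 R}-\tilde f(A_i(\cdot),\cdot)\|_{C^3}<\varepsilon$ for every $i\in S$. *)

(* Defs.v *)
From HB Require Import structures.
From mathcomp Require Import all_boot all_order all_algebra.
From mathcomp Require Import all_classical all_reals all_analysis.
Set Implicit Arguments.
Unset Strict Implicit.
Unset Printing Implicit Defensive.
Import Order.TTheory GRing.Theory Num.Theory.
Import numFieldNormedType.Exports.
Local Open Scope classical_set_scope.
Local Open Scope ring_scope.

(* The circle is ]0, 1] and the phase space is
   ]0, 1] x [l, r]. All maps are total functions on R or R * R whose values
   outside the stated domains play no role. *)

Section Smoothness.
Context {R : realType} {V : normedModType R}.
Implicit Types (f F : V -> R) (A U : set V) (vs : seq V).

Definition iterD F vs : V -> R := foldr (fun v G => fun x => 'D_v G x) F vs.

(* In finite dimension, existence and continuity of all iterated directional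
   derivatives up to order k is the usual notion of class C^k. *)
Definition Ck_open (k : nat) U F : Prop :=
  [/\ open U,
      (forall vs x, (size vs <= k)%N -> U x ->
         {for x, continuous (iterD F vs)}) &
      (forall vs v x, (size vs < k)%N -> U x -> derivable (iterD F vs) x v)].

(* Class C^k on an arbitrary set: restriction of a C^k function on an open
   neighbourhood. *)
Definition Ck_on (k : nat) A f : Prop :=
  exists U F, [/\ Ck_open k U F, A `<=` U & forall x, A x -> F x = f x].

(* max over j <= k of sup over A of the operator norm of the j-th derivative,
   for A open. *)
Definition Ck_norm (k : nat) A F : \bar R :=
  ereal_sup [set y | exists vs x,
    [/\ (size vs <= k)%N, all (fun v => `|v| <= 1) vs, A x &
        y = (`|iterD F vs x|)%:E]].

End Smoothness.

Section IntervalMaps.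
Context {R : realType}.
Implicit Types (h : R -> R) (l r : R).

Definition attracting_periodic l r h : set R :=
  [set p | l <= p <= r /\ exists n : nat,
     [/\ (0 < n)%N, iter n h p = p & `|derive1 (iter n h) p| < 1]].

(* Points asymptotic to p; as every point of an attracting cycle is an
   attracting periodic point, the union of these sets is the union of the
   basins of the attracting cycles. *)
Definition periodic_basin l r h (p : R) : set R :=
  [set x | l <= x <= r /\ (iter k h x - iter k h p) @[k --> \oo] --> (0 : R)].

Definition expanding_set h (K : set R) : Prop :=
  [/\ compact K, h @` K `<=` K &
      exists C lam : R, [/\ 0 < C, 1 < lam &
        forall n x, K x -> C * lam ^+ n <= `|derive1 (iter n h) x|]].

(* A C^1 endomorphism of [l, r] is given through a C^1 extension h to R;
   by the chain rule nothing below depends on the extension. *)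
Definition hyperbolic_endo l r h : Prop :=
  [/\ Ck_open 1 setT h,
      h @` `[l, r] `<=` `[l, r],
      finite_set (attracting_periodic l r h) &
      expanding_set h (`[l, r] `\`
        \bigcup_(p in attracting_periodic l r h) periodic_basin l r h p)].

End IntervalMaps.

Section MarkovMaps.
Context {R : realType} {S : countType}.
Implicit Types (a b : S -> R) (g : R -> R) (f : R * R -> R).

(* The pieces are omega_i = ]a_i, b_i]: a partition of ]0, 1] into intervals
   homeomorphic to ]0, 1] only has pieces of this form. *)
Definition markov_partition a b : Prop :=
  [/\ forall i, a i < b i,
      trivIset setT (fun i => `]a i, b i]%classic) &
      \bigcup_i `]a i, b i]%classic = `]0, 1]%classic].

(* G is the C^3 extension of g|omega_i to the closure; the inverse of
   g|omega_i is then C^3 because its derivative does not vanish.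
   In the integrability condition, derive1 g is the derivative of g off the
   countable set of endpoints. *)
Definition markov_expanding a b g : Prop :=
  [/\ markov_partition a b,
      (exists D K : R, [/\ 16%:R <= D, 0 < K & forall i,
         set_bij `]a i, b i] `]0, 1] g /\
         exists U (G : R -> R),
           [/\ Ck_open 3 U G, `[a i, b i] `<=` U,
               forall t, t \in `]a i, b i] -> G t = g t,
               forall t, t \in `]a i, b i] -> D <= `|derive1 G t| &
               forall t, t \in `]a i, b i] ->
                 `|derive1n 2 G t| <= K * `|derive1 G t| ^+ 2]]) &
      (@lebesgue_measure R).-integrable `]0, 1]
        (fun t => (ln `|derive1 g t|)%:E)].

Definition skew_product g f (z : R * R) : R * R := (g z.1, f z).

Definition cylinder (J : set R) : set (R * R) := `]0, 1]%classic `*` J.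

Definition affine_piece (a b a' b' : R) (t : R) : R :=
  a' + (b' - a') / (b - a) * (t - a).

(* The map (g', f') is eps-C^3-close to (g, f), with a, b the Markov partition
   of g. The C^3 norms are suprema over the interior of the pieces; by
   continuity of the one-sided derivatives these are the suprema over the
   pieces. *)
Definition C3_close (l r : R) a b g f (eps : R) (g' : R -> R)
    (f' : R * R -> R) : Prop :=
  skew_product g' f' @` cylinder `[l, r] `<=` cylinder `[l, r] /\
  exists a' b' : S -> R,
    [/\ markov_expanding a' b' g',
        forall i, Ck_on 3 (`]a' i, b' i]%classic `*` setT) f',
        forall i, (Ck_norm 3 `]a i, b i[
          (fun t : R =>
             (g t - g' (affine_piece (a i) (b i) (a' i) (b' i) t))%R)
          < eps%:E)%E &
        forall i, (Ck_norm 3 (`]a i, b i[%classic `*` [set: R])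
          (fun z : R * R =>
             (f z - f' (affine_piece (a i) (b i) (a' i) (b' i) z.1, z.2))%R)
          < eps%:E)%E].

End MarkovMaps.

Section Measures.
Context {R : realType}.
Local Notation plane := (measurableTypeR R * measurableTypeR R)%type.
Implicit Types (phi : R * R -> R * R) (nu : probability plane R) (l r : R).

Definition lebesgue2 : set plane -> \bar R :=
  (@lebesgue_measure R \x @lebesgue_measure R)%E.

Definition invariant_measure l r phi nu : Prop :=
  nu (cylinder `[l, r]) = 1%E /\
  forall A : set plane, measurable A ->
    nu (cylinder `[l, r] `&` phi @^-1` A) = nu A.

Definition ergodic_measure l r phi nu : Prop :=
  forall A : set plane, measurable A -> A `<=` cylinder `[l, r] ->
    cylinder `[l, r] `&` phi @^-1` A = A -> nu A = 0%E \/ nu A = 1%E.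

Definition empirical_measure phi (z : plane) (n : nat) :
    {measure set plane -> \bar R} :=
  mscale (n%:R^-1)%:nng (msum (fun j => \d_(iter j phi z : plane)) n).

(* Continuous functions on S^1 x [l, r] are the restrictions of continuous
   functions on R x R that are 1-periodic in the first variable. *)
Definition weak_star_cvg l r (mu : nat -> {measure set plane -> \bar R})
    nu : Prop :=
  forall psi : R * R -> R, continuous psi ->
    (forall t x, psi (t + 1, x) = psi (t, x)) ->
    (\int[mu n]_(z in cylinder `[l, r]) psi z)%R @[n --> \oo] -->
      (\int[nu]_(z in cylinder `[l, r]) psi z)%R.

Definition basin l r phi nu : set plane :=
  [set z | cylinder `[l, r] z /\
           weak_star_cvg l r (empirical_measure phi z) nu].

(* Positive Lebesgue measure of the basin, without a separate measurability
   proof: the basin contains a Borel set of positive measure. *)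
Definition SRB_measure l r phi nu : Prop :=
  [/\ invariant_measure l r phi nu, ergodic_measure l r phi nu &
      exists A : set plane,
        [/\ measurable A, A `<=` basin l r phi nu & (0 < lebesgue2 A)%E]].

(* lambda may be -oo, since D(phi^n) v may vanish or decay
   superexponentially. *)
Definition lyapunov_at phi (z v : R * R) (lambda : \bar R) : Prop :=
  ((n%:R^-1)%:E * lne (`|'D_v (iter n phi) z|)%:E)%E @[n --> \oo] --> lambda.

(* s lists the values taken by the Lyapunov exponents at nu-a.e. point. *)
Definition lyapunov_spectrum phi nu (s : seq (\bar R)) : Prop :=
  {ae nu, forall z : plane,
    [/\ forall n, differentiable (iter n phi : R * R -> R * R) (z : R * R),
        forall v : R * R, v != 0 ->
          exists2 lambda, lambda \in s & lyapunov_at phi z v lambda &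
        forall lambda, lambda \in s ->
          exists2 v : R * R, v != 0 & lyapunov_at phi z v lambda]}.

Definition hyperbolic_measure phi nu : Prop :=
  exists s : seq (\bar R),
    [/\ lyapunov_spectrum phi nu s, 0%E \notin s,
        exists2 lambda, lambda \in s & (0 < lambda)%E &
        exists2 lambda, lambda \in s & (lambda < 0)%E].

Definition supported_in_proper_attractor l r phi nu : Prop :=
  exists (s : seq (R * R)) (N : nat),
    let U := \bigcup_(p in [set` s]) `]p.1, p.2[%classic in
    [/\ (0 < N)%N,
        cylinder U `<` cylinder `[l, r],
        iter N phi @` cylinder U `<=` cylinder U &
        nu.-negligible (~` \bigcap_n (iter n phi @` cylinder U))].

Definition has_hyperbolic_SRB l r phi : Prop :=
  exists nu : probability plane R,
    [/\ SRB_measure l r phi nu, hyperbolic_measure phi nu &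
        supported_in_proper_attractor l r phi nu].

End Measures.

Section QuadraticFamily.
Context {R : realType}.

(* d * t mod 1, with representatives in ]0, 1]. *)
Definition times_mod1 (d : nat) (t : R) : R :=
  d%:R * t - (Num.ceil (d%:R * t))%:~R + 1.

Definition quad_fiber (a0 alpha : R) (z : R * R) : R :=
  a0 + alpha * sin (2%:R * pi * z.1) - z.2 ^+ 2.

Definition viana_map (d : nat) (a0 alpha : R) : R * R -> R * R :=
  skew_product (times_mod1 d) (quad_fiber a0 alpha).

End QuadraticFamily.

(* Main.v *)
From HB Require Import structures.
Require Import Defs.
From mathcomp Require Import all_boot all_order all_algebra.
From mathcomp Require Import all_classical all_reals all_analysis.
From mathcomp Require Import measurable_realfun.
From mathcomp Require Import ring lra zify.
Set Implicit Arguments.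
Unset Strict Implicit.
Unset Printing Implicit Defensive.
Import Order.TTheory GRing.Theory Num.Theory.
Import numFieldNormedType.Exports.
Local Open Scope classical_set_scope.
Local Open Scope ring_scope.

(** Write h x = a0 - x^2. The theorem reduces to a statement about skew-products
    which contract their fibres, for two reasons. First, h has an attracting
    cycle p_0, ..., p_(N-1): otherwise the hyperbolic set would be all of [l, r],
    and the mean value theorem forbids a self-map of [l, r] to expand uniformly
    everywhere ([attracting_point_exists]). Because the interval is invariant for
    every small alpha, h maps [l, r] at a positive distance from its ends, so the
    cycle is interior. Second, suitable intervals J_j around p_j are contracted
    into one another, not only by h but by every map that is C^1-close to h
    ([trapping_cycle]). For small alpha, and for each perturbation, all the fibre
    maps are C^1-close to h, hence phi maps ]0, 1] x J_j into ]0, 1] x J_(j+1)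
    and contracts its fibres. The union of the bands ]0, 1] x J_j is the
    neighbourhood of a proper attractor, and an SRB measure is wanted on it
    ([contracting_skew_SRB]).

    The measure is built from the base map g. Its transfer operator has a fixed
    density rho, bounded between positive constants ([invariant_density]). On the
    region under the graph of rho lives a measure-preserving map W which adds a
    past to the base point: g undoes W on the first coordinate
    ([natural_extension]). Coming back from the remote past, the cell J_0
    shrinks to one point of the fibre, and these points carry a probability nu0
    invariant under phi^N ([section_invariant]); its images along the cycle are
    averaged into nu ([cycle_measure]).

    The whole statistical behaviour follows from that of the base. Distortion
    bounds make every power of g ergodic ([invariant_set_dichotomy]), so
    Lebesgue-almost every t visits all cylinders under g^N with the right
    frequency. After many turns of the cycle a continuous function of
    phi^(kN) (t, x) depends, up to e, only on finitely many letters of the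
    itinerary of t. Hence its averages converge to the integral for every
    typical t and every x in J_0 ([section_average_cvg]): the basin of nu contains
    a product set of positive area. The same fact read nu0-almost everywhere gives
    ergodicity ([section_ergodic]).

    The derivative of phi is triangular. A vector with a base component grows
    like the product of the slopes of g, since the contraction of the cells keeps
    its fibre component bounded by a multiple of its base component
    ([cone_bound]); a vertical vector is multiplied by the fibre derivatives. Both
    rates converge by Birkhoff's theorem, which is needed for functions with
    values in [0, +oo] because the fibre derivative may vanish ([birkhoff_ge0]).
    The exponents are at least ln 16 and at most ln lam < 0, where lam is the
    contraction rate of the cells ([cycle_hyperbolic]).

    What remains is to read the hypotheses of [near_quadratic_SRB] off the
    definition of C^3-closeness, on each piece separately. *)

Local Notation line R := (measurableTypeR R).
Local Notation plane R := (measurableTypeR R * measurableTypeR R)%type.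

(** * Birkhoff's ergodic theorem *)

Lemma real_lt_nat (R : realType) (x : R) : exists n : nat, x < n%:R.
Proof. by exists (Num.truncn x).+1; exact: Num.Theory.truncnS_gt. Qed.

Section Birkhoff.
Context d (T : measurableType d) (R : realType) (P : probability T R).
Variable tau : T -> T.
Hypothesis mtau : measurable_fun setT tau.
Hypothesis tau_inv : forall A, measurable A -> P (tau @^-1` A) = P A.

Lemma integrable_comp_invariant (f : T -> \bar R) :
  P.-integrable setT f -> P.-integrable setT (f \o tau).
Proof.
move=> fi; have := integrableP _ _ _ fi; case=> mf ifoo.
apply/integrableP; split; first exact: measurableT_comp.
have mabs : measurable_fun setT (fun x => `|f x|%E).
  by apply: measurableT_comp => //; exact: measurable_abse.
have <- : (\int[pushforward P tau]_x `|f x| = \int[P]_x `|(f \o tau) x|)%E.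
  by rewrite ge0_integral_pushforward.
by rewrite (@eq_measure_integral _ _ _ _ P)// => A mA _; exact: tau_inv.
Qed.

Lemma integral_invariant_set (A : set T) (f : T -> \bar R) :
  measurable A -> tau @^-1` A = A -> P.-integrable setT f ->
  (\int[P]_(x in A) (f \o tau) x = \int[P]_(x in A) f x)%E.
Proof.
move=> mA Ainv fi.
rewrite -{1}Ainv -(integral_pushforward mtau)//.
- by apply: eq_measure_integral => B mB _; exact: tau_inv.
- exact: measurable_int fi.
- by rewrite Ainv; apply: integrableS (integrable_comp_invariant fi).
Qed.

Definition birkhoff_sum (F : T -> R) n x := \sum_(0 <= k < n) F (iter k tau x).

Lemma birkhoff_sumS F n x :
  birkhoff_sum F n.+1 x = F x + birkhoff_sum F n (tau x).
Proof.
rewrite /birkhoff_sum big_nat_recl//=; congr (_ + _).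
by apply: eq_bigr => k _; rewrite -iterSr.
Qed.

(** The maximum of the Birkhoff sums of lengths 0, ..., n, in the recursive form that
    shows how it changes along tau. *)
Fixpoint max_sum (F : T -> R) n x : R :=
  if n is m.+1 then Num.max 0 (F x + max_sum F m (tau x)) else 0.

Lemma max_sum_ge0 F n x : 0 <= max_sum F n x.
Proof. by case: n => //= n; rewrite le_max lexx. Qed.

Lemma max_sum_ndecr F n x : max_sum F n x <= max_sum F n.+1 x.
Proof.
elim: n x => [|n IH] x; first exact: (max_sum_ge0 F 1).
rewrite [X in X <= _]/= [X in _ <= X]/= ge_max.
by rewrite le_max lexx /= le_max lerD2l IH orbT.
Qed.

Lemma max_sum_homo F x : {homo max_sum F ^~ x : m n / (m <= n)%N >-> m <= n}.
Proof.
by apply: homo_leq => [//|? ? ? /le_trans|n]; [exact|exact: max_sum_ndecr].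
Qed.

Lemma birkhoff_sum_le_max F n x : birkhoff_sum F n x <= max_sum F n x.
Proof.
elim: n x => [|n IH] x; first by rewrite /birkhoff_sum big_geq.
by rewrite birkhoff_sumS /= le_max lerD2l IH orbT.
Qed.

Lemma integrable_max_sum F n : P.-integrable setT (EFin \o F) ->
  P.-integrable setT (EFin \o max_sum F n).
Proof.
move=> iF; elim: n => [|n IH]; first exact: integrable0.
have iG : P.-integrable setT (fun x => (`|F x|)%:E + (max_sum F n (tau x))%:E)%E.
  by apply: integrableD => //; [exact: integrable_abse iF
                               |exact: (integrable_comp_invariant IH)].
have mF : measurable_fun setT F by exact/measurable_EFinP/(measurable_int _ iF).
have mM : measurable_fun setT (max_sum F n).
  exact/measurable_EFinP/(measurable_int _ IH).
apply: le_integrable iG => //.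
- apply/measurable_EFinP => /=; apply: measurable_maxr => //.
  by apply: measurable_funD => //; exact: (measurableT_comp mM).
- move=> x _ /=; rewrite lee_fin ger0_norm; last exact: (max_sum_ge0 F n.+1 x).
  rewrite ger0_norm; last by rewrite addr_ge0// max_sum_ge0.
  by rewrite ge_max addr_ge0 ?max_sum_ge0//= lerD2r ler_norm.
Qed.

Hypothesis tau_erg : forall A, measurable A -> tau @^-1` A = A ->
  P A = 0%E \/ P A = 1%E.

(** The points with unbounded sums form an invariant set. On it the maxima satisfy
    max_sum (n + 1) - max_sum n o tau = F for large n; these differences have
    nonnegative integral, so the set cannot have full measure when F has negative
    integral. *)
Lemma ae_bounded_birkhoff_sum (F : T -> R) :
  P.-integrable setT (EFin \o F) -> (\int[P]_x (F x)%:E < 0)%E ->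
  {ae P, forall x, exists B : nat, forall n, birkhoff_sum F n x <= B%:R}.
Proof.
move=> iF ltF0.
pose A := \bigcap_(B : nat) \bigcup_n [set x | B%:R < max_sum F n x].
have mM n : measurable_fun setT (max_sum F n).
  exact/measurable_EFinP/(measurable_int _ (integrable_max_sum n iF)).
have mA : measurable A.
  apply: bigcapT_measurable => B; apply: bigcup_measurable => n _.
  rewrite -[X in measurable X]setTI.
  rewrite (_ : [set x | _] = max_sum F n @^-1` `]B%:R, +oo[%classic); last first.
    by apply/seteqP; split => x /=; rewrite in_itv/= andbT.
  exact: mM.
have Ainv : tau @^-1` A = A.
  apply/seteqP; split => x /= Ax B _.
  - have [N H] := real_lt_nat (B%:R + `|F x|).
    have [n _ /= Hn] := Ax N I.
    exists n.+1 => //=; rewrite lt_max; apply/orP; right.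
    have := ler_norm (- F x); rewrite normrN; lra.
  - have [N H] := real_lt_nat (B%:R + `|F x|).
    have [n _ /= Hn] := Ax N I.
    exists n => //=; case: n Hn => [|n]/=; first by rewrite ltNge ler0n.
    rewrite lt_max ltNge ler0n /= => Hn.
    have Hn' := max_sum_ndecr F n (tau x).
    have := ler_norm (F x); move: Hn Hn' => /=; lra.
have mtA : measurable (~` A) by exact: measurableC.
have [PA0|PA1] := tau_erg mA Ainv.
- exists A; split => // x /= nb; apply: contrapT => nAx; apply: nb.
  have [B nB] : exists B : nat, forall n, ~ (B%:R < max_sum F n x).
    apply: contrapT => /forallNP nB; apply: nAx => B _.
    by have /existsNP [n /contrapT Hn] := nB B; exists n.
  exists B => n; apply: le_trans (birkhoff_sum_le_max F n x) _.
  by rewrite leNgt; apply/negP/nB.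
(* From here on A has full measure, so the integral of F is its integral over A. *)
exfalso; move: ltF0; apply/negP; rewrite -leNgt.
have -> : (\int[P]_x (F x)%:E = \int[P]_(x in A) (F x)%:E)%E.
  have PA0 : P (~` A) = 0%E by rewrite probability_setC// PA1 subee.
  rewrite -[X in integral _ X _](setvU A) setUC integral_setU ?setvU//.
  - rewrite [X in (_ + X)%E](_ : _ = 0%E) ?adde0//.
    apply: null_set_integral => //; apply: measurable_funTS.
    exact: measurable_int iF.
  - by apply: measurable_funTS; exact: measurable_int iF.
  - exact/disj_setPCl.
pose D n x := max_sum F n.+1 x - max_sum F n (tau x).
have DE n x : D n x = Num.max (- max_sum F n (tau x)) (F x).
  rewrite /D /=; case: (leP 0 (F x + _)) => H; case: (leP (- _) (F x)); lra.
have iMA n : P.-integrable A (EFin \o max_sum F n).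
  by apply: integrableS (integrable_max_sum n iF).
have iMtA n : P.-integrable A (EFin \o (max_sum F n \o tau)).
  by apply: integrableS (integrable_comp_invariant (integrable_max_sum n iF)).
have D0 n : (0 <= \int[P]_(x in A) (D n x)%:E)%E.
  rewrite (_ : (fun x => _) = (fun x => (max_sum F n.+1 x)%:E
      - (max_sum F n (tau x))%:E)%E) //.
  rewrite (integralB_EFin mA (iMA n.+1) (iMtA n)).
  rewrite [X in (_ - X)%E](_ : _ = \int[P]_(x in A) (max_sum F n x)%:E)%E; last first.
    exact: (integral_invariant_set mA Ainv (integrable_max_sum n iF)).
  rewrite sube_ge0; last by rewrite (integrable_fin_num mA (iMA n)).
  apply: (le_integral mA (iMA n) (iMA n.+1)) => x _.
  by rewrite lee_fin max_sum_ndecr.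
have mDE n : measurable_fun setT (D n).
  apply: measurable_funB => //; exact: measurableT_comp.
have DF x : A x -> \forall n \near \oo, D n x = F x.
  rewrite -Ainv => Ax; have [N HN] := real_lt_nat (- F x).
  have [m _ /= Hm] := Ax N I.
  near=> n; rewrite DE; apply/max_idPr; rewrite lerNl ltW// (lt_trans HN)//.
  apply: lt_le_trans Hm _.
  by apply: max_sum_homo; near: n; exact: nbhs_infty_ge.
have [|||||_ _ cvgD] := @dominated_convergence _ _ _ P A mA
    (fun n => EFin \o D n) (EFin \o F) (fun x => (`|F x|)%:E).
- by move=> n; apply: measurable_funTS; exact/measurable_EFinP.
- by apply: measurable_funTS; exact: measurable_int iF.
- apply: aeW => x Ax; apply: cvg_near_cst => /=.
  by apply: filterS (DF x Ax) => n ->.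
- by apply: integrableS (integrable_abse iF).
- apply: aeW => x n Ax /=; rewrite lee_fin DE.
  have := max_sum_ge0 F n (tau x).
  by case: (leP (- _) (F x)) => // H; rewrite !ler_norml; have := ler_norm (F x); have := ler_norm (- F x); rewrite normrN; lra.
apply: (closed_cvg (fun x => 0 <= x)%E) cvgD => //.
  exact: closed_ereal_le_ereal.
by apply: nearW => n; exact: D0.
Unshelve. all: by end_near. Qed.

Lemma birkhoff_sum_affine (F : T -> R) a b n x :
  birkhoff_sum (fun y => a * F y + b) n x = a * birkhoff_sum F n x + b *+ n.
Proof.
rewrite /birkhoff_sum big_split/= -mulr_sumr; congr (_ + _).
by rewrite sumr_const_nat subn0.
Qed.

Lemma ae_birkhoff_sum_ub (F : T -> R) (a c e : R) :
  P.-integrable setT (EFin \o F) -> 0 < e ->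
  c = - a * \int[P]_x F x ->
  {ae P, forall x, exists B : nat, forall n,
     a * birkhoff_sum F n x + (c - e) *+ n <= B%:R}.
Proof.
move=> iF e0 cE.
have iaF : P.-integrable setT (fun x => (a * F x)%:E).
  by have := integrableZl measurableT a iF.
have ic : P.-integrable setT (fun x => (c - e)%:E : \bar R).
  exact: finite_measure_integrable_cst.
have iG : P.-integrable setT (EFin \o (fun x => a * F x + (c - e))).
  by have := integrableD measurableT iaF ic.
have := ae_bounded_birkhoff_sum iG; rewrite [X in (X < 0)%E -> _](_ : _ = (- e)%:E).
  rewrite lte_fin oppr_lt0 => /(_ e0); apply: filterS => x [B HB].
  by exists B => n; rewrite -birkhoff_sum_affine.
transitivity ((\int[P]_x (a * F x)%:E + \int[P]_x (c - e)%:E)%E).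
  by rewrite -integralD_EFin.
have -> : (\int[P]_x (a * F x)%:E = a%:E * \int[P]_x (F x)%:E)%E.
  by rewrite -integralZl.
rewrite integral_cst//= probability_setT mule1.
rewrite -(fineK (integrable_fin_num measurableT iF)) -EFinM -EFinD.
congr (_%:E); rewrite cE /Rintegral; ring.
Qed.

(** Apply the boundedness of sums to F and to - F, after subtracting constants that
    make the integrals slightly negative. *)
Theorem birkhoff (F : T -> R) : P.-integrable setT (EFin \o F) ->
  {ae P, forall x, n%:R^-1 * birkhoff_sum F n x @[n --> \oo] -->
    \int[P]_x F x}.
Proof.
move=> iF; set I := \int[P]_x F x.
have H1 : {ae P, forall x k, exists B : nat, forall n,
     1 * birkhoff_sum F n x + (- 1 * I - k.+1%:R^-1) *+ n <= B%:R}.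
  by apply: ae_foralln => k; apply: ae_birkhoff_sum_ub => //.
have H2 : {ae P, forall x k, exists B : nat, forall n,
     - 1 * birkhoff_sum F n x + (- - 1 * I - k.+1%:R^-1) *+ n <= B%:R}.
  by apply: ae_foralln => k; apply: ae_birkhoff_sum_ub => //.
apply: filterS2 H1 H2 => x H1 H2.
apply/cvgrPdist_le => /= e e0.
have [k Hk] := real_lt_nat (2 / e).
have [B1 {}H1] := H1 k; have [B2 {}H2] := H2 k.
have [N HN] := real_lt_nat ((B1 + B2)%:R * 2 / e).
near=> n.
have n0 : 0 < n%:R :> R by rewrite ltr0n; near: n; exact: nbhs_infty_gt.
have Nn : (B1 + B2)%:R * 2 / e <= n%:R :> R.
  rewrite (le_trans (ltW HN))// ler_nat; near: n; exact: nbhs_infty_ge.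
have k1 : k.+1%:R^-1 <= e / 2 :> R.
  rewrite -[leRHS]invrK lef_pV2 ?posrE ?invr_gt0 ?divr_gt0//.
  by rewrite invf_div (le_trans (ltW Hk))// ler_nat.
have := H2 n; rewrite -[X in _ + X <= _]mulr_natr => L2.
have := H1 n; rewrite -[X in _ + X <= _]mulr_natr => L1; move: L1 L2.
set S := birkhoff_sum F n x => L1 L2.
rewrite distrC -(ler_pM2r n0) -[X in _ * X <= _](gtr0_norm n0) -normrM.
rewrite mulrBl mulrAC mulVf ?gt_eqF// mul1r.
have B1n : (B1 + B2)%:R * 2 <= n%:R * e by rewrite -ler_pdivrMr.
have : k.+1%:R^-1 * n%:R <= e / 2 * n%:R by rewrite ler_pM2r.
move: B1n L1 L2; rewrite natrD.
have := ler0n R B1; have := ler0n R B2.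
set b1 := B1%:R; set b2 := B2%:R; set kk := k.+1%:R^-1; set nn := n%:R.
move=> b20 b10 B1n L1 L2 kn.
rewrite ler_norml; apply/andP; split; nra.
Unshelve. all: by end_near. Qed.

End Birkhoff.

(** * Borel measures on the line and the plane *)

(** A comparison on intervals extends to Borel sets because these can be covered by
    intervals of almost the same total length. *)
Lemma lebesgue_measure_dominates (R : realType)
    (nu : {measure set (measurableTypeR R) -> \bar R}) (c : R) :
  0 < c ->
  (forall a b : R, a < b -> (nu `]a, b]%classic <= (c * (b - a))%:E)%E) ->
  forall A : set (measurableTypeR R), measurable A ->
    (nu A <= c%:E * @lebesgue_measure R A)%E.
Proof.
move=> c0 nuab A mA; rewrite -lee_pdivrMl//.
apply: le_ereal_inf_tmp => _ [F [mF AF] <-].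
rewrite lee_pdivrMl//.
have mF' k : measurable (F k : set (measurableTypeR R)).
  by apply: sub_sigma_algebra; exact: mF.
apply: (@le_trans _ _ (\sum_(k <oo) nu (F k))%E).
  by apply: measure_sigma_subadditive => //.
rewrite -nneseriesZl//.
apply: lee_nneseries => // k _.
have /ocitvP[->|[[a b]/= ab ->]] := mF k.
  by rewrite measure0 mule_ge0 ?lee_fin ?(ltW c0)//; apply: wlength_ge0.
rewrite wlength_itv_bnd ?(ltW ab)//= -EFinM; exact: nuab.
Qed.

Section Plane.
Context {R : realType}.

Definition quadrant (a b : R) : set (plane R) := `]-oo, a] `*` `]-oo, b].

Let quadrants := [set Q : set (plane R) | exists a b, Q = quadrant a b].

Let sub_quadrants (f : plane R -> line R) :
  (forall c, <<s quadrants >> (f @^-1` `]-oo, c])) ->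
  preimage_set_system setT f measurable `<=` <<s quadrants >>.
Proof.
move=> Hc _ [B mB <-].
suff: image_set_system setT f <<s quadrants >> B by [].
suff: (measurable : set (set (line R))) `<=` image_set_system setT f <<s quadrants >> by apply.
apply: smallest_sub.
  exact/sigma_algebra_image/smallest_sigma_algebra.
move=> _ [[a b] _ <-]; rewrite /image_set_system /= setTI.
rewrite (_ : f @^-1` _ = f @^-1` `]-oo, b] `\` f @^-1` `]-oo, a]); last first.
  apply/seteqP; split => z /=; rewrite !in_itv/=.
    by move=> /andP[az zb]; split => //; apply/negP; rewrite -ltNge.
  by move=> [-> /negP]; rewrite -ltNge => ->.
have HD := @measurableD _ (g_sigma_algebraType quadrants).
by apply: HD; exact: Hc.
Qed.

Lemma measurable_plane_quadrants :
  (measurable : set (set (plane R))) = <<s quadrants >>.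
Proof.
apply/seteqP; split.
  apply: smallest_sub; first exact: smallest_sigma_algebra.
  have mU := @bigcupT_measurable _ (g_sigma_algebraType quadrants).
  rewrite subUset; split; apply: sub_quadrants => c.
  - rewrite (_ : _ @^-1` _ = \bigcup_n quadrant c n%:R).
      by apply: mU => n; apply: sub_sigma_algebra; exists c, n%:R.
    apply/seteqP; split => -[x y] /=.
      rewrite in_itv/= => xc; have [n Hn] := real_lt_nat y.
      by exists n => //; split; rewrite /= in_itv//= ltW.
    by move=> [n _ []].
  - rewrite (_ : _ @^-1` _ = \bigcup_n quadrant n%:R c).
      by apply: mU => n; apply: sub_sigma_algebra; exists n%:R, c.
    apply/seteqP; split => -[x y] /=.
      rewrite in_itv/= => xc; have [n Hn] := real_lt_nat x.
      by exists n => //; split; rewrite /= in_itv//= ltW.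
    by move=> [n _ []].
apply: smallest_sub; first exact: sigma_algebra_measurable.
by move=> _ [a [b ->]]; apply: measurableX; exact: measurable_itv.
Qed.

Lemma measurable_quadrant a b : measurable (quadrant a b).
Proof. by apply: measurableX; exact: measurable_itv. Qed.

(** Quadrants are stable under intersection and generate the Borel sets. *)
Lemma plane_measure_unique (m1 m2 : {measure set (plane R) -> \bar R}) :
  (m1 setT < +oo)%E ->
  (forall a b, m1 (quadrant a b) = m2 (quadrant a b)) ->
  forall A, measurable A -> m1 A = m2 A.
Proof.
move=> m1oo m12 A mA.
apply: (@measure_unique _ _ _ quadrants (fun n => quadrant n%:R n%:R)) => //.
- exact: measurable_plane_quadrants.
- move=> _ _ [a [b ->]] [c [e ->]]; exists (Num.min a c), (Num.min b e).
  apply/seteqP; split => -[x y]; rewrite /quadrant /= !in_itv/= !le_min.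
    by move=> [[-> ->] [-> ->]].
  by move=> [/andP[-> ->] /andP[-> ->]].
- by move=> i; exists i%:R, i%:R.
- apply/seteqP; split => // -[x y] _.
  have [n Hn] := real_lt_nat (Num.max x y); exists n => //.
  by move: Hn; rewrite gt_max => /andP[xn yn]; split; rewrite /= in_itv/= ltW.
- by move=> B [a [b ->]].
- move=> k; apply: le_lt_trans m1oo; apply: le_measure; rewrite ?inE//.
  exact: measurable_quadrant.
Qed.

(** An open set is the union of the rational boxes it contains; this relates the
    topology of the plane to the product sigma-algebra. *)
Lemma open_measurable_plane (A : set (R * R)) :
  open A -> measurable (A : set (plane R)).
Proof.
move=> oA.
pose box (p : rat * rat * nat) : set (plane R) :=
  ball (ratr p.1.1 : R) p.2.+1%:R^-1 `*` ball (ratr p.1.2 : R) p.2.+1%:R^-1.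
rewrite (_ : A = \bigcup_p if `[< box p `<=` A >] then box p else set0).
  apply: countable_bigcupT_measurable => [|p]; first exact: countableP.
  case: asboolP => // _; rewrite /box !ball_itv.
  by apply: measurableX; exact: measurable_itv.
apply/seteqP; split => [[x y] Axy|z [p _]]; last by case: asboolP => // + ?; apply.
have [e /= e0 eA] : exists2 e : R, 0 < e & ball (x, y) e `<=` A.
  exact/nbhs_ballP/open_nbhs_nbhs.
have [n Hn] := real_lt_nat (2 / e).
have n0 : 0 < n.+1%:R^-1 :> R by rewrite invr_gt0 ltr0n.
have Hne : n.+1%:R^-1 * 2 < e.
  rewrite mulrC ltr_pdivrMr ?ltr0n// mulrC -ltr_pdivrMr//.
  by rewrite (lt_trans Hn)// ltr_nat.
have near_rat (t : R) : exists q : rat, `|t - ratr q| < n.+1%:R^-1.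
  have [q] : exists q : rat, ratr q \in `]t, (t + n.+1%:R^-1)[.
    by apply: rat_in_itvoo; rewrite ltrDl.
  rewrite in_itv/= => /andP[tq qt]; exists q.
  by rewrite distrC gtr0_norm ?subr_gt0// ltrBlDl.
have [[q xq] [q' yq']] := (near_rat x, near_rat y).
exists (q, q', n) => //; rewrite asboolT.
  by split; apply: ball_sym.
move=> [x' y'] /= [qx' qy']; apply: eA; split => /=.
  apply: (@le_ball _ _ _ (n.+1%:R^-1 + n.+1%:R^-1)).
    by move: Hne; set w := n.+1%:R^-1; lra.
  by apply: ball_triangle qx'; exact: xq.
apply: (@le_ball _ _ _ (n.+1%:R^-1 + n.+1%:R^-1)).
    by move: Hne; set w := n.+1%:R^-1; lra.
by apply: ball_triangle qy'; exact: yq'.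
Qed.

Lemma fst_is_diff (z : R * R) : is_diff z (fst : R * R -> R) fst.
Proof.
apply: DiffDef; first by apply: (@linear_differentiable _ _ _ fst) => ?; exact: cvg_fst.
by apply: (@diff_lin _ _ _ fst) => ?; exact: cvg_fst.
Qed.

Lemma snd_is_diff (z : R * R) : is_diff z (snd : R * R -> R) snd.
Proof.
apply: DiffDef; first by apply: (@linear_differentiable _ _ _ snd) => ?; exact: cvg_snd.
by apply: (@diff_lin _ _ _ snd) => ?; exact: cvg_snd.
Qed.

Lemma continuous_at_measurable_plane (D : set (plane R)) (u : R * R -> R) :
  measurable D -> (forall z, D z -> {for z, continuous u}) ->
  measurable_fun D (u : plane R -> R).
Proof.
move=> mD cu _; apply: (measurability _ (RGenOInfty.measurableE R)) => //.
move=> _ [_ [a ->] <-].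
rewrite (_ : D `&` _ = D `&` interior (u @^-1` `]a, +oo[%classic)).
  by apply: measurableI => //; apply: open_measurable_plane; exact: open_interior.
apply/seteqP; split => z [Dz uz]; split => //; last exact: interior_subset uz.
by apply: (cu z Dz); apply: open_nbhs_nbhs; split.
Qed.

Lemma continuous_measurable_plane (u : R * R -> R) :
  continuous u -> measurable_fun setT (u : plane R -> R).
Proof. by move=> cu; apply: continuous_at_measurable_plane => // z _; exact: cu. Qed.

End Plane.

(** * Markov maps and their inverse branches *)

(** What the proof uses of a Markov expanding map. The branches are increasing and
    extended to closed intervals. The second derivative enters only through the
    distortion inequality [mm_dist], which compares slopes at two points in terms of
    their images and therefore can be iterated. *)
Record markov_map (R : realType) (d : nat) (a b : 'I_d -> R)
    (G dG : 'I_d -> R -> R) (K : R) (g : R -> R) : Prop := MarkovMap {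
  mm_K : 0 < K;
  mm_ab : forall i, a i < b i;
  mm_triv : trivIset setT (fun i => `]a i, b i]%classic);
  mm_cover : \bigcup_i `]a i, b i]%classic = `]0, 1]%classic;
  mm_deriv : forall i t, t \in `[a i, b i] -> is_derive t 1 (G i) (dG i t);
  mm_cont : forall i t, t \in `[a i, b i] -> {for t, continuous (dG i)};
  mm_exp : forall i t, t \in `[a i, b i] -> 16%:R <= dG i t;
  mm_dist : forall i s t, s \in `[a i, b i] -> t \in `[a i, b i] ->
     dG i s <= expR (K * `|G i s - G i t|) * dG i t;
  mm_Ga : forall i, G i (a i) = 0;
  mm_Gb : forall i, G i (b i) = 1;
  mm_g : forall i t, t \in `]a i, b i] -> g t = G i t }.

Section InverseBranches.
Context {R : realType} {d : nat} {a b : 'I_d -> R} {G dG : 'I_d -> R -> R}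
  {K : R} {g : R -> R}.
Hypothesis H : markov_map a b G dG K g.
Implicit Types (i : 'I_d) (s t x y : R).

Let ab i := mm_ab H i.

Lemma a_itv i : a i \in `[a i, b i]. Proof. by rewrite in_itv/= lexx ltW. Qed.
Lemma b_itv i : b i \in `[a i, b i]. Proof. by rewrite in_itv/= lexx ltW/=. Qed.

Lemma branch_continuous i : {within `[a i, b i], continuous (G i)}.
Proof.
apply: derivable_within_continuous => t tab.
by have [] := mm_deriv H tab.
Qed.

Lemma branch_expand i x y : x \in `[a i, b i] -> y \in `[a i, b i] -> x <= y ->
  16%:R * (y - x) <= G i y - G i x.
Proof.
move=> xab yab; rewrite le_eqVlt => /predU1P[->|xy]; first by rewrite !subrr mulr0.
have sub : `[x, y] `<=` `[a i, b i].
  by apply: subset_itv; rewrite bnd_simp; rewrite ?(itvP xab) ?(itvP yab).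
have [c cxy ->] := MVT xy
  (fun c (cxy : c \in `]x, y[) => mm_deriv H (sub c (subset_itv_oo_cc cxy)))
  (continuous_subspaceW sub (@branch_continuous i)).
rewrite ler_wpM2r ?subr_ge0 ?(ltW xy)//; apply: (mm_exp H).
exact: sub (subset_itv_oo_cc cxy).
Qed.

Lemma branch_homo i : {in `[a i, b i] &, {homo G i : x y / x < y}}.
Proof.
move=> x y xab yab xy; have := branch_expand xab yab (ltW xy).
by move: xy; lra.
Qed.

Lemma branch_mono i : {in `[a i, b i] &, {mono G i : x y / x <= y}}.
Proof. by apply: le_mono_in; exact: branch_homo. Qed.

Definition clamp t : R := if t < 0 then 0 else if 1 < t then 1 else t.

Lemma clamp01 t : clamp t \in `[0, 1].
Proof.
by rewrite in_itv/= /clamp; case: (ltP t 0) => ?; [lra|case: (ltP 1 t) => ?; lra].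
Qed.

Lemma clampE t : t \in `[0, 1] -> clamp t = t.
Proof.
by rewrite in_itv/= /clamp => ?; case: (ltP t 0) => ?; [lra|case: (ltP 1 t) => ?; lra].
Qed.

Lemma clamp_lip s t : `|clamp s - clamp t| <= `|s - t|.
Proof.
have := ler_norm (s - t); have := ler_norm (t - s); rewrite distrC => h1 h2.
rewrite ler_norml /clamp.
by case: (ltP s 0) => ?; case: (ltP t 0) => ?; case: (ltP 1 s) => ?; case: (ltP 1 t) => ?; lra.
Qed.

(** Clamping t to [0, 1] defines the inverse branch on the whole line, where it is
    Lipschitz; continuity arguments then need no one-sided limits at 0 and 1. *)
Definition psi i t : R :=
  xget (a i) [set x | x \in `[a i, b i] /\ G i x = clamp t].

Lemma psi_spec i t : psi i t \in `[a i, b i] /\ G i (psi i t) = clamp t.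
Proof.
rewrite /psi; case: xgetP => [x -> []//|nex]; exfalso.
have [|||x xab Gx] := @IVT R (G i) (a i) (b i) (clamp t).
- exact/ltW/ab.
- exact: branch_continuous.
- rewrite (mm_Ga H) (mm_Gb H); have := clamp01 t; rewrite in_itv/= => /andP[? ?].
  by rewrite ge_min le_max; apply/andP; split; apply/orP; [left|right].
- by apply: (nex x).
Qed.

Lemma psi_itv i t : psi i t \in `[a i, b i]. Proof. by case: (psi_spec i t). Qed.
Lemma psiK i t : G i (psi i t) = clamp t. Proof. by case: (psi_spec i t). Qed.

Lemma branchK i x : x \in `[a i, b i] -> psi i (G i x) = x.
Proof.
move=> xab; have := psiK i (G i x); rewrite clampE; last first.
  rewrite in_itv/= -(mm_Ga H i) -(mm_Gb H i) !branch_mono ?a_itv ?b_itv//.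
by move/(inc_inj_in (@branch_mono i)); apply => //; exact: psi_itv.
Qed.

Lemma psi_clamp i t : psi i (clamp t) = psi i t.
Proof. by rewrite -(psiK i) branchK// psi_itv. Qed.

Lemma psi_le i s t : s <= t -> psi i s <= psi i t.
Proof.
move=> st; rewrite leNgt; apply/negP => /(branch_homo (psi_itv i t) (psi_itv i s)).
rewrite !psiK /clamp; by case: (ltP s 0) => ?; case: (ltP t 0) => ?; case: (ltP 1 s) => ?; case: (ltP 1 t) => ?; lra.
Qed.

Lemma psi_lip i s t : `|psi i s - psi i t| <= `|s - t| / 16%:R.
Proof.
wlog st : s t / s <= t.
  by move=> h; case: (leP s t) => [/h//|/ltW/h]; rewrite distrC (distrC t).
rewrite distrC (distrC s) !ger0_norm ?subr_ge0// ?psi_le//.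
rewrite ler_pdivlMr// mulrC.
apply: le_trans (branch_expand (psi_itv i s) (psi_itv i t) (psi_le i st)) _.
by rewrite !psiK (le_trans (ler_norm _))// (le_trans (clamp_lip _ _))// ger0_norm ?subr_ge0.
Qed.

Lemma psi_oc i t : t \in `]0, 1] -> psi i t \in `]a i, b i].
Proof.
move=> t01; have := psi_itv i t; rewrite !in_itv/= => /andP[+ ->].
rewrite le_eqVlt => /predU1P[ap|->//].
have := psiK i t; rewrite -ap (mm_Ga H) clampE ?subset_itv_oc_cc// => t0.
by exfalso; move: t01; rewrite -t0 in_itv/= ltxx.
Qed.

Lemma g_psi i t : t \in `]0, 1] -> g (psi i t) = t.
Proof.
move=> t01; rewrite (mm_g H (psi_oc i t01)) psiK clampE//.
exact: subset_itv_oc_cc.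
Qed.

Lemma psi_g i t : t \in `]a i, b i] -> psi i (g t) = t.
Proof. by move=> tab; rewrite (mm_g H tab) branchK//; exact: subset_itv_oc_cc. Qed.

Lemma piece_sub i t : t \in `]a i, b i] -> t \in `]0, 1].
Proof.
move=> tab; suff : `]0, 1]%classic t by [].
by rewrite -(mm_cover H); exists i.
Qed.

Lemma piece_ex t : t \in `]0, 1] -> exists i, t \in `]a i, b i].
Proof.
move=> t01; have : `]0, 1]%classic t by [].
by rewrite -(mm_cover H) => -[i _]; exists i.
Qed.

Lemma piece_uniq i j t : t \in `]a i, b i] -> t \in `]a j, b j] -> i = j.
Proof.
move=> ti tj; apply: contrapT => /eqP ij.
by have /trivIsetP/(_ i j I I ij)/seteqP[+ _] := mm_triv H; apply; split; [exact: ti|exact: tj].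
Qed.

Lemma g01 t : t \in `]0, 1] -> g t \in `]0, 1].
Proof.
move=> /piece_ex[i tab]; rewrite (mm_g H tab) in_itv/= -{1}(mm_Ga H i) -{1}(mm_Gb H i).
have tab' := subset_itv_oc_cc tab.
apply/andP; split; last by rewrite branch_mono ?b_itv// (itvP tab).
by apply: branch_homo; rewrite ?a_itv// (itvP tab).
Qed.

(** The derivative of the inverse branch. *)
Definition wt i t : R := (dG i (psi i t))^-1.

Lemma dG_gt0 i t : 0 < dG i (psi i t).
Proof. by rewrite (lt_le_trans _ (mm_exp H (psi_itv i t))). Qed.

Lemma wt_gt0 i t : 0 < wt i t. Proof. by rewrite invr_gt0 dG_gt0. Qed.

Lemma wt_dist i s t : wt i s <= expR (K * `|s - t|) * wt i t.
Proof.
rewrite /wt ler_pdivlMr ?dG_gt0// mulrC ler_pdivrMr ?dG_gt0//.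
apply: le_trans (mm_dist H (psi_itv i t) (psi_itv i s)) _.
rewrite ler_wpM2r ?(ltW (dG_gt0 _ _))// ler_expR ler_wpM2l ?(ltW (mm_K H))//.
by rewrite !psiK distrC clamp_lip.
Qed.

Lemma wt_clamp i t : wt i (clamp t) = wt i t.
Proof. by rewrite /wt psi_clamp. Qed.

Lemma psi_continuous i : continuous (psi i).
Proof.
move=> t; apply/cvgrPdist_le => /= e e0; near=> s.
rewrite (le_trans (psi_lip i t s))// ler_pdivrMr//.
have : `|t - s| <= e by near: s; apply: cvgr_dist_le.
by have := normr_ge0 (t - s); lra.
Unshelve. all: by end_near. Qed.

Lemma wt_continuous i : continuous (wt i).
Proof.
move=> t; apply: cvgV; first by rewrite gt_eqF// dG_gt0.
apply: (@continuous_comp _ _ _ (psi i) (dG i)); first exact: psi_continuous.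
exact: (mm_cont H (psi_itv i t)).
Qed.

Local Notation mu := (@lebesgue_measure R).

(** Only initial pieces [a_i, c] occur, because measures on the plane will be compared
    on quadrants. *)
Lemma branch_substitution i c (u : R -> R) : c \in `[a i, b i] -> continuous u ->
  (\int[mu]_(t in `[0%R, G i c]) (u (psi i t) * wt i t)%:E =
   \int[mu]_(t in `[a i, c]) (u t)%:E)%E.
Proof.
move=> cab cu; rewrite -{1}(mm_Ga H i).
have ac : a i <= c by rewrite (itvP cab).
have sub : `[a i, c] `<=` `[a i, b i].
  by apply: subset_itv; rewrite bnd_simp// (itvP cab).
have dGE x : x \in `[a i, c] -> derive1 (G i) x = dG i x.
  move=> xac; rewrite derive1E; have := mm_deriv H (sub x xac).
  by move=> ?; exact: derive_val.
have GcG x : x \in `[a i, b i] -> {for x, continuous (G i)}.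
  move=> xab; apply: differentiable_continuous; apply/derivable1_diffP.
  by have [] := mm_deriv H xab.
have dcvg x (F : set_system R) : Filter F -> x \in `[a i, b i] -> F `=>` nbhs x ->
    (\forall y \near F, y \in `[a i, c]) -> cvg (derive1 (G i) @ F).
  move=> FF xab Fx Fc; apply/cvg_ex; exists (dG i x).
  have H1 : dG i @ F --> dG i x.
    by apply: cvg_trans (mm_cont H xab); apply: cvg_app.
  apply: cvg_trans H1; apply: near_eq_cvg.
  by apply: filterS Fc => y /dGE ->.
move: (ac); rewrite le_eqVlt => /predU1P[<-|ac'].
  by rewrite !set_itv1 !integral_set1.
rewrite (@integration_by_substitution_increasing R (G i)
  (fun t => u (psi i t) * wt i t) (a i) c) //.
- apply: eq_integral => x; rewrite inE => xac /=; congr (_%:E).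
  rewrite fctE /= dGE// /wt branchK; last exact: sub.
  by rewrite mulfVK// gt_eqF// (lt_le_trans _ (mm_exp H (sub x xac))).
- by move=> x y xab yab; apply: branch_homo; exact: sub.
- move=> x xac.
  have xab := sub x (subset_itv_oo_cc xac).
  rewrite /continuous_at dGE ?subset_itv_oo_cc//.
  apply: cvg_trans (mm_cont H xab); apply: near_eq_cvg.
  near=> y; rewrite dGE//; apply: subset_itv_oo_cc.
  by near: y; exact: near_in_itvoo.
- apply: (dcvg (a i)); first exact: a_itv.
    exact: cvg_within.
  near=> y; rewrite in_itv/=; apply/andP; split; first by near: y; exact: nbhs_right_ge.
  by near: y; exact: nbhs_right_le.
- apply: (dcvg c) => //; first exact: cvg_within.
  near=> y; rewrite in_itv/=; apply/andP; split; last by near: y; exact: nbhs_left_le.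
  by near: y; exact: nbhs_left_ge.
- split.
  + move=> x xac; have := mm_deriv H (sub x (subset_itv_oo_cc xac)).
    by case.
  + by apply: cvg_at_right_filter; apply: GcG; exact: a_itv.
  + by apply: cvg_at_left_filter; exact: GcG.
- apply: continuous_subspaceT => t; apply: continuousM; last exact: wt_continuous.
  by apply: (@continuous_comp _ _ _ (psi i) u); [exact: psi_continuous|exact: cu].
Unshelve. all: by end_near. Qed.

End InverseBranches.

(** * The invariant density *)

(** An ultrafilter provides limits of all bounded sequences at once, which replaces
    the extraction of a subsequence converging at every point. *)
Lemma bounded_ultralimit (R : realType) : exists U : set_system nat,
  [/\ ProperFilter U, \oo `<=` U & forall (x : nat -> R) (l r : R),
     (forall n, l <= x n <= r) -> cvg (x @ U)].
Proof.
have [U [UU ooU]] := @ultraFilterLemma nat \oo _.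
exists U; split => // [|x l r xlr]; first exact: ultra_proper.
have PU : ProperFilter U by exact: ultra_proper.
have [|p [_ clp]] := @segment_compact R l r (x @ U).
  apply: (@filterS _ U _ setT); last exact: filterT.
  by move=> n _ /=; rewrite in_itv/=.
apply/cvg_ex; exists p => N /= Np.
have [//|UN] := in_ultra_setVsetC (x @^-1` N) UU.
have [y [Ny /=]] := clp (~` N) N UN Np.
by [].
Qed.

Lemma cvg_finite_sum (R : realType) (T I : Type) (F : set_system T) (r : seq I)
    (f : I -> T -> R) (l : I -> R) : Filter F ->
  (forall i, f i @ F --> l i) ->
  (fun x => \sum_(i <- r) f i x) @ F --> \sum_(i <- r) l i.
Proof.
move=> FF fl; elim: r => [|i r IH].
  rewrite big_nil (_ : (fun x => _) = fun=> 0); first exact: cvg_cst.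
  by apply/funext => x; rewrite big_nil.
rewrite big_cons (_ : (fun x => _) = fun x => f i x + \sum_(i <- r) f i x).
  exact: cvgD.
by apply/funext => x; rewrite big_cons.
Qed.

Lemma continuous_measurable_line (R : realType) (u : R -> R) (D : set (measurableTypeR R)) :
  continuous u -> measurable_fun D (u : measurableTypeR R -> R).
Proof. by move=> cu; apply: measurable_funTS; exact: continuous_measurable_fun. Qed.

Section InvariantDensity.
Context {R : realType} {d : nat} {a b : 'I_d -> R} {G dG : 'I_d -> R -> R}
  {K : R} {g : R -> R}.
Hypothesis H : markov_map a b G dG K g.
Implicit Types (i : 'I_d) (s t x y : R) (u : R -> R).
Local Notation psi := (@psi R d a b G).
Local Notation wt := (@wt R d a b G dG).
Local Notation mu := (@lebesgue_measure R).

Lemma psi01 i t : psi i t \in `[0, 1].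
Proof.
have := psi_itv H i t; rewrite !in_itv/= => /andP[ap pb].
have := mm_ab H i => ab.
have := @piece_sub _ _ _ _ _ _ _ _ H i (b i); rewrite !in_itv/= lexx ab => /(_ erefl)/andP[b0 b1].
have a0 : 0 <= a i.
  rewrite leNgt; apply/negP => a0.
  have := @piece_sub _ _ _ _ _ _ _ _ H i 0; rewrite !in_itv/= a0 (ltW b0) ltxx.
  by move=> /(_ erefl).
by rewrite (le_trans a0)//= (le_trans pb).
Qed.

(** The transfer operator of g, acting on densities. *)
Definition transfer u t : R := \sum_(i < d) u (psi i t) * wt i t.

Lemma transfer_clamp u t : transfer u (clamp t) = transfer u t.
Proof. by apply: eq_bigr => i _; rewrite (psi_clamp H) (wt_clamp H). Qed.

Lemma transfer_ge0 u : (forall t, 0 <= u t) -> forall t, 0 <= transfer u t.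
Proof.
by move=> u0 t; apply: sumr_ge0 => i _; rewrite mulr_ge0// ltW// (wt_gt0 H).
Qed.

Lemma transfer_continuous u : continuous u -> continuous (transfer u).
Proof.
move=> cu t; rewrite /transfer.
apply: (@cvg_finite_sum _ _ _ _ _ (fun i s => u (psi i s) * wt i s)) => i.
apply: (@continuousM _ _ (u \o psi i) (wt i)); last exact: (wt_continuous H).
by apply: continuous_comp; [exact: (psi_continuous H)|exact: cu].
Qed.

Definition log_lipschitz (C : R) u := forall s t, u s <= expR (C * `|s - t|) * u t.

(** Inverse branches contract by 16, so the constant 2 K of u is reduced to K / 8,
    and the distortion of the weights adds K. *)
Lemma transfer_log_lipschitz u : (forall t, 0 <= u t) ->
  log_lipschitz (2 * K) u -> log_lipschitz (2 * K) (transfer u).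
Proof.
move=> u0 lu s t; rewrite /transfer mulr_sumr; apply: ler_sum => i _.
have st := psi_lip H i s t.
apply: (@le_trans _ _ ((expR (2 * K * (`|s - t| / 16%:R)) * u (psi i t)) *
   (expR (K * `|s - t|) * wt i t))).
  apply: ler_pM => //; first exact/ltW/(wt_gt0 H).
    apply: le_trans (lu _ (psi i t)) _; apply: ler_wpM2r => //.
    rewrite ler_expR; apply: ler_wpM2l => //.
    by rewrite mulr_ge0// ltW// (mm_K H).
  exact: (wt_dist H).
rewrite mulrACA -expRD ler_wpM2r//.
  by rewrite mulr_ge0// ltW// (wt_gt0 H).
rewrite ler_expR; have := normr_ge0 (s - t); have := mm_K H; nra.
Qed.

Lemma integral_transfer u : continuous u -> (forall t, 0 <= u t) ->
  (\int[mu]_(t in `[0%R, 1%R]) (transfer u t)%:E =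
   \int[mu]_(t in `[0%R, 1%R]) (u t)%:E)%E.
Proof.
move=> cu u0.
have cL i : continuous (fun t => u (psi i t) * wt i t).
  move=> t; apply: (@continuousM _ _ (u \o psi i) (wt i)); last exact: (wt_continuous H).
  by apply: continuous_comp; [exact: (psi_continuous H)|exact: cu].
under eq_integral do rewrite /transfer -sumEFin.
rewrite ge0_integral_sum//; last 2 first.
- by move=> i; apply/measurable_EFinP; exact: continuous_measurable_line.
- by move=> i t _; rewrite lee_fin mulr_ge0// ltW// (wt_gt0 H).
have mu_ D : measurable_fun (D : set (measurableTypeR R)) (fun t => (u t)%:E).
  by apply/measurable_EFinP; exact: continuous_measurable_line.
rewrite -[RHS]integral_itv_obnd_cbnd; last exact: mu_.
rewrite -(mm_cover H).
rewrite (_ : \bigcup_i _ = \big[setU/set0]_(i < d) `]a i, b i]%classic); last first.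
  rewrite -bigcup_seq; apply: eq_bigcupl; split => // i _ /=.
  exact: mem_index_enum.
rewrite ge0_integral_bigsetU//=; last 3 first.
- exact: index_enum_uniq.
- exact: sub_trivIset (mm_triv H).
- by move=> t _; rewrite lee_fin.
apply: eq_bigr => i _; rewrite integral_itv_obnd_cbnd; last exact: mu_.
by rewrite -(branch_substitution H (b_itv H i) cu) (mm_Gb H).
Qed.

Definition density n : R -> R := iter n transfer (fun=> 1).

Lemma density_ge0 n t : 0 <= density n t.
Proof. by elim: n t => [|n IH] t //=; apply: transfer_ge0. Qed.

Lemma density_continuous (n : nat) : continuous (density n).
Proof.
elim: n => [|n IH]; first by move=> t; exact: cvg_cst.
exact: transfer_continuous.
Qed.

Lemma density_log_lipschitz n : log_lipschitz (2 * K) (density n).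
Proof.
elim: n => [|n IH] /=; last exact: (transfer_log_lipschitz (density_ge0 n)).
move=> s t; rewrite mulr1 -expR0 ler_expR mulr_ge0// mulr_ge0// ltW//.
exact: (mm_K H).
Qed.

Lemma integral_density n : (\int[mu]_(t in `[0%R, 1%R]) (density n t)%:E = 1)%E.
Proof.
elim: n => [|n IH] /=.
  by rewrite integral_cst//= mul1e lebesgue_measure_itv/= lte01 oppr0 adde0.
by rewrite integral_transfer//; [exact: density_continuous|exact: density_ge0].
Qed.

Lemma density_ratio n s t : s \in `[0, 1] -> t \in `[0, 1] ->
  density n s <= expR (2 * K) * density n t.
Proof.
move=> s01 t01; apply: le_trans (density_log_lipschitz n s t) _.
rewrite ler_wpM2r ?density_ge0// ler_expR -[leRHS]mulr1 ler_wpM2l//.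
  by rewrite mulr_ge0// ltW// (mm_K H).
by move: s01 t01; rewrite !in_itv/= ler_norml => /andP[? ?] /andP[? ?]; lra.
Qed.

Lemma integral_cst01 (c : R) : (\int[mu]_(t in `[0%R, 1%R]) c%:E = c%:E)%E.
Proof.
by rewrite integral_cst//= lebesgue_measure_itv/= lte_fin ltr01 oppr0 adde0 mule1.
Qed.

(** The mean over [0, 1] is 1, and [density_ratio] bounds the quotient of any two values. *)
Lemma density_bounds n t : t \in `[0, 1] ->
  expR (- (2 * K)) <= density n t <= expR (2 * K).
Proof.
move=> t01; have mD D : measurable_fun (D : set (measurableTypeR R))
    (fun t => (density n t)%:E).
  by apply/measurable_EFinP; exact: (continuous_measurable_line (@density_continuous n)).
have mc D (c : R) : measurable_fun (D : set (measurableTypeR R)) (fun=> c%:E).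
  exact: measurable_cst.
apply/andP; split.
- rewrite expRN -[leLHS]mulr1 ler_pdivrMl ?expR_gt0// -lee_fin -(integral_density n).
  rewrite -integral_cst01; apply: ge0_le_integral => //.
  + by move=> s _; rewrite lee_fin density_ge0.
  + by move=> s s01; rewrite lee_fin density_ratio.
- rewrite -[leRHS]mulr1 -ler_pdivrMl ?expR_gt0// -lee_fin -(integral_density n).
  rewrite -integral_cst01; apply: ge0_le_integral => //.
  + by move=> s _; rewrite lee_fin mulr_ge0 ?density_ge0// invr_ge0 expR_ge0.
  + by move=> s s01; rewrite lee_fin ler_pdivrMl ?expR_gt0// density_ratio.
Qed.

(** The Cesaro means sigma of the densities are almost fixed by the transfer operator:
    the error telescopes to two terms divided by n. Their ultralimit is fixed, and it
    inherits the bounds and the continuity from the uniform log-Lipschitz estimate. *)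
Lemma invariant_density : exists (rho : R -> R) (c C : R),
  [/\ 0 < c, continuous rho, forall t, c <= rho t <= C &
      forall t, transfer rho t = rho t].
Proof.
have [U [PU ooU cvgU]] := @bounded_ultralimit R.
pose c := expR (- (2 * K)); pose C := expR (2 * K).
pose sigma t n := n.+1%:R^-1 * \sum_(0 <= k < n.+1) density k (clamp t).
have sigma_bd t n : c <= sigma t n <= C.
  have n0 : 0 < n.+1%:R :> R by rewrite ltr0n.
  rewrite /sigma ler_pdivlMl// ler_pdivrMl//.
  have E (e : R) : n.+1%:R * e = \sum_(0 <= k < n.+1) e.
    by rewrite sumr_const_nat subn0 mulr_natl.
  rewrite !E; apply/andP; split; apply: ler_sum => k _.
    by have /andP[] := density_bounds k (clamp01 t).
  by have /andP[] := density_bounds k (clamp01 t).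
pose rho t := lim (sigma t @ U).
have sigma_rho t : sigma t @ U --> rho t by apply: (cvgU _ c C).
have rho_bd t : c <= rho t <= C.
  apply/andP; split.
    by apply: (limr_ge (cvgU _ _ _ (sigma_bd t))); near=> n; have /andP[] := sigma_bd t n.
  by apply: (limr_le (cvgU _ _ _ (sigma_bd t))); near=> n; have /andP[] := sigma_bd t n.
have rho_lip s t : rho s <= expR (2 * K * `|s - t|) * rho t.
  have -> : expR (2 * K * `|s - t|) * rho t =
      lim ((fun n => expR (2 * K * `|s - t|) * sigma t n) @ U).
    by apply/esym/cvg_lim => //; apply: cvgMr; exact: sigma_rho.
  apply: ler_lim; [exact: cvgU (sigma_bd s)| |].
    by apply/cvg_ex; eexists; apply: cvgMr; exact: sigma_rho.
  near=> n; rewrite /sigma mulrCA ler_pM2l ?invr_gt0 ?ltr0n// mulr_sumr.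
  apply: ler_sum => k _; apply: le_trans (density_log_lipschitz k _ (clamp t)) _.
  rewrite ler_wpM2r ?density_ge0// ler_expR ler_wpM2l ?clamp_lip//.
  by rewrite mulr_ge0// ltW// (mm_K H).
exists rho, c, C; split => //; first exact: expR_gt0.
  move=> t; apply/cvgrPdist_le => /= e e0.
  have : expR (2 * K * `|t - s|) @[s --> t] --> expR (2 * K * `|t - t|).
    apply: continuous_cvg; first exact: continuous_expR.
    apply: cvgMr; apply: cvg_norm; apply: cvgB; [exact: cvg_cst|exact: cvg_id].
  rewrite subrr normr0 mulr0 expR0 => /cvgrPdist_le /(_ (e / C)) h.
  have C0 : 0 < C by exact: expR_gt0.
  near=> s.
  have : `|1 - expR (2 * K * `|t - s|)| <= e / C.
    by near: s; apply: h; rewrite divr_gt0.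
  rewrite distrC ler_norml => /andP[_]; rewrite lerBlDr.
  have := rho_lip t s; have := rho_lip s t; rewrite (distrC s).
  have /andP[r1 r2] := rho_bd s; have /andP[r3 r4] := rho_bd t.
  set E := expR _ => h1 h2 h3.
  have c0 : 0 < c by exact: expR_gt0.
  have CE : C * (E - 1) <= e by rewrite -ler_pdivlMl// mulrC; lra.
  have E1 : 1 <= E by rewrite -expR0 ler_expR !mulr_ge0// ltW// (mm_K H).
  rewrite ler_norml; apply/andP; split; nra.
move=> t.
have H1 : transfer (fun s => sigma s n) t @[n --> U] --> transfer rho t.
  apply: (@cvg_finite_sum _ _ _ _ _ (fun i n => sigma (psi i t) n * wt i t)) => i.
  by apply: cvgMl; exact: sigma_rho.
have H2 : transfer (fun s => sigma s n) t @[n --> U] --> rho t.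
  have E n : transfer (fun s => sigma s n) t = sigma t n +
      n.+1%:R^-1 * (density n.+1 (clamp t) - density 0 (clamp t)).
    rewrite /transfer /sigma.
    under eq_bigr do rewrite -mulrA mulr_suml.
    rewrite -mulr_sumr exchange_big /= -mulrDr; congr (_ * _).
    transitivity (\sum_(0 <= k < n.+1) density k.+1 (clamp t)).
      apply: eq_bigr => k _ /=; rewrite transfer_clamp.
      by apply: eq_bigr => i _; rewrite clampE// psi01.
    have := telescope_sumr (fun k => density k (clamp t)) (leq0n n.+1).
    by rewrite sumrB => /eqP; rewrite subr_eq addrC => /eqP.
  rewrite (_ : (fun n => _) = (fun n => sigma t n +
      n.+1%:R^-1 * (density n.+1 (clamp t) - density 0 (clamp t)))); last first.
    by apply/funext => n; exact: E.
  rewrite -[X in _ --> X]addr0; apply: cvgD; first exact: sigma_rho.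
  apply: (@cvg_trans _ ((fun n => n.+1%:R^-1 * (density n.+1 (clamp t) - density 0 (clamp t))) @ \oo)).
    by move=> A /= HA; apply: ooU.
  apply/cvgrPdist_le => /= e e0.
  have C0 : 0 < C by exact: expR_gt0.
  have [N HN] := real_lt_nat (C / e).
  near=> n.
  have n0 : 0 < n.+1%:R :> R by rewrite ltr0n.
  rewrite sub0r normrN normrM gtr0_norm ?invr_gt0// ler_pdivrMl//.
  apply: (@le_trans _ _ C).
    have /andP[h1 h2] := density_bounds n.+1 (clamp01 t).
    have /andP[h3 h4] := density_bounds 0 (clamp01 t).
    have c0 : 0 < c by exact: expR_gt0.
    move: h1 h2 h3 h4; rewrite -/c -/C.
    set D1 := density n.+1 _; set D2 := density 0 _ => h1 h2 h3 h4.
    by change (`|D1 - D2| <= C); rewrite ler_norml; apply/andP; split; lra.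
  rewrite -ler_pdivrMr//; apply/ltW/(lt_le_trans HN); rewrite ler_nat.
  by apply: leqW; near: n; exact: nbhs_infty_ge.
rewrite -(cvg_lim (@Rhausdorff R) H1); exact: cvg_lim.
Unshelve. all: by end_near. Qed.

End InvariantDensity.

(** * The natural extension of the base map *)

Lemma measurable_fun_piecewise d1 d2 (T1 : measurableType d1) (T2 : measurableType d2)
    (I : finType) (E : I -> set T1) (f : T1 -> T2) :
  (forall i, measurable (E i)) -> (forall i, measurable_fun (E i) f) ->
  measurable_fun (\bigcup_i E i) f.
Proof.
move=> mE mf _ B mB; rewrite setI_bigcupl.
by apply: countable_bigcupT_measurable => [|i]; [exact: countableP|exact: mf].
Qed.

Lemma mnormalizeE d (T : measurableType d) (R : realType)
    (mu : {measure set T -> \bar R}) (P : probability T R) (M : R) A :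
  0 < M -> mu setT = M%:E -> mnormalize mu P A = (mu A * M^-1%:E)%E.
Proof. by move=> M0 muT; rewrite /mnormalize muT /= orbF eqe gt_eqF. Qed.

Section NaturalExtension.
Context {R : realType} {d : nat} {a b : 'I_d -> R} {G dG : 'I_d -> R -> R}
  {K : R} {g : R -> R}.
Hypothesis H : markov_map a b G dG K g.
Implicit Types (i : 'I_d) (s t x y : R) (u : R -> R).
Local Notation psi := (@psi R d a b G).
Local Notation wt := (@wt R d a b G dG).
Local Notation transfer := (@transfer R d a b G dG).
Local Notation leb := (@lebesgue_measure R).
Local Notation leb2 := ((@lebesgue_measure R \x @lebesgue_measure R)%E : set (plane R) -> \bar R).

Definition strip (T : set R) (lo len : R -> R) : set (plane R) :=
  [set z | T z.1 /\ lo z.1 < z.2 <= lo z.1 + len z.1].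

Lemma measurable_strip (T : set (line R)) (lo len : R -> R) : measurable T ->
  continuous lo -> continuous len -> measurable (strip T lo len).
Proof.
move=> mT clo clen.
have mc (u : R -> R) : continuous u -> measurable_fun setT (fun z : plane R => u z.1 : R).
  move=> cu; apply: continuous_measurable_plane => z.
  by apply: (@continuous_comp _ _ _ fst u); [exact: cvg_fst|exact: cu].
have m2 : measurable_fun setT (fun z : plane R => z.2 : R).
  by apply: continuous_measurable_plane => z; exact: cvg_snd.
rewrite (_ : strip T lo len = (fst @^-1` T) `&`
   ((fun z : plane R => z.2 - lo z.1) @^-1` `]0, +oo[ `&`
    (fun z : plane R => z.2 - lo z.1 - len z.1) @^-1` `]-oo, 0])); last first.
  apply/seteqP; split => z /=; rewrite /strip /= !in_itv/= andbT.
    by move=> [? /andP[? ?]]; split => //; split; lra.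
  by move=> [? [? ?]]; split => //; apply/andP; split; lra.
have mlo := measurable_funB m2 (mc _ clo).
apply: measurableI; first by rewrite -[X in measurable X]setTI; exact: measurable_fst.
apply: measurableI; rewrite -[X in measurable X]setTI.
  by apply: mlo => //; exact: measurable_itv.
by apply: (measurable_funB mlo (mc _ clen)) => //; exact: measurable_itv.
Qed.

Lemma lebesgue2_strip (T : set (line R)) (lo len : R -> R) : measurable T ->
  continuous lo -> continuous len -> (forall t, 0 <= len t) ->
  leb2 (strip T lo len) = (\int[leb]_(t in T) (len t)%:E)%E.
Proof.
move=> mT clo clen len0; rewrite /product_measure1 /=.
rewrite [RHS]integral_mkcond; apply: eq_integral => t _ /=.
rewrite patchE; case: ifPn => [|tT]; last first.
  rewrite (_ : xsection _ _ = set0) ?measure0//.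
  apply/seteqP; split => s //; rewrite xsectionE /= => -[] /= /mem_set.
  by rewrite (negbTE tT).
move=> /set_mem tT.
rewrite (_ : xsection _ _ = `]lo t, (lo t + len t)]%classic).
  rewrite lebesgue_measure_itv/= lte_fin; case: ltP => [h|h].
    by rewrite -EFinD addrAC subrr add0r.
  by congr EFin; have := len0 t; lra.
by rewrite xsectionE; apply/seteqP; split => s /=; rewrite /strip /= in_itv/=; [case|].
Qed.

Context {rho : R -> R} {c C : R}.
Hypothesis c0 : 0 < c.
Hypothesis rho_cont : continuous rho.
Hypothesis rho_bd : forall t, c <= rho t <= C.
Hypothesis rho_inv : forall t, transfer rho t = rho t.

Let rho_gt0 t : 0 < rho t.
Proof. by have /andP[+ _] := rho_bd t; exact: lt_le_trans. Qed.

Let zero_cont : continuous (fun _ : R => 0 : R).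
Proof. by move=> t; exact: cvg_cst. Qed.

(** The vertical segment over t, of length rho t, is cut into slots of lengths
    rho (psi i t) * wt i t, which add up to rho t since rho is invariant. Sending
    the i-th slot affinely onto the segment over psi i t preserves area: the factor
    wt i by which the base is contracted is the inverse of the vertical stretching.
    So the height of a point encodes a choice of preimages, that is, a past. *)
Definition tower : set (plane R) := strip `]0, 1]%classic (fun=> 0) rho.

Lemma measurable_tower : measurable tower.
Proof. by apply: measurable_strip => //; exact: measurable_itv. Qed.

Definition slot i t : R := rho (psi i t) * wt i t.
Definition floor_of i t : R := \sum_(j < d | (j < i)%N) slot j t.

Let slot_gt0 i t : 0 < slot i t.
Proof. by rewrite mulr_gt0// (wt_gt0 H). Qed.

Let slot_cont i : continuous (slot i).
Proof.
move=> t; apply: (@continuousM _ _ (rho \o psi i) (wt i)); last exact: (wt_continuous H).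
by apply: continuous_comp; [exact: (psi_continuous H)|exact: rho_cont].
Qed.

Let floor_cont i : continuous (floor_of i).
Proof.
move=> t; rewrite /floor_of /continuous_at -[X in _ --> X]big_filter.
rewrite (_ : (fun x => _) = fun x => \sum_(j <- [seq j : 'I_d <- index_enum 'I_d | (j < i)%N]) slot j x).
  by apply: (cvg_finite_sum (f := fun j x => slot j x)) => j; exact: slot_cont.
by apply/funext => x; rewrite big_filter.
Qed.

Lemma floor_top i t : floor_of i t + slot i t <= rho t.
Proof.
rewrite -[leRHS]rho_inv /transfer (bigID (fun j : 'I_d => (j < i)%N)) /= lerD2l.
rewrite (bigD1 i) ?ltnn//= lerDl sumr_ge0// => j _; exact/ltW/slot_gt0.
Qed.

Lemma floor_next i (j : 'I_d) t : (i < j)%N -> floor_of i t + slot i t <= floor_of j t.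
Proof.
move=> ij; rewrite /floor_of [leRHS](bigID (fun k : 'I_d => (k < i)%N)) /=.
rewrite (eq_bigl (fun k : 'I_d => (k < j)%N && (k < i)%N)); last first.
  by move=> k /=; case: ltnP => ki; rewrite ?andbF// andbT (ltn_trans ki).
rewrite lerD2l (bigD1 i) ?ij ?ltnn//= lerDl sumr_ge0// => k _; exact/ltW/slot_gt0.
Qed.

Definition brick i : set (plane R) := strip `]0, 1]%classic (floor_of i) (slot i).

Lemma measurable_brick i : measurable (brick i).
Proof. by apply: measurable_strip => //; exact: measurable_itv. Qed.

Lemma brick_tower i : brick i `<=` tower.
Proof.
move=> [t s]; rewrite /brick /tower /strip /= => -[-> /andP[h1 h2]]; split => //.
rewrite add0r (le_trans h2 (floor_top i t)) andbT (le_lt_trans _ h1)//.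
by apply: sumr_ge0 => j _; exact/ltW/slot_gt0.
Qed.

Lemma tower_brick z : tower z -> exists i, brick i z.
Proof.
move: z => [t s]; rewrite /tower /strip /= add0r => -[t01 /andP[s0 sr]].
have d0 : (0 < d)%N.
  by have [i _] := piece_ex H t01; exact: leq_ltn_trans (ltn_ord i).
pose top n := \sum_(j < d | (j < n)%N) slot j t.
have topd : top d = rho t.
  by rewrite -rho_inv /transfer /top; apply: eq_bigl => j; rewrite ltn_ord.
have ex : exists n, s <= top n by exists d; rewrite topd.
case: (ex_minnP ex) => -[|n] hn hmin.
  by move: hn; rewrite /top big_pred0// leNgt s0.
have nd : (n < d)%N by apply: hmin; rewrite topd.
exists (Ordinal nd); rewrite /brick /strip /=; split => //; apply/andP; split.
  rewrite ltNge; apply/negP => h.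
  by have := hmin n h; rewrite ltnn.
apply: le_trans hn _; rewrite /top (bigD1 (Ordinal nd)) /= ?ltnSn// addrC lerD2r.
rewrite /floor_of (eq_bigl (fun j : 'I_d => (j < n)%N))// => j /=.
rewrite ltnS leq_eqVlt -val_eqE /=.
by case: eqP => [->|]; rewrite ?ltnn ?andbF// andbT.
Qed.

Lemma brick_uniq i j z : brick i z -> brick j z -> i = j.
Proof.
move: z => [t s]; rewrite /brick /strip /= => -[_ /andP[i1 i2]] [_ /andP[j1 j2]].
by case: (ltngtP (val i) (val j)) => [h|h|/val_inj//]; exfalso;
  have := floor_next t h; lra.
Qed.

Definition up i (z : plane R) : plane R :=
  (psi i z.1, (z.2 - floor_of i z.1) / wt i z.1).

(** On brick i the past begins with letter i; the constant value off the bricks keeps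
    the map measurable. *)
Definition past (z : plane R) : plane R :=
  if [pick i | `[< brick i z >]] is Some i then up i z else (1, rho 1).

Lemma pastE i z : brick i z -> past z = up i z.
Proof.
move=> bi; rewrite /past; case: pickP => [j /asboolP bj|/(_ i)/asboolP//].
by rewrite (brick_uniq bi bj).
Qed.

Lemma past_tower z : tower z -> tower (past z).
Proof.
move=> /tower_brick[i bi]; rewrite (pastE bi); move: bi.
move: z => [t s]; rewrite /brick /tower /strip /= => -[t01 /andP[h1 h2]].
split; first exact: (piece_sub H (psi_oc H i t01)).
rewrite add0r divr_gt0 ?subr_gt0 ?(wt_gt0 H)//= ler_pdivrMr ?(wt_gt0 H)//.
by rewrite lerBlDl.
Qed.

Lemma g_past z : tower z -> g (past z).1 = z.1.
Proof.
by move=> /tower_brick[i bi]; rewrite (pastE bi) /= (g_psi H)//; case: bi.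
Qed.

Let mfst (u : R -> R) : continuous u -> measurable_fun setT (fun z : plane R => u z.1 : R).
Proof.
move=> cu; apply: continuous_measurable_plane => z.
by apply: (@continuous_comp _ _ _ fst u); [exact: cvg_fst|exact: cu].
Qed.

Let measurable_up i : measurable_fun setT (up i).
Proof.
apply/measurable_fun_pairP; split => /=.
  by apply: mfst; exact: (psi_continuous H).
apply: continuous_measurable_plane => z; apply: cvgM.
  apply: cvgB; first exact: cvg_snd.
  by apply: (@continuous_comp _ _ _ fst (floor_of i)); [exact: cvg_fst|exact: floor_cont].
apply: cvgV; first by rewrite gt_eqF// (wt_gt0 H).
by apply: (@continuous_comp _ _ _ fst (wt i)); [exact: cvg_fst|exact: (wt_continuous H)].
Qed.

Lemma measurable_past : measurable_fun setT past.
Proof.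
have mb : measurable (\bigcup_i brick i).
  apply: countable_bigcupT_measurable => [|i]; [exact: countableP|exact: measurable_brick].
rewrite -(setUv (\bigcup_i brick i)); apply/measurable_funU => //.
  exact: measurableC.
split.
  apply: measurable_fun_piecewise => i; first exact: measurable_brick.
  apply: (eq_measurable_fun (up i)).
    by move=> z /set_mem bz; rewrite (pastE bz).
  exact: measurable_funTS.
apply: (eq_measurable_fun (fun _ : plane R => (1, rho 1) : plane R)); last exact: measurable_cst.
move=> z /set_mem nz; rewrite /past; case: pickP => // i /asboolP bz.
by exfalso; apply: nz; exists i.
Qed.

(** The part of brick i sent into a quadrant is again a strip, because the slot is
    mapped affinely. Its area is an integral over an initial piece of [0, 1], which the
    substitution along branch i turns into the area of the part of the quadrant over
    ]a_i, b_i]. *)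
Lemma past_quadrant (e f : R) :
  leb2 (past @^-1` quadrant e f `&` tower) = leb2 (quadrant e f `&` tower).
Proof.
pose v (t : R) : R := Num.max 0 (Num.min f (rho t)).
have v_cont : continuous v.
  move=> t; apply: (@continuous_max _ _ (fun=> 0) (fun t => Num.min f (rho t))).
    exact: cvg_cst.
  apply: (@continuous_min _ _ (fun=> f) rho); [exact: cvg_cst|exact: rho_cont].
have v0 t : 0 <= v t by rewrite le_max lexx.
have mv D : measurable_fun (D : set (line R)) (fun t => (v t)%:E).
  by apply/measurable_EFinP; exact: continuous_measurable_line.
pose T i := `]0, 1]%classic `&` [set t | psi i t <= e].
pose piece i : set (plane R) := strip (T i) (floor_of i) (fun t => v (psi i t) * wt i t).
have vw_cont i : continuous (fun t => v (psi i t) * wt i t).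
  move=> t; apply: (@continuousM _ _ (v \o psi i) (wt i)); last exact: (wt_continuous H).
  by apply: continuous_comp; [exact: (psi_continuous H)|exact: v_cont].
have vw0 i t : 0 <= v (psi i t) * wt i t by rewrite mulr_ge0// ltW// (wt_gt0 H).
have vslot i t : v (psi i t) * wt i t <= slot i t.
  by rewrite ler_wpM2r ?(ltW (wt_gt0 H i t))// ge_max ltW//= ge_min lexx orbT.
have T_E i : T i = if e < a i then set0 else `]0, G i (Num.min e (b i))]%classic.
  case: ltP => eai; apply/seteqP; split => t; rewrite /T //= ?in_itv/=.
  - by move=> [_ h]; have := psi_itv H i t; rewrite in_itv/= => /andP[h1 _]; lra.
  - move=> [t01 h]; have t01' : t \in `]0, 1] by rewrite in_itv.
    case/andP: t01 => -> t1 /=.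
    rewrite -[leLHS](@clampE _ t) ?subset_itv_oc_cc// -(psiK H i).
    rewrite (branch_mono H) ?(psi_itv H)//.
      by rewrite le_min h; have := psi_itv H i t; rewrite in_itv/= => /andP[_ ->].
    rewrite in_itv/= le_min eai (ltW (mm_ab H i))/= ge_min lexx orbT//.
  - have mab : Num.min e (b i) \in `[a i, b i].
      by rewrite in_itv/= le_min eai (ltW (mm_ab H i))/= ge_min lexx orbT.
    move=> /andP[t0 tG].
    have t1 : t <= 1.
      rewrite (le_trans tG)// -(mm_Gb H i) (branch_mono H) ?(b_itv H)//.
      by rewrite ge_min lexx orbT.
    have t01' : t \in `]0, 1] by rewrite in_itv/= t0.
    split; first by rewrite t0.
    move: tG; rewrite -{1}(@clampE _ t) ?subset_itv_oc_cc// -(psiK H i).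
    by rewrite (branch_mono H) ?(psi_itv H)// le_min => /andP[].
have mT i : measurable (T i : set (line R)).
  by rewrite T_E; case: ifP => // _; exact: measurable_itv.
have int_piece i : leb2 (piece i) = (\int[leb]_(t in `]a i, b i] `&` `]-oo, e]) (v t)%:E)%E.
  rewrite lebesgue2_strip// T_E; case: ltP => eai.
    rewrite (_ : _ `&` _ = set0) ?integral_set0//.
    by apply/seteqP; split => t //=; rewrite !in_itv/= => -[/andP[? ?] ?]; lra.
  rewrite (_ : _ `&` _ = `]a i, (Num.min e (b i))]%classic); last first.
    apply/seteqP; split => t /=; rewrite !in_itv/= le_min.
      by move=> [/andP[-> ->] ->].
    by move=> /andP[-> /andP[-> ->]].
  have mab : Num.min e (b i) \in `[a i, b i].
    by rewrite in_itv/= le_min eai (ltW (mm_ab H i))/= ge_min lexx orbT.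
  rewrite integral_itv_obnd_cbnd; last first.
    by apply/measurable_EFinP; exact: continuous_measurable_line.
  by rewrite [LHS]integral_itv_obnd_cbnd ?(branch_substitution H)//;
     apply/measurable_EFinP; exact: continuous_measurable_line.
transitivity (\sum_(i < d) leb2 (piece i)).
  rewrite (_ : _ `&` _ = \big[setU/set0]_(i < d) piece i); last first.
    rewrite -bigcup_seq; apply/seteqP; split => z.
      move=> [+ /[dup] /tower_brick[i bz]]; rewrite /preimage /= (pastE bz) => -[/= h1 h2] tz.
      exists i => /=; first exact: mem_index_enum.
      move: bz h1 h2; rewrite /brick /piece /strip /= => -[z1 /andP[h3 h4]].
      rewrite !in_itv/= => h1 h2; split => //; apply/andP; split => //.
      move: h2; rewrite ler_pdivrMr ?(wt_gt0 H)// lerBlDl => h2.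
      apply: (@le_trans _ _ (floor_of i z.1 + Num.min f (rho (psi i z.1)) * wt i z.1)).
        by move: h4; rewrite /slot; case: (leP f).
      by rewrite lerD2l ler_wpM2r ?(ltW (wt_gt0 H i z.1))// le_max lexx orbT.
    move=> [i /= _ pz]; have bz : brick i z.
      move: pz; rewrite /piece /brick /strip /= => -[[z1 _] /andP[h1 h2]].
      by split => //; rewrite h1/= (le_trans h2)// lerD2l.
    split; last exact: brick_tower bz.
    rewrite /preimage /= (pastE bz) /quadrant /=.
    move: pz; rewrite /piece /strip /T /= => -[[z1 pe] /andP[h1 h2]].
    rewrite !in_itv/= pe; split => //.
    rewrite ler_pdivrMr ?(wt_gt0 H)// lerBlDl (le_trans h2)// lerD2l.
    have [m0|m0] := leP (Num.min f (rho (psi i z.1))) 0.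
      by exfalso; move: h2; rewrite /v (max_l m0) mul0r addr0; lra.
    rewrite ler_wpM2r ?(ltW (wt_gt0 H i z.1))//.
    have -> : v (psi i z.1) = Num.min f (rho (psi i z.1)) by rewrite /v max_r ?ltW.
    by rewrite ge_min lexx.
  rewrite measure_bigsetU_ord//.
    move=> i; apply: measurable_strip => //; exact: floor_cont.
  move=> i j _ _ [z [pi pj]]; have sub k : piece k `<=` brick k.
    move=> y; rewrite /piece /brick /strip /= => -[[z1 _] /andP[h1 h2]].
    by split => //; rewrite h1/= (le_trans h2)// lerD2l.
  exact: brick_uniq (sub _ _ pi) (sub _ _ pj).
under eq_bigr do rewrite int_piece.
rewrite (_ : _ `&` tower = strip (`]0, 1] `&` `]-oo, e])%classic (fun=> 0) v); last first.
  apply/seteqP; split => z; rewrite /quadrant /tower /strip /= !in_itv/= !add0r /v.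
    move=> [[h1 h2] [h3 /andP[h4 h5]]]; split => //.
    by rewrite h4 le_max le_min h2 h5 orbT.
  move=> [[h1 h2] /andP[h3]].
  rewrite le_max leNgt h3/= le_min => /andP[-> ->].
  by split.
rewrite lebesgue2_strip//; last by apply: measurableI; exact: measurable_itv.
rewrite -(mm_cover H) setI_bigcupl.
rewrite (_ : \bigcup_i _ = \big[setU/set0]_(i < d) (`]a i, b i] `&` `]-oo, e])%classic); last first.
  rewrite -bigcup_seq; apply: eq_bigcupl; split => // i _ /=.
  exact: mem_index_enum.
rewrite ge0_integral_bigsetU//=.
- by move=> i; apply: measurableI; exact: measurable_itv.
- exact: index_enum_uniq.
- apply: (sub_trivIset (D' := setT)) => //.
  by apply: trivIset_setIr; exact: (mm_triv H).
- by move=> t _; rewrite lee_fin.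
Qed.

Lemma tower_slice (A : set (line R)) : measurable A -> A `<=` `]0, 1]%classic ->
  (c%:E * leb A <= leb2 ((A `*` setT) `&` tower) <= C%:E * leb A)%E.
Proof.
move=> mA A01; rewrite (_ : _ `&` _ = strip A (fun=> 0) rho); last first.
  apply/seteqP; split => z; rewrite /tower /strip /=; first by move=> [[? _] [_ ?]].
  by move=> [Az ?]; split => //; split => //; exact: A01.
rewrite lebesgue2_strip//; last by move=> t; exact/ltW.
have mr : measurable_fun A (fun t => (rho t)%:E).
  by apply/measurable_EFinP; exact: continuous_measurable_line.
rewrite -!integral_cst//; apply/andP; split; apply: ge0_le_integral => //.
- by move=> t _; rewrite lee_fin ltW.
- by move=> t _; rewrite lee_fin; have /andP[] := rho_bd t.
- by move=> t _; rewrite lee_fin ltW.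
- by move=> t _; rewrite lee_fin; have /andP[] := rho_bd t.
Qed.

Let tower_mass : (c%:E <= leb2 tower <= C%:E)%E.
Proof.
have := @tower_slice `]0, 1]%classic (measurable_itv _) (@subset_refl _ _).
rewrite lebesgue_measure_itv/= lte_fin ltr01 oppr0 adde0 !mule1.
rewrite (_ : _ `&` tower = tower)//; apply/setIidPr.
by move=> z; rewrite /tower /strip /= => -[].
Qed.

Definition tower_measure : probability (plane R) R :=
  mnormalize (mrestr leb2 measurable_tower) (dirac ((0, 0) : plane R)).

Lemma tower_measureE : exists2 M : R, 0 < M &
  forall A, tower_measure A = (leb2 (A `&` tower) * M^-1%:E)%E.
Proof.
have /andP[h1 h2] := tower_mass.
have fin : leb2 tower \is a fin_num.
  by rewrite ge0_fin_numE ?(le_lt_trans h2) ?ltry//.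
have M0 : 0 < fine (leb2 tower).
  by rewrite -lte_fin fineK// (lt_le_trans _ h1)// lte_fin.
exists (fine (leb2 tower)) => // A.
apply: (mnormalizeE (mu := mrestr leb2 measurable_tower)) => //.
by rewrite fineK// -[LHS]/(leb2 (setT `&` tower)) setTI.
Qed.

End NaturalExtension.

(** The map W moves one step back in time, so that g recovers the first coordinate. By
    the last clause the distribution of that coordinate has the same null sets as
    Lebesgue measure. *)
Record base_extension (R : realType) (g : R -> R) (m : probability (plane R) R)
    (W : plane R -> plane R) (Q : set (plane R)) (c C : R) : Prop := BaseExtension {
  be_meas : measurable Q;
  be_full : m Q = 1%E;
  be_c : 0 < c;
  be_shift : measurable_fun setT W;
  be_inv : forall A : set (plane R), measurable A -> m (W @^-1` A) = m A;
  be_base : forall z, Q z -> [/\ z.1 \in `]0, 1], Q (W z) & g (W z).1 = z.1];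
  be_marg : forall A : set (line R), measurable A -> A `<=` `]0, 1]%classic ->
    (c%:E * lebesgue_measure A <= m (A `*` setT) <= C%:E * lebesgue_measure A)%E }.

Theorem natural_extension (R : realType) (d : nat) (a b : 'I_d -> R)
    (G dG : 'I_d -> R -> R) (K : R) (g : R -> R) :
  markov_map a b G dG K g ->
  exists (m : probability (plane R) R) (W : plane R -> plane R) (Q : set (plane R)) (c C : R),
    base_extension g m W Q c C.
Proof.
move=> H; have [rho [c [C [c0 rc rb ri]]]] := invariant_density H.
have mt := @measurable_tower R rho rc.
have [M M0 mE] := tower_measureE c0 rc rb.
pose W := @past R d a b G dG rho.
exists (@tower_measure R rho rc), W, (@tower R rho), (c / M), (C / M).
have meas : measurable_fun setT W by exact: (measurable_past H c0 rc rb).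
split => //.
- have <- := @probability_setT _ _ _ (@tower_measure R rho rc).
  by rewrite !mE setTI setIid.
- by rewrite divr_gt0.
- move=> A mA.
  have mpA : measurable (W @^-1` A) by rewrite -[X in measurable X]setTI; exact: meas.
  have -> : (@tower_measure R rho rc) (W @^-1` A) = pushforward (@tower_measure R rho rc) W A by [].
  apply: plane_measure_unique => //=.
    by rewrite /pushforward preimage_setT probability_setT ltry.
  move=> e f; rewrite /pushforward !mE.
  by rewrite -(past_quadrant H c0 rc rb ri e f).
- move=> z Qz; split; first by case: Qz.
    exact: (past_tower H c0 rb ri Qz).
  exact: (g_past H c0 rb ri Qz).
- move=> A mA A01; rewrite mE.
  have /andP[h1 h2] := tower_slice c0 rc rb mA A01.
  rewrite !EFinM !(muleAC _ _ (@lebesgue_measure R A)).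
  by apply/andP; split; apply: lee_wpmul2r => //; rewrite lee_fin invr_ge0 ltW.
Qed.

(** * Image measures and measure-preserving maps *)

Section ImageMeasure.
Context d1 d2 (T1 : measurableType d1) (T2 : measurableType d2) (R : realType).
Variables (f : T1 -> T2).
Variable mf : measurable_fun setT f.

Definition image_measure (mu : {measure set T1 -> \bar R}) : {measure set T2 -> \bar R}.
Proof. by refine (pushforward mu f : {measure set T2 -> \bar R}). Defined.

Lemma image_measureE mu A : image_measure mu A = mu (f @^-1` A).
Proof. by []. Qed.

Variable P : probability T1 R.
Definition image_probability_fun := image_measure P : set T2 -> \bar R.
HB.instance Definition _ := Measure.copy image_probability_fun (image_measure P).
Lemma image_probability_setT : image_probability_fun setT = 1%E.
Proof. exact: (@probability_setT _ _ _ P). Qed.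
HB.instance Definition _ := Measure_isProbability.Build _ _ _ image_probability_fun image_probability_setT.
Definition image_probability : probability T2 R := image_probability_fun.
Lemma image_probabilityE A : image_probability A = P (f @^-1` A).
Proof. by []. Qed.
End ImageMeasure.

Lemma measurable_fun_split d1 d2 (T1 : measurableType d1) (T2 : measurableType d2)
    (D : set T1) (u v w : T1 -> T2) :
  measurable D -> measurable_fun D v -> measurable_fun setT w ->
  (forall z, D z -> u z = v z) -> (forall z, ~ D z -> u z = w z) ->
  measurable_fun setT u.
Proof.
move=> mD mv mw uv uw; rewrite -(setUv D).
apply/measurable_funU; [exact: mD|exact: measurableC|split].
  by apply: (eq_measurable_fun v) => // z /set_mem zr; rewrite uv.
apply: (eq_measurable_fun w); last exact: measurable_funTS.
by move=> z /set_mem zr; rewrite uw.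
Qed.

Section MeasurePreserving.
Context d (T : measurableType d) (R : realType) (P : probability T R).

Lemma probability_eq_on (Q A B : set T) :
  measurable Q -> P Q = 1%E -> measurable A -> measurable B ->
  (forall z, Q z -> A z <-> B z) -> P A = P B.
Proof.
move=> mQ Q1 mA mB AB.
have Q0 : P (~` Q) = 0%E by rewrite probability_setC// Q1 subee.
have E C : measurable C -> P C = P (C `&` Q).
  move=> mC; have -> : P C = (P (C `\` Q) + P (C `&` Q))%E by exact: measureDI.
  rewrite [X in (X + _)%E](_ : _ = 0%E) ?add0e//.
  apply/eqP; rewrite eq_le measure_ge0 andbT -Q0; apply: le_measure; rewrite ?inE.
  - exact: measurableD.
  - exact: measurableC.
  - by move=> z [].
rewrite (E A)// (E B)//; congr (P _); apply/seteqP.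
by split => z [zA zQ]; split => //; apply/(AB z zQ).
Qed.

Variables (tau : T -> T).
Hypothesis mtau : measurable_fun setT tau.

Lemma measurable_iter n : measurable_fun setT (iter n tau).
Proof.
elim: n => [|n IH]; first exact: measurable_id.
rewrite (_ : iter n.+1 tau = tau \o iter n tau)//; exact: measurableT_comp.
Qed.

Lemma iter_invariant n : (forall A, measurable A -> P (tau @^-1` A) = P A) ->
  forall A, measurable A -> P (iter n tau @^-1` A) = P A.
Proof.
move=> inv; elim: n => [|n IH] A mA //.
have mt : measurable (tau @^-1` A).
  by rewrite -[X in measurable X]setTI; exact: mtau.
by rewrite -[RHS](inv A mA) -[RHS](IH _ mt).
Qed.
End MeasurePreserving.

(** * Cylinders and bounded distortion *)

Section Cylinders.
Context {R : realType} {d : nat} {a b : 'I_d -> R} {G dG : 'I_d -> R -> R}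
  {K : R} {g : R -> R}.
Hypothesis H : markov_map a b G dG K g.
Implicit Types (i : 'I_d) (s t x y : R) (w : seq 'I_d).
Local Notation psi := (@psi R d a b G).
Local Notation wt := (@wt R d a b G dG).
Local Notation leb := (@lebesgue_measure R).

Fixpoint word_cylinder w : set R :=
  if w is i :: w' then [set t | t \in `]a i, b i] /\ word_cylinder w' (g t)]
  else `]0, 1]%classic.

Definition psi_word w t := foldr psi t w.

Lemma psi_lt i s t : s \in `[0, 1] -> t \in `[0, 1] -> s < t -> psi i s < psi i t.
Proof.
move=> s01 t01 st; rewrite lt_neqAle (psi_le H) ?(ltW st)// andbT; apply/eqP => e.
by have := psiK H i s; rewrite e (psiK H) !clampE// => ts; rewrite ts ltxx in st.
Qed.

Lemma psi_word01 w t : t \in `[0, 1] -> psi_word w t \in `[0, 1].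
Proof. by case: w => //= i w _; exact: (psi01 H). Qed.

Lemma psi_word_lt w s t : s \in `[0, 1] -> t \in `[0, 1] -> s < t ->
  psi_word w s < psi_word w t.
Proof.
by move=> s01 t01 st; elim: w => //= i w IH; apply: psi_lt => //; exact: psi_word01.
Qed.

Lemma psi_word_continuous w : continuous (psi_word w).
Proof.
elim: w => [|i w IH] t /=; first exact: cvg_id.
by apply: (@continuous_comp _ _ _ (psi_word w) (psi i)); [exact: IH|exact: (psi_continuous H)].
Qed.

Lemma word_cylinderE w :
  word_cylinder w = `]psi_word w 0, psi_word w 1]%classic.
Proof.
have z01 : (0 : R) \in `[0, 1] by rewrite in_itv/= lexx ler01.
have o01 : (1 : R) \in `[0, 1] by rewrite in_itv/= lexx ler01.
elim: w => //= i w ->; apply/seteqP; split => t /=.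
  move=> [tab]; rewrite !in_itv/= => /andP[h1 h2].
  rewrite -(psi_g H tab) (psi_le H)// andbT psi_lt// ?psi_word01//.
  by apply: subset_itv_oc_cc; apply: (g01 H); exact: (piece_sub H tab).
rewrite in_itv/= => /andP[h1 h2].
have tab : t \in `]a i, b i].
  rewrite in_itv/=; apply/andP; split.
    by apply: le_lt_trans h1; have := psi_itv H i (psi_word w 0); rewrite in_itv => /andP[].
  by apply: le_trans h2 _; have := psi_itv H i (psi_word w 1); rewrite in_itv => /andP[].
split => //; have gt01 := g01 H (piece_sub H tab).
rewrite in_itv/=; apply/andP; split.
  rewrite ltNge; apply/negP => h; move: h1; rewrite -(psi_g H tab) ltNge.
  by rewrite (psi_le H).
rewrite leNgt; apply/negP => h; move: h2; rewrite -(psi_g H tab) leNgt.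
by rewrite psi_lt// ?psi_word01//; exact: subset_itv_oc_cc.
Qed.

Lemma psi_word_cylinder w t : t \in `]0, 1] -> word_cylinder w (psi_word w t).
Proof.
move=> t01; rewrite word_cylinderE /= in_itv/=.
have tc := subset_itv_oc_cc t01; move: t01; rewrite in_itv/= => /andP[t0 t1].
have z01 : (0 : R) \in `[0, 1] by rewrite in_itv/= lexx ler01.
have o01 : (1 : R) \in `[0, 1] by rewrite in_itv/= lexx ler01.
rewrite psi_word_lt//=; move: t1; rewrite le_eqVlt => /predU1P[->//|t1].
by rewrite ltW// psi_word_lt.
Qed.

Lemma measurable_word_cylinder w : measurable (word_cylinder w : set (line R)).
Proof. by rewrite word_cylinderE; exact: measurable_itv. Qed.

Lemma word_cylinder_psi w t : word_cylinder w t ->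
  t \in `]0, 1] /\ psi_word w (iter (size w) g t) = t.
Proof.
elim: w t => [|i w IH] t //= [tab] /IH[gt01]; rewrite -iterS iterSr => ->.
by split; [exact: (piece_sub H tab)|exact: (psi_g H)].
Qed.

Lemma iter_g_psi_word w t : t \in `]0, 1] -> iter (size w) g (psi_word w t) = t.
Proof.
move=> t01; elim: w => //= i w IH; rewrite -iterS iterSr (g_psi H)//.
have := psi_word_cylinder w t01 => /word_cylinder_psi[]//.
Qed.

Lemma iter_g01 n t : t \in `]0, 1] -> iter n g t \in `]0, 1].
Proof. by move=> t01; elim: n => //= n; exact: (g01 H). Qed.

Definition word_length w := psi_word w 1 - psi_word w 0.

Lemma word_length_gt0 w : 0 < word_length w.
Proof.
by rewrite subr_gt0 psi_word_lt// in_itv/= ?lexx ler01.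
Qed.

Lemma psi_word_lip w s t : `|psi_word w s - psi_word w t| <= 16%:R ^- size w * `|s - t|.
Proof.
elim: w => [|i w IH] /=; first by rewrite invr1 mul1r.
apply: le_trans (psi_lip H i _ _) _; rewrite exprS invfM mulrC -mulrA.
by rewrite ler_wpM2l.
Qed.

Lemma word_length_le w : word_length w <= 16%:R ^- size w.
Proof.
have := psi_word_lip w 1 0; rewrite subr0 normr1 mulr1 gtr0_norm//.
exact: word_length_gt0.
Qed.

Lemma psi_secant i x y : x \in `[0, 1] -> y \in `[0, 1] -> x <= y ->
  exists2 z, x <= z <= y & psi i y - psi i x = wt i z * (y - x).
Proof.
move=> x01 y01 xy.
have sub : `[psi i x, psi i y] `<=` `[a i, b i].
  have := psi_itv H i x; have := psi_itv H i y; rewrite !in_itv/= => /andP[_ h1] /andP[h2 _].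
  by apply: subset_itv; rewrite bnd_simp.
have [c cxy] := MVT_segment (psi_le H i xy)
  (fun c (cxy : c \in `]psi i x, psi i y[) => mm_deriv H (sub c (subset_itv_oo_cc cxy)))
  (continuous_subspaceW sub (branch_continuous H (i := i))).
rewrite !(psiK H) !clampE// => E.
exists (G i c).
  move: (cxy); rewrite in_itv/= => /andP[h1 h2].
  have cab := sub c cxy.
  rewrite -[x](@clampE _ x)// -[y](@clampE _ y)// -!(psiK H i).
  by rewrite !(branch_mono H)// ?(psi_itv H)// h1.
rewrite /wt (branchK H) ?sub// E mulrA mulVf ?mul1r// gt_eqF//.
by rewrite (lt_le_trans _ (mm_exp H (sub c cxy))).
Qed.

(** The slope of the i-th factor varies by a factor at most exp (K * L), where L is the
    length of the cylinder on which it acts, and these lengths decrease geometrically. The sum of the series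
    is carried through the induction as the factor 1 - 16^-n. *)
Lemma psi_word_distortion w s t : s \in `[0, 1] -> t \in `[0, 1] -> s <= t ->
  expR (- (2 * K)) * word_length w * (t - s) <= psi_word w t - psi_word w s.
Proof.
move=> s01 t01 st.
suff: expR (- (2 * K * (1 - 16%:R ^- size w))) * word_length w * (t - s)
    <= psi_word w t - psi_word w s.
  apply: le_trans; rewrite ler_wpM2r ?subr_ge0// ler_wpM2r ?(ltW (word_length_gt0 w))//.
  rewrite ler_expR lerN2 -[leRHS]mulr1 ler_wpM2l ?mulr_ge0 ?(ltW (mm_K H))//.
have z01 : (0 : R) \in `[0, 1] by rewrite in_itv/= lexx ler01.
have o01 : (1 : R) \in `[0, 1] by rewrite in_itv/= lexx ler01.
elim: w => [|i w IH]; first by rewrite /word_length /= !subr0 invr1 subrr mulr0 oppr0 expR0 !mul1r.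
have [[s' t'] [l u]] := ((psi_word01 w s01, psi_word01 w t01), (psi_word01 w z01, psi_word01 w o01)).
have ord x y : x \in `[0, 1] -> y \in `[0, 1] -> x <= y -> psi_word w x <= psi_word w y.
  by move=> x01 y01; rewrite le_eqVlt => /predU1P[->//|xy]; rewrite ltW// psi_word_lt.
have [z1 z1st E1] := psi_secant i s' t' (ord _ _ s01 t01 st).
have [z2 z2st E2] := psi_secant i l u (ord _ _ z01 o01 ler01).
rewrite /word_length /= E1 E2 -/(word_length w).
have D : `|z2 - z1| <= word_length w.
  move: s01 t01 (ord _ _ z01 s01) (ord _ _ t01 o01); rewrite !in_itv/= => /andP[s0 _] /andP[_ t1] /(_ s0) h1 /(_ t1) h2.
  by move: z1st z2st => /andP[? ?] /andP[? ?]; rewrite /word_length ler_norml; apply/andP; split; lra.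
have Dw := wt_dist H i z2 z1.
have K0 := mm_K H.
have W16 := word_length_le w.
set q := 16%:R ^- size w in IH W16 *.
have q0 : 0 < q by rewrite invr_gt0 exprn_gt0.
have E3 : (16%:R : R) ^- (size w).+1 = q / 16%:R by rewrite exprS invfM mulrC.
rewrite E3.
apply: (@le_trans _ _ (wt i z1 * (expR (- (2 * K * (1 - q))) * word_length w * (t - s)))); last first.
  by rewrite ler_wpM2l// ltW// (wt_gt0 H).
rewrite !mulrA ler_wpM2r ?subr_ge0// ler_wpM2r ?(ltW (word_length_gt0 w))//.
rewrite mulrC; apply: (@le_trans _ _ (expR (K * `|z2 - z1|) * wt i z1 * expR (- (2 * K * (1 - q / 16%:R))))).
  by rewrite ler_wpM2r ?expR_ge0.
rewrite mulrAC [leRHS]mulrC ler_wpM2r ?(ltW (wt_gt0 H _ _))// -expRD ler_expR.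
have : K * `|z2 - z1| <= K * q by rewrite ler_wpM2l ?(ltW K0)// (le_trans D).
have : 0 < K * q by rewrite mulr_gt0.
lra.
Qed.

End Cylinders.

(** * Ergodicity of the base map *)

Lemma lebesgue_measure_diam (R : realType) (E : set (line R)) (L : R) :
  measurable E -> 0 <= L ->
  (forall s t, E s -> E t -> s <= t -> t - s <= L) ->
  (@lebesgue_measure R E <= L%:E)%E.
Proof.
move=> mE L0 EL; have [->|/set0P[x Ex]] := eqVneq E set0; first by rewrite measure0 lee_fin.
have lbE : has_lbound E.
  exists (x - L) => y Ey; have [yx|/ltW xy] := leP y x; last by lra.
  by have := EL _ _ Ey Ex yx; lra.
have hasinf : has_inf E by split => //; exists x.
apply: (@le_trans _ _ (@lebesgue_measure R `[inf E, (inf E + L)]%classic)).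
  apply: le_measure; rewrite ?inE; [exact: mE|exact: measurable_itv|].
  move=> y Ey /=; rewrite in_itv/= (ge_inf lbE Ey)/=.
  apply/ler_addgt0Pr => e e0.
  have [z Ez zE] := inf_adherent e0 hasinf.
  have [zy|/ltW yz] := leP z y; first by have := EL _ _ Ez Ey zy; lra.
  by have := ge_inf lbE Ey; lra.
rewrite lebesgue_measure_itv/= lte_fin; case: ltP => h; rewrite ?lee_fin//.
by rewrite addrAC subrr add0r.
Qed.

Section BaseErgodicity.
Context {R : realType} {d : nat} {a b : 'I_d -> R} {G dG : 'I_d -> R -> R}
  {K : R} {g : R -> R}.
Hypothesis H : markov_map a b G dG K g.
Implicit Types (i : 'I_d) (s t x y : R) (w : seq 'I_d).
Local Notation psi := (@psi R d a b G).
Local Notation psi_word := (@psi_word R d a b G).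
Local Notation word_cylinder := (@word_cylinder R d a b g).
Local Notation word_length := (@word_length R d a b G).
Local Notation leb := (@lebesgue_measure R).

Lemma itinerary_word n t : t \in `]0, 1] ->
  exists w : n.-tuple 'I_d, word_cylinder w t.
Proof.
elim: n t => [|n IH] t t01; first by exists [tuple].
have [i ti] := piece_ex H t01.
have [w wt] := IH (g t) (g01 H t01).
by exists [tuple of i :: w].
Qed.

Lemma word_cylinder_uniq (w w' : seq 'I_d) t : size w = size w' ->
  word_cylinder w t -> word_cylinder w' t -> w = w'.
Proof.
elim: w w' t => [|i w IH] [|i' w'] t //= [sw] [ti wt] [ti' wt'].
by rewrite (piece_uniq H ti ti') (IH _ _ sw wt wt').
Qed.

Variables (n : nat) (A : set (line R)).
Hypothesis n0 : (0 < n)%N.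
Hypothesis mA : measurable A.
Hypothesis Ainv : forall t, t \in `]0, 1] -> A (iter n g t) <-> A t.

Let inv_iter k t : t \in `]0, 1] -> A (iter (k * n) g t) <-> A t.
Proof.
move=> t01; elim: k => //= k IH; rewrite mulSn iterD Ainv//.
exact: (iter_g01 H).
Qed.

Let A1 : set (line R) := A `&` `]0, 1]%classic.
Let mA1 : measurable A1. Proof. by apply: measurableI => //; exact: measurable_itv. Qed.
Let A2 : set (line R) := `]0, 1]%classic `\` A.
Let mA2 : measurable A2. Proof. by apply: measurableD => //; exact: measurable_itv. Qed.

Let D := expR (2 * K).

(** The set contains the image of A1 under psi_word, since A is invariant under g^n;
    by distortion this image fills a definite proportion of the cylinder. Comparison of
    measures through [lebesgue_measure_dominates] needs intervals only, whose preimages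
    under psi_word are bounded by their diameter. *)
Lemma invariant_set_in_cylinder k w : size w = (k * n)%N ->
  (leb A1 <= (D / word_length w)%:E * leb (word_cylinder w `&` A))%E.
Proof.
move=> sw.
have wl := word_length_gt0 H w.
have mpsi : measurable_fun setT (psi_word w : line R -> line R).
  by apply: continuous_measurable_fun; exact: (psi_word_continuous H).
have mpre B : measurable B -> measurable (psi_word w @^-1` B : set (line R)).
  by move=> mB; rewrite -[X in measurable X]setTI; exact: mpsi.
have := @lebesgue_measure_dominates R (image_measure mpsi (mrestr leb mA1)) (D / word_length w).
rewrite divr_gt0 ?expR_gt0// => /(_ erefl) dom.
apply: (@le_trans _ _ (image_measure mpsi (mrestr leb mA1) (word_cylinder w `&` A))); last apply: dom.
- rewrite image_measureE /mrestr; apply: le_measure; rewrite ?inE//.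
  + apply: measurableI => //; apply: mpre.
    by apply: measurableI => //; exact: (measurable_word_cylinder H).
  + move=> t A1t; split => //; have [At t01] := A1t.
    split; first exact: (psi_word_cylinder H).
    have pc := psi_word_cylinder H w t01.
    have [p01 _] := word_cylinder_psi H pc.
    by apply/(inv_iter k p01); rewrite -sw (iter_g_psi_word H).
- move=> x y xy; rewrite image_measureE /mrestr.
  apply: lebesgue_measure_diam.
  + by apply: measurableI => //; apply: mpre; exact: measurable_itv.
  + by rewrite mulr_ge0// ?subr_ge0 ?(ltW xy)// divr_ge0 ?expR_ge0 ?(ltW wl).
  + move=> s t [/= + [_ s01]] [/= + [_ t01]] st; rewrite !in_itv/= => /andP[h1 h2] /andP[h3 h4].
    have := psi_word_distortion H w (subset_itv_oc_cc s01) (subset_itv_oc_cc t01) st.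
    rewrite expRN -mulrA ler_pdivrMl ?expR_gt0// => h5.
    rewrite mulrAC ler_pdivlMr// mulrC (le_trans h5)// ler_wpM2l ?expR_ge0//; lra.
- by apply: measurableI => //; exact: (measurable_word_cylinder H).
Qed.

(** If A1 has positive measure, A2 misses a proportion delta of every cylinder. Cylinders
    being arbitrarily short, A2 misses this proportion of every interval, hence of every
    Borel set; applied to A2 itself, this makes A2 null. *)
Lemma invariant_set_dichotomy : leb A1 = 0%E \/ leb A2 = 0%E.
Proof.
have [|A10] := eqVneq (leb A1) 0%E; [by left|right].
have le1 (E : set (line R)) : measurable E -> E `<=` `]0, 1]%classic -> (leb E <= 1)%E.
  move=> mE E01; have -> : (1 = leb `]0%R, 1%R]%classic)%E.
    by rewrite lebesgue_measure_itv/= lte_fin ltr01 oppr0 adde0.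
  by apply: le_measure; rewrite ?inE; [exact: mE|exact: measurable_itv|].
have A1fin : leb A1 \is a fin_num.
  by rewrite ge0_fin_numE// (le_lt_trans (le1 _ mA1 _)) ?ltry// => t [].
pose delta := fine (leb A1) / D.
have delta0 : 0 < delta.
  by rewrite divr_gt0 ?expR_gt0// -lte_fin fineK// lt0e A10/=.
have D1 : 1 <= D by rewrite -expR0 ler_expR mulr_ge0// ltW// (mm_K H).
have delta1 : delta <= 1.
  rewrite ler_pdivrMr ?expR_gt0// mul1r (le_trans _ D1)// -lee_fin fineK//.
  by apply: le1 => // t [].
have mC w := measurable_word_cylinder H w.
have lC w : leb (word_cylinder w) = (word_length w)%:E.
  rewrite (word_cylinderE H) lebesgue_measure_itv/= lte_fin -subr_gt0.
  by rewrite -/(word_length w) (word_length_gt0 H) EFinB.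
have cyl k w : size w = (k * n)%N ->
    (leb (word_cylinder w `&` A2) <= (1 - delta)%:E * leb (word_cylinder w))%E.
  move=> sw; have h1 := invariant_set_in_cylinder sw.
  have -> : word_cylinder w `&` A2 = word_cylinder w `\` A.
    apply/seteqP; split => t; first by move=> [? [? ?]].
    by move=> [wt ?]; split => //; split => //; have [] := word_cylinder_psi H wt.
  have E : ((word_length w)%:E = leb (word_cylinder w `\` A) + leb (word_cylinder w `&` A))%E.
    by rewrite -lC; exact: (measureDI leb (mC w) mA).
  rewrite lC.
  have f1 : leb (word_cylinder w `&` A) \is a fin_num.
    rewrite ge0_fin_numE// (@le_lt_trans _ _ (leb (word_cylinder w)))//.
      by apply: le_measure; rewrite ?inE//; exact: measurableI.
    by rewrite lC ltry.
  have f2 : leb (word_cylinder w `\` A) \is a fin_num.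
    rewrite ge0_fin_numE// (@le_lt_trans _ _ (leb (word_cylinder w)))//.
      by apply: le_measure; rewrite ?inE//; exact: measurableD.
    by rewrite lC ltry.
  rewrite -(fineK f2) -(fineK f1) -EFinD in E; case: E => E.
  move: h1; rewrite -(fineK f1) -(fineK f2) -(fineK A1fin) -!EFinM !lee_fin.
  move: E; set u := fine (leb (_ `\` _)); set v := fine (leb (_ `&` A)); set z := fine (leb A1) => E.
  have wl := word_length_gt0 H w; have Dp := expR_gt0 (2 * K).
  rewrite mulrAC ler_pdivlMr// => h1.
  have : delta * word_length w <= v.
    by rewrite /delta mulrAC ler_pdivrMr// -/z [v * _]mulrC.
  by move: E; rewrite mulrBl mul1r; lra.
have itv x y : x < y -> (leb (`]x, y]%classic `&` A2) <= ((1 - delta) * (y - x))%:E)%E.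
  move=> xy; apply/lee_addgt0Pr => e e0.
  have [k kE] := real_lt_nat (2 / e).
  (* Cylinders of length k * n have diameter at most q; those that meet ]x, y] lie
       in ]x - q, y + q]. *)
  pose q : R := 16%:R ^- (k * n).
  have q0 : 0 < q by rewrite invr_gt0 exprn_gt0.
  have q2 : 2 * q <= e.
    have h : k%:R <= 16%:R ^+ (k * n) :> R.
      rewrite -natrX ler_nat (leq_trans (ltnW (ltn_expl k (isT : 1 < 16)%N)))//.
      by rewrite leq_exp2l// leq_pmulr.
    rewrite /q ler_pdivrMr ?exprn_gt0// mulrC -ler_pdivrMr// (le_trans (ltW kE))//.
  pose S := [set w : (k * n).-tuple 'I_d | word_cylinder w `&` `]x, y]%classic !=set0].
  have fS : finite_set S by exact: finite_finset.
  have tS : trivIset S (fun v : (k * n).-tuple 'I_d => word_cylinder v : set (line R)).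
    move=> w w' _ _ [t [wt wt']]; apply/val_inj/(word_cylinder_uniq _ wt wt').
    by rewrite !size_tuple.
  apply: (@le_trans _ _ (leb (\bigcup_(v in S) (word_cylinder v `&` A2)))).
    apply: le_measure; rewrite ?inE.
    - by apply: measurableI => //; exact: measurable_itv.
    - apply: fin_bigcup_measurable => // w _.
      by apply: measurableI => //; exact: mC.
    - move=> t [txy [t01 nAt]]; have [w wt] := itinerary_word (k * n) t01.
      by exists w; [exists t|split].
  rewrite measure_fin_bigcup//; last 2 first.
    exact: trivIset_setIr.
    by move=> w _; apply: measurableI => //; exact: mC.
  apply: (@le_trans _ _ (\sum_(v \in S) (1 - delta)%:E * leb (word_cylinder v))%E).
    by apply: lee_fsum => // w _; apply: (cyl k); rewrite size_tuple.
  rewrite -ge0_mule_fsumr// -measure_fin_bigcup//.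
  apply: (@le_trans _ _ ((1 - delta)%:E * (y - x + 2 * q)%:E)%E).
    apply: lee_wpmul2l; first by rewrite lee_fin subr_ge0.
    apply: (@le_trans _ _ (leb `](x - q), (y + q)]%classic)).
      apply: le_measure; rewrite ?inE.
      - by apply: fin_bigcup_measurable => // w _; exact: mC.
      - exact: measurable_itv.
      - move=> t [w [s [ws sxy]] wt].
        have lw := word_length_le H w; rewrite size_tuple -/q in lw.
        move: sxy ws wt; rewrite !(word_cylinderE H) /= !in_itv/=.
        move=> /andP[s1 s2] /andP[s3 s4] /andP[t1 t2].
        by move: lw; rewrite /word_length => lw; apply/andP; split; lra.
    rewrite lebesgue_measure_itv/= lte_fin; case: ltP => h; last by rewrite lee_fin; lra.
    by rewrite -EFinB lee_fin; lra.
  rewrite -EFinM -EFinD lee_fin mulrDr lerD2l.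
  by rewrite (le_trans _ q2)// ler_piMl ?mulr_ge0 ?(ltW q0)//; lra.
have [d1|d1] := eqVneq delta 1.
  have := itv 0 1 ltr01; rewrite d1 subrr mul0r setIC.
  rewrite (_ : _ `&` _ = A2); last by apply/setIidPl => t [].
  by move=> h; apply/eqP; rewrite eq_le h measure_ge0.
have dd : 0 < 1 - delta by rewrite subr_gt0 lt_neqAle d1.
have := @lebesgue_measure_dominates R (mrestr leb mA2) (1 - delta) dd itv A2 mA2.
rewrite -[X in (X <= _)%E -> _]/(leb (A2 `&` A2)) setIid => h.
have A2fin : leb A2 \is a fin_num.
  by rewrite ge0_fin_numE// (le_lt_trans (le1 _ mA2 _)) ?ltry// => t [].
apply/eqP; rewrite eq_le measure_ge0 andbT; move: h.
rewrite -(fineK A2fin) -EFinM !lee_fin mulrBl mul1r.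
by have := delta0; nra.
Qed.

End BaseErgodicity.

(** * Contracting skew-products *)

(** A superlevel set of a Lipschitz function is the trace of a union of balls. *)
Lemma lipschitz_measurable_plane (R : realType) (D : set (plane R))
    (u : plane R -> R) (L : R) : measurable D -> 0 < L ->
  (forall z z' e, D z -> D z' -> `|z.1 - z'.1| < e -> `|z.2 - z'.2| < e ->
     `|u z - u z'| < L * e) ->
  measurable_fun D u.
Proof.
move=> mD L0 uL _; apply: (measurability _ (RGenOInfty.measurableE R)) => //.
move=> _ [_ [c ->] <-].
pose O : set (R * R) := \bigcup_(z in [set z | D z /\ c < u z]) ball (z : R * R) ((u z - c) / L).
have oO : open O by apply: bigcup_open => z _; exact: ball_open.
rewrite (_ : D `&` _ = D `&` O).
  by apply: measurableI => //; apply: open_measurable_plane.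
apply/seteqP; split => z [Dz].
  rewrite /= in_itv/= andbT => cu; split => //; exists z => //.
  by apply: ballxx; rewrite divr_gt0// subr_gt0.
move=> [z' [Dz' cu'] [/= b1 b2]]; split => //; rewrite /= in_itv/= andbT.
have := uL z' z _ Dz' Dz b1 b2; rewrite mulrC divfK ?gt_eqF// => h.
by move: h; rewrite ltr_norml => /andP[_]; lra.
Qed.

(** The fibre maps carry the interval J_j of centre p_j and radius rr_j into J_(j+1),
    indices being read modulo N through the periodicity of p and rr. Contraction is measured
    in the scale of the radii: a single fibre map may expand, but n successive ones
    contract by lam^n up to the ratio of two radii. The last clause places the image of
    J_j in a compact part of J_(j+1). *)
Record contracting_skew (R : realType) (d : nat) (a b : 'I_d -> R)
    (G dG : 'I_d -> R -> R) (K : R) (g : R -> R) (f : R * R -> R)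
    (l r M Lam lam : R) (N : nat) (p rr : nat -> R) : Prop := ContractingSkew {
  cs_base : markov_map a b G dG K g;
  cs_M : 0 <= M;
  cs_Lam : 0 <= Lam;
  cs_theta : forall i t t' x, t \in `]a i, b i] -> t' \in `]a i, b i] ->
    x \in `[l, r] -> `|f (t, x) - f (t', x)| <= M * `|t - t'|;
  cs_x : forall t x y, t \in `]0, 1] -> x \in `[l, r] -> y \in `[l, r] ->
    `|f (t, x) - f (t, y)| <= Lam * `|x - y|;
  cs_itv : forall t x, t \in `]0, 1] -> x \in `[l, r] -> f (t, x) \in `[l, r];
  cs_N : (0 < N)%N;
  cs_p : forall j, p (j + N)%N = p j;
  cs_rrN : forall j, rr (j + N)%N = rr j;
  cs_rr : forall j, 0 < rr j;
  cs_J : forall j, l <= p j - rr j /\ p j + rr j <= r;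
  cs_lam : 0 < lam < 1;
  cs_contr : forall j t x y, t \in `]0, 1] -> `|x - p j| < rr j ->
    `|y - p j| < rr j -> `|f (t, x) - f (t, y)| <= lam * (rr j.+1 / rr j) * `|x - y|;
  cs_map : forall j t x, t \in `]0, 1] -> `|x - p j| < rr j ->
    `|f (t, x) - p j.+1| <= lam * rr j.+1 }.

Section Skew.
Context {R : realType} {d : nat} {a b : 'I_d -> R} {G dG : 'I_d -> R -> R}
  {K : R} {g : R -> R} {f : R * R -> R} {l r M Lam lam : R} {N : nat}
  {p rr : nat -> R}.
Hypothesis H : contracting_skew a b G dG K g f l r M Lam lam N p rr.
Implicit Types (i : 'I_d) (s t x y : R) (z : R * R) (j k n : nat).
Let HB := cs_base H.
Local Notation word_cylinder := (@word_cylinder R d a b g).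
Local Notation phi := (skew_product g f).
Local Notation region := (cylinder `[l, r]%classic).

Definition cell j : set R := [set x | `|x - p j| < rr j].
Local Notation J := cell.

Lemma region_iff z : region z <-> z.1 \in `]0, 1] /\ z.2 \in `[l, r].
Proof. by rewrite /cylinder; split => -[]. Qed.

Lemma measurable_region : measurable (region : set (plane R)).
Proof. by apply: measurableX; exact: measurable_itv. Qed.

Lemma J_itv j x : J j x -> x \in `[l, r].
Proof.
rewrite /cell /= ltr_norml => /andP[h1 h2]; have [h3 h4] := cs_J H j.
by rewrite in_itv/=; apply/andP; split; lra.
Qed.

Lemma phi_region z : region z -> region (phi z).
Proof.
move=> /region_iff[z1 z2]; apply/region_iff; split; first exact: (g01 HB).
by case: z z1 z2 => t x /= z1 z2; exact: (cs_itv H).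
Qed.

Lemma iter_phi_region n z : region z -> region (iter n phi z).
Proof. by move=> z0; elim: n => //= n; exact: phi_region. Qed.

Lemma iter_phi1 n z : (iter n phi z).1 = iter n g z.1.
Proof. by elim: n => //= n ->. Qed.

(** phi is constrained on the phase space only; extended by the identity it becomes a
    measurable self-map of the plane with the same orbits in the phase space. *)
Definition phi_tot z : R * R := if (z.1 \in `]0, 1]) && (z.2 \in `[l, r]) then phi z else z.

Lemma phi_totE z : region z -> phi_tot z = phi z.
Proof. by move=> /region_iff[z1 z2]; rewrite /phi_tot z1 z2. Qed.

Lemma iter_phi_totE n z : region z -> iter n phi_tot z = iter n phi z.
Proof.
by move=> zr; elim: n => //= n ->; rewrite phi_totE//; exact: iter_phi_region.
Qed.

Definition base_tot t : R := if t \in `]0, 1] then g t else t.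
Local Notation g_tot := base_tot.

Lemma iter_g_totE n t : t \in `]0, 1] -> iter n g_tot t = iter n g t.
Proof.
move=> t01; elim: n => //= n ->; rewrite /base_tot ifT//.
exact: (iter_g01 HB).
Qed.

Lemma measurable_g_tot : measurable_fun setT (g_tot : line R -> line R).
Proof.
have E : setT = `]0, 1]%classic `|` ~` `]0, 1]%classic :> set (line R) by rewrite setUv.
rewrite E; apply/measurable_funU; [exact: measurable_itv|apply: measurableC; exact: measurable_itv|].
split; last first.
  apply: (eq_measurable_fun (fun t : line R => t)) => //.
  by move=> t /set_mem /= nt; rewrite /base_tot; case: ifPn.
rewrite -(mm_cover HB); apply: measurable_fun_piecewise => i; first exact: measurable_itv.
apply: (eq_measurable_fun (G i : line R -> line R)).
  move=> t /set_mem /= ti; rewrite /base_tot (piece_sub HB ti).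
  by rewrite (mm_g HB ti).
apply: (measurable_funS (E := `[a i, b i]%classic)); first exact: measurable_itv.
  exact: subset_itv_oc_cc.
apply: subspace_continuous_measurable_fun; first exact: measurable_itv.
exact: (branch_continuous HB).
Qed.

Lemma measurable_phi_tot : measurable_fun setT (phi_tot : plane R -> plane R).
Proof.
have mr := measurable_region.
have outside z : ~ region z -> phi_tot z = z.
  move=> nt; rewrite /phi_tot; case: ifPn => // /andP[z1 z2].
  by exfalso; apply: nt; apply/region_iff.
apply/measurable_fun_pairP; split => /=.
  apply: (@measurable_fun_split _ _ _ _ region _ (g_tot \o fst) fst mr).
  - by apply: measurable_funTS; apply: (measurableT_comp measurable_g_tot).
  - exact: measurable_fst.
  - by move=> z /[dup] /region_iff[z1 z2] zr /=; rewrite phi_totE// /base_tot z1.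
  - by move=> z nz /=; rewrite outside.
apply: (@measurable_fun_split _ _ _ _ region _ f snd mr); last 3 first.
- exact: measurable_snd.
- by move=> z zr /=; rewrite phi_totE.
- by move=> z nz /=; rewrite outside.
rewrite (_ : region = \bigcup_i ((`]a i, b i]%classic `*` `[l, r]%classic) : set (plane R))); last first.
  rewrite /cylinder -(mm_cover HB); apply/seteqP; split => z.
    by move=> [[i _ zi] z2]; exists i.
  by move=> [i _ [zi z2]]; split => //; exists i.
apply: measurable_fun_piecewise => i.
  by apply: measurableX; exact: measurable_itv.
apply: (@lipschitz_measurable_plane _ _ _ (M + Lam + 1)).
- by apply: measurableX; exact: measurable_itv.
- by have := cs_M H; have := cs_Lam H; lra.
move=> [t x] [t' y] e [/= ti xi] [/= t'i yi] te xe.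
have h1 := cs_theta H ti t'i xi; have h2 := cs_x H (piece_sub HB t'i) xi yi.
have := ler_distD (f (t', x)) (f (t, x)) (f (t', y)).
have M0 := cs_M H; have L0 := cs_Lam H.
have : M * `|t - t'| <= M * e by rewrite ler_wpM2l// ltW.
have : Lam * `|x - y| <= Lam * e by rewrite ler_wpM2l// ltW.
have := normr_ge0 (x - y).
by rewrite !mulrDl mul1r; lra.
Qed.

Lemma iter_phiS2 n t x :
  (iter n.+1 phi (t, x)).2 = f (iter n g t, (iter n phi (t, x)).2).
Proof.
by rewrite iterS {1}[iter n phi _]surjective_pairing iter_phi1.
Qed.

Lemma iter_phi_J n j t x : t \in `]0, 1] -> J j x -> J (j + n) (iter n phi (t, x)).2.
Proof.
move=> t01 xJ; elim: n => [|n IH]; first by rewrite addn0.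
rewrite addnS /cell /mkset iter_phiS2.
apply: (le_lt_trans (cs_map H (iter_g01 HB n t01) IH)).
by have /andP[_ l1] := cs_lam H; rewrite gtr_pMl ?(cs_rr H).
Qed.

Lemma iter_phi_core n j t x : (0 < n)%N -> t \in `]0, 1] -> J j x ->
  `|(iter n phi (t, x)).2 - p (j + n)%N| <= lam * rr (j + n)%N.
Proof.
case: n => // n _ t01 xJ; rewrite addnS iter_phiS2.
exact: (cs_map H (iter_g01 HB n t01) (iter_phi_J n t01 xJ)).
Qed.

Lemma iter_phi_contract n j t x y : t \in `]0, 1] -> J j x -> J j y ->
  `|(iter n phi (t, x)).2 - (iter n phi (t, y)).2|
    <= lam ^+ n * (rr (j + n)%N / rr j) * `|x - y|.
Proof.
move=> t01 xJ yJ; elim: n => [|n IH].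
  by rewrite addn0 divff ?gt_eqF ?(cs_rr H)// !mul1r.
rewrite !iter_phiS2 addnS.
apply: (le_trans (cs_contr H (iter_g01 HB n t01) (iter_phi_J n t01 xJ) (iter_phi_J n t01 yJ))).
have /andP[l0 _] := cs_lam H.
have r0 := cs_rr H.
rewrite exprS; apply: (@le_trans _ _ (lam * (rr (j + n).+1 / rr (j + n)) *
   (lam ^+ n * (rr (j + n) / rr j) * `|x - y|))).
  by rewrite ler_wpM2l// mulr_ge0 ?divr_ge0// ltW.
rewrite le_eqVlt; apply/orP; left; apply/eqP.
have := r0 j; have := r0 (j + n)%N => h1 h2; field.
by rewrite !gt_eqF.
Qed.

Lemma same_word_dist (w : seq 'I_d) s t : word_cylinder w s -> word_cylinder w t ->
  `|s - t| <= 16%:R ^- size w.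
Proof.
move=> ws wt; have := word_length_le HB w.
by move: ws wt; rewrite !(word_cylinderE HB) /= !in_itv/= /word_length ler_norml => /andP[? ?] /andP[? ?] ?; apply/andP; split; lra.
Qed.

End Skew.

(** * Observables *)

Lemma heine_cantor (R : realType) (A : set (R * R)) (u : R * R -> R) (e : R) :
  compact A -> continuous u -> 0 < e ->
  exists2 del : R, 0 < del & forall z z', A z -> ball z del z' -> `|u z - u z'| < e.
Proof.
move=> /compact_near_coveringP cA cu e0.
pose P (del : R) (z : R * R) := forall z', ball z del z' -> `|u z - u z'| < e.
have : \forall del \near 0^'+, A `<=` P del.
  apply: cA => z Az.
  have /cvgrPdist_lt /(_ (e / 2)) := cu z.
  rewrite divr_gt0// => /(_ erefl) /nbhs_ballP[del /= del0 Hdel].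
  exists (ball z (del / 2), [set t : R | 0 < t < del / 2]) => /=.
    split; first by apply: nbhsx_ballx; rewrite divr_gt0.
    by near=> t; apply/andP; split; near: t; [exact: nbhs_right_gt|apply: nbhs_right_lt; rewrite divr_gt0].
  move=> [z' t] /= [zz' /andP[t0 t1]] z'' z'z''.
  have h1 : `|u z - u z'| < e / 2.
    by apply: Hdel; apply: le_ball zz'; rewrite ler_pdivrMr// ler_pMr// ler1n.
  have h2 : `|u z - u z''| < e / 2.
    apply: Hdel; apply: (@le_ball _ _ _ (del / 2 + t)); first by move: t1; lra.
    exact: ball_triangle zz' z'z''.
  by have := ler_distD (u z) (u z') (u z''); rewrite (distrC (u z') (u z)); lra.
move=> [del /= del0 Hdel].
have d2 : `|0 - del / 2| < del.
  by rewrite sub0r normrN gtr0_norm ?divr_gt0// ltr_pdivrMr// ltr_pMr// ltr1n.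
exists (del / 2); first by rewrite divr_gt0.
by move=> z z' Az; apply: (Hdel _ d2 _ z Az); rewrite /= divr_gt0.
Unshelve. all: by end_near. Qed.

Section Observables.
Context {R : realType} {d : nat} {a b : 'I_d -> R} {G dG : 'I_d -> R -> R}
  {K : R} {g : R -> R} {f : R * R -> R} {l r M Lam lam : R} {N : nat}
  {p rr : nat -> R}.
Hypothesis H : contracting_skew a b G dG K g f l r M Lam lam N p rr.
Implicit Types (i : 'I_d) (s t x y : R) (z : R * R) (j k n : nat) (w : seq 'I_d).
Let HB := cs_base H.
Local Notation word_cylinder := (@word_cylinder R d a b g).
Local Notation psi_word := (@psi_word R d a b G).
Local Notation phi := (skew_product g f).
Local Notation phi_tot := (@phi_tot R g f l r).
Local Notation region := (cylinder `[l, r]%classic).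
Local Notation J := (@cell R p rr).

(** Uniform continuity in the itinerary of the base point and in the fibre coordinate.
    Unlike continuity on the cylinder, it is preserved by composition with phi, which
    is discontinuous at the ends of the pieces. *)
Record observable (u : R * R -> R) : Prop := Observable {
  obs_meas : measurable_fun region (u : plane R -> R);
  obs_bound : exists2 B : R, 0 < B & forall z, region z -> `|u z| <= B;
  obs_cont : forall e : R, 0 < e -> exists (n : nat) (del : R), 0 < del /\
    forall w t t' x y, size w = n -> word_cylinder w t -> word_cylinder w t' ->
      x \in `[l, r] -> y \in `[l, r] -> `|x - y| < del ->
      `|u (t, x) - u (t', y)| < e }.

Lemma small_power (q e : R) : 0 <= q < 1 -> 0 < e -> exists n0, forall n, (n0 <= n)%N -> q ^+ n < e.
Proof.
move=> /andP[q0 q1] e0.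
have : q ^+ n @[n --> \oo] --> (0 : R) by apply: cvg_expr; rewrite ger0_norm.
move=> /cvgrPdist_lt /(_ e e0)[n0 _ Hn]; exists n0 => n n0n.
by have := Hn n n0n; rewrite sub0r normrN ger0_norm// exprn_ge0.
Qed.

Lemma word_cylinder_take n w t : word_cylinder w t -> word_cylinder (take n w) t.
Proof.
elim: w n t => [|i w IH] [|n] t //=; first by move=> [ti _]; exact: (piece_sub HB ti).
by move=> [ti wt]; split => //; exact: IH.
Qed.

Lemma observable_comp u : observable u -> observable (u \o phi).
Proof.
move=> [mu [B B0 uB] uc]; split.
- apply: (eq_measurable_fun (fun z : plane R => u (phi_tot z))).
    by move=> z /set_mem zr /=; rewrite phi_totE.
  apply: (@measurable_comp _ _ _ _ _ _ (region : set (plane R))) => //.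
  + exact: measurable_region.
  + by move=> _ [z zr <-]; rewrite phi_totE//; exact: (phi_region H).
  + by apply: measurable_funTS; exact: (measurable_phi_tot H).
- by exists B => // z zr; apply: uB; exact: (phi_region H).
- move=> e e0; have [n [del [del0 Hu]]] := uc e e0.
  have M0 := cs_M H; have L0 := cs_Lam H.
  have [n0 Hn0] : exists n0, forall n, (n0 <= n)%N -> (16%:R^-1 : R) ^+ n < del / 2 / (M + 1).
    apply: small_power; first by rewrite invr_ge0 ler0n invf_lt1// ltr1n.
    by rewrite !divr_gt0// ltr_wpDl.
  exists (maxn n.+1 n0), (del / 2 / (Lam + 1)); split; first by rewrite !divr_gt0// ltr_wpDl.
  move=> w t t' x y sw wt wt' xi yi xy.
  have tt' : `|t - t'| < del / 2 / (M + 1).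
    apply: le_lt_trans (same_word_dist H wt wt') _; rewrite -exprVn.
    by apply: Hn0; rewrite sw leq_maxr.
  case: w sw wt wt' => [|i w] /=; first by move=> /eqP; rewrite eq_sym -leqn0 leqNgt (leq_trans _ (leq_maxl _ _)).
  move=> [sw] [ti wt] [t'i wt'].
  have [t01 t'01] := (piece_sub HB ti, piece_sub HB t'i).
  rewrite /skew_product /=; apply: (Hu (take n w)).
  + by rewrite size_takel// -ltnS sw leq_maxl.
  + exact: word_cylinder_take.
  + exact: word_cylinder_take.
  + exact: (cs_itv H).
  + exact: (cs_itv H).
  + have h1 := cs_theta H ti t'i xi; have h2 := cs_x H t'01 xi yi.
    have := ler_distD (f (t', x)) (f (t, x)) (f (t', y)).
    move: tt' xy; rewrite !ltr_pdivlMr ?ltr_wpDl// => tt' xy.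
    have := normr_ge0 (t - t'); have := normr_ge0 (x - y); nra.
Qed.

Lemma observable_iter u n : observable u -> observable (u \o iter n phi).
Proof.
elim: n u => [|n IH] u ou //; have := IH _ (observable_comp ou).
by congr observable; apply/funext => z /=; rewrite -iterS.
Qed.

Lemma observable_continuous (u : R * R -> R) : continuous u -> observable u.
Proof.
move=> cu; split.
- by apply: measurable_funTS; exact: continuous_measurable_plane.
- have cpt : compact (`[0 : R, 1]%classic `*` `[l, r]%classic).
    by apply: compact_setX; exact: segment_compact.
  have : compact (u @` (`[0 : R, 1]%classic `*` `[l, r]%classic)).
    by apply: continuous_compact => //; exact: continuous_subspaceT.
  move=> /compact_bounded [B [_ HB']].
  exists (`|B| + 1); first by rewrite ltr_wpDl.
  move=> z /region_iff[z1 z2]; apply: (HB' (`|B| + 1)).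
    by have := ler_norm B; lra.
  by exists z => //; split => //=; exact: subset_itv_oc_cc.
- move=> e e0.
  have cpt : compact (`[0 : R, 1]%classic `*` `[l, r]%classic).
    by apply: compact_setX; exact: segment_compact.
  have [del del0 Hdel] := heine_cantor cpt cu e0.
  have [n Hn] : exists n0, forall n, (n0 <= n)%N -> (16%:R^-1 : R) ^+ n < del.
    by apply: small_power => //; rewrite invr_ge0 ler0n invf_lt1// ltr1n.
  exists n, del; split => // w t t' x y sw wt wt' xi yi xy.
  apply: Hdel.
    split => //=; apply: subset_itv_oc_cc.
    by have [] := word_cylinder_psi HB wt.
  split => //=; apply: le_lt_trans (same_word_dist H wt wt') _.
  by rewrite -exprVn sw; exact: Hn.
Qed.

(** After q turns of the cycle the choice of x in J_0 matters by lam^q only, so x can be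
    replaced by the centre; what remains is an observable of the itinerary of t. *)
Lemma step_approximation u e : observable u -> 0 < e ->
  exists (q n : nat) (v : seq 'I_d -> R), forall w t x, size w = n ->
    word_cylinder w t -> J 0 x -> `|u (iter (q * N) phi (t, x)) - v w| <= e.
Proof.
move=> ou e0; have e2 : 0 < e / 2 by rewrite divr_gt0.
have [n1 [del1 [del10 H1]]] := obs_cont ou e2.
have /andP[l0 l1] := cs_lam H.
have [q Hq] : exists n0, forall n, (n0 <= n)%N -> lam ^+ n < del1 / rr 0.
  by apply: small_power; rewrite ?(ltW l0)// divr_gt0// (cs_rr H).
have qN : (q <= q * N)%N by rewrite leq_pmulr// (cs_N H).
have [n2 [del2 [del20 H2]]] := obs_cont (observable_iter (q * N) ou) e2.
exists q, n2, (fun w => u (iter (q * N) phi (psi_word w 1, p 0%N))).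
move=> w t x sw wt xJ.
have pJ : J 0 (p 0%N) by rewrite /cell /= subrr normr0 (cs_rr H).
have o01 : (1 : R) \in `]0, 1] by rewrite in_itv/= ltr01 lexx.
have [t01 _] := word_cylinder_psi HB wt.
apply: le_trans (ler_distD (u (iter (q * N) phi (t, p 0%N))) _ _) _.
rewrite [leRHS](splitr e) lerD// ltW//.
  have gt01 := iter_g01 HB (q * N) t01.
  have [w' w't] := itinerary_word HB n1 gt01.
  have inJ y : J 0 y -> (iter (q * N) phi (t, y)).2 \in `[l, r].
    by move=> yJ; apply: (J_itv H); exact: (iter_phi_J H (q * N) t01 yJ).
  rewrite [iter _ _ (t, x)]surjective_pairing [iter _ _ (t, p 0%N)]surjective_pairing.
  rewrite !iter_phi1; apply: (H1 w') => //; rewrite ?size_tuple ?inJ//.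
  apply: le_lt_trans (iter_phi_contract H (q * N) t01 xJ pJ) _.
  have rrq k : rr (0 + k * N)%N = rr 0%N.
    by elim: k => // k IH; rewrite mulSn addnCA addnC (cs_rrN H).
  rewrite rrq divff ?gt_eqF ?(cs_rr H)// mulr1.
  apply: (@le_lt_trans _ _ (lam ^+ (q * N) * rr 0%N)).
    by rewrite ler_wpM2l ?exprn_ge0 ?(ltW l0)// ltW.
  by rewrite -ltr_pdivlMr ?(cs_rr H)//; exact: Hq.
apply: (H2 w) => //; rewrite ?(J_itv H pJ)//; last by rewrite subrr normr0.
exact: (psi_word_cylinder HB).
Qed.

End Observables.

(** * Typical base points *)

Section BaseMeasure.
Context {R : realType} {d : nat} {a b : 'I_d -> R} {G dG : 'I_d -> R -> R}
  {K : R} {g : R -> R} {f : R * R -> R} {l r M Lam lam : R} {N : nat}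
  {p rr : nat -> R}.
Hypothesis H : contracting_skew a b G dG K g f l r M Lam lam N p rr.
Implicit Types (i : 'I_d) (s t x y : R) (z : R * R) (j k n : nat) (w : seq 'I_d).
Let HB := cs_base H.
Local Notation word_cylinder := (@word_cylinder R d a b g).
Local Notation psi_word := (@psi_word R d a b G).
Local Notation phi := (skew_product g f).
Local Notation phi_tot := (@phi_tot R g f l r).
Local Notation g_tot := (@base_tot R g).
Local Notation region := (cylinder `[l, r]%classic).
Local Notation J := (@cell R p rr).
Local Notation leb := (@lebesgue_measure R).
Local Notation observable := (@observable R d a b g l r).

Context {m : probability (plane R) R} {W : plane R -> plane R} {Q : set (plane R)}
  {c C : R}.
Hypothesis HE : base_extension g m W Q c C.
Let mQ := be_meas HE.
Let Q1 := be_full HE.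
Let mW := be_shift HE.
Let Winv := be_inv HE.
Let QW := be_base HE.
Let marg := be_marg HE.

Definition base_measure : probability (line R) R :=
  image_probability (@measurable_fst _ _ (line R) (line R)) m.

Lemma base_measureE A : base_measure A = m (fst @^-1` A).
Proof. exact: image_probabilityE. Qed.

Let mpre_fst (A : set (line R)) : measurable A -> measurable (fst @^-1` A : set (plane R)).
Proof. by move=> mA; rewrite -[X in measurable X]setTI; exact: measurable_fst. Qed.

Lemma base_measure01 : base_measure `]0, 1]%classic = 1%E.
Proof.
rewrite base_measureE -Q1; apply: (probability_eq_on mQ Q1) => //.
  by apply: mpre_fst; exact: measurable_itv.
by move=> z Qz; split => // _; have [] := QW Qz.
Qed.

Lemma base_measure_bounds (A : set (line R)) : measurable A -> A `<=` `]0, 1]%classic ->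
  (c%:E * leb A <= base_measure A <= C%:E * leb A)%E.
Proof.
move=> mA A01; rewrite base_measureE.
rewrite (_ : fst @^-1` A = A `*` setT); first exact: marg.
by apply/seteqP; split => z //= [].
Qed.

Lemma base_invariant A : measurable A -> base_measure (g_tot @^-1` A) = base_measure A.
Proof.
move=> mA; have mgA : measurable (g_tot @^-1` A).
  by rewrite -[X in measurable X]setTI; exact: (measurable_g_tot H).
rewrite !base_measureE -Winv; last exact: mpre_fst.
apply: (probability_eq_on mQ Q1).
- by rewrite -[X in measurable X]setTI; apply: mW => //; exact: mpre_fst.
- exact: mpre_fst.
- move=> z Qz /=; have [z1 QWz gW] := QW Qz; have [W1 _ _] := QW QWz.
  by rewrite /base_tot W1 gW.
Qed.

Let tau := iter N g_tot.

Let mtau : measurable_fun setT (tau : line R -> line R).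
Proof. by apply: measurable_iter; exact: (measurable_g_tot H). Qed.

Let tau_inv (A : set (line R)) : measurable A -> base_measure (tau @^-1` A) = base_measure A.
Proof.
by apply: iter_invariant; [exact: (measurable_g_tot H)|exact: base_invariant].
Qed.

(** The base measure has the null sets of Lebesgue measure on ]0, 1]. *)
Lemma base_ergodic A : measurable A -> tau @^-1` A = A ->
  base_measure A = 0%E \/ base_measure A = 1%E.
Proof.
move=> mA tauA.
have inv t : t \in `]0, 1] -> A (iter N g t) <-> A t.
  by move=> t01; rewrite -{2}tauA /preimage /= /tau (iter_g_totE H).
have m01 : measurable (`]0, 1]%classic : set (line R)) by exact: measurable_itv.
have [A0|A1] := invariant_set_dichotomy HB (cs_N H) mA inv; [left|right].
- have -> : base_measure A = base_measure (A `&` `]0, 1]%classic).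
    apply: (probability_eq_on m01 base_measure01) => //; first exact: measurableI.
    by move=> t; split => [At|[]].
  apply/eqP; rewrite eq_le measure_ge0 andbT.
  have /andP[_] := @base_measure_bounds (A `&` `]0, 1]%classic) (measurableI _ _ mA m01) (@subIsetr _ _ _).
  by rewrite A0 mule0.
- have z0 : base_measure (`]0, 1]%classic `\` A) = 0%E.
    apply/eqP; rewrite eq_le measure_ge0 andbT.
    have /andP[_] := @base_measure_bounds (`]0, 1]%classic `\` A) (measurableD m01 mA) (@subDsetl _ _ _).
    by rewrite A1 mule0.
  have -> : base_measure A = base_measure (~` (`]0, 1]%classic `\` A)).
    apply: (probability_eq_on m01 base_measure01) => //; first by apply/measurableC/measurableD.
    by move=> t t01; split => [At []//|h]; apply: contrapT => nA; apply: h.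
  by rewrite probability_setC ?z0 ?sube0//; exact: measurableD.
Qed.

Definition frequency w n t : R := n%:R^-1 * birkhoff_sum tau (\1_(word_cylinder w)) n t.

(** The sets of words being countable, almost every point is typical. *)
Definition typical t := t \in `]0, 1] /\ forall w,
  frequency w n t @[n --> \oo] --> fine (base_measure (word_cylinder w)).

Lemma ae_typical : {ae base_measure, forall t, typical t}.
Proof.
have H1 : {ae base_measure, forall t, t \in `]0, 1]}.
  exists (~` `]0, 1]%classic : set (line R)); split.
  - by apply: measurableC; exact: measurable_itv.
  - rewrite probability_setC; last exact: measurable_itv.
    by rewrite base_measure01 subee.
  - by move=> t /= nt; exact: nt.
have H2 w : {ae base_measure, forall t,
    frequency w k t @[k --> \oo] --> fine (base_measure (word_cylinder w))}.
  have mw := measurable_word_cylinder HB w.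
  have -> : fine (base_measure (word_cylinder w)) = \int[base_measure]_t \1_(word_cylinder w) t.
    by rewrite /Rintegral integral_indic// setIT.
  by apply: (birkhoff mtau tau_inv base_ergodic); exact: integrable_indic.
pose P n t := if @unpickle (seq 'I_d) n is Some w then
    frequency w k t @[k --> \oo] --> fine (base_measure (word_cylinder w)) else True.
have H3 n : {ae base_measure, forall t, P n t}.
  rewrite /P; case: (unpickle n) => [w|]; first exact: H2.
  by apply: (@filterE _ (almost_everywhere base_measure)).
have H4 : {ae base_measure, forall t n, P n t} by exact: ae_foralln.
have FF : Filter (almost_everywhere base_measure) by exact: ae_filter_ringOfSetsType.
apply: filterS2 H1 H4 => t t01 ht; split => // w.
by have := ht (pickle w); rewrite /P pickleK.
Qed.

End BaseMeasure.

(** * The attracting graph over the natural extension *)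

Section Attractor.
Context {R : realType} {d : nat} {a b : 'I_d -> R} {G dG : 'I_d -> R -> R}
  {K : R} {g : R -> R} {f : R * R -> R} {l r M Lam lam : R} {N : nat}
  {p rr : nat -> R}.
Hypothesis H : contracting_skew a b G dG K g f l r M Lam lam N p rr.
Implicit Types (i : 'I_d) (s t x y : R) (z : R * R) (j k n : nat) (w : seq 'I_d).
Let HB := cs_base H.
Local Notation phi := (skew_product g f).
Local Notation phi_tot := (@phi_tot R g f l r).
Local Notation region := (cylinder `[l, r]%classic).
Local Notation J := (@cell R p rr).
Context {m : probability (plane R) R} {W : plane R -> plane R} {Q : set (plane R)}
  {c C : R}.
Hypothesis HE : base_extension g m W Q c C.
Let mQ := be_meas HE.
Let Q1 := be_full HE.
Let mW := be_shift HE.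
Let Winv := be_inv HE.
Let QW := be_base HE.

Lemma iter_shift n z : Q z ->
  [/\ Q (iter n W z), (iter n W z).1 \in `]0, 1] & iter n g (iter n W z).1 = z.1].
Proof.
move=> Qz; elim: n => [|n [IH1 IH2 IH3]]; first by have [] := QW Qz.
have [_ QWn gW] := QW IH1; have [W1 _ _] := QW QWn.
by split => //=; rewrite -iterS iterSr /= gW.
Qed.

(** Start at the centre p_0 above the base point k * N steps in the past, and come
    back to the present. *)
Definition approx_fiber k z : R := (iter (k * N) phi_tot ((iter (k * N) W z).1, p 0%N)).2.

Let p_period k : p (0 + k * N)%N = p 0%N.
Proof. by elim: k => // k IH; rewrite mulSn addnCA addnC (cs_p H). Qed.

Let rr_period k : rr (0 + k * N)%N = rr 0%N.
Proof. by elim: k => // k IH; rewrite mulSn addnCA addnC (cs_rrN H). Qed.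

Lemma center_J : J 0 (p 0%N).
Proof. by rewrite /cell /= subrr normr0 (cs_rr H). Qed.

Lemma return_J n t x : t \in `]0, 1] -> J 0 x -> J 0 (iter (n * N) phi (t, x)).2.
Proof.
by move=> t01 xJ; have := iter_phi_J H (n * N) t01 xJ; rewrite /cell p_period rr_period.
Qed.

Let contract_period n t x y : t \in `]0, 1] -> J 0 x -> J 0 y ->
  `|(iter (n * N) phi (t, x)).2 - (iter (n * N) phi (t, y)).2| <= lam ^+ n * `|x - y|.
Proof.
move=> t01 xJ yJ; apply: le_trans (iter_phi_contract H (n * N) t01 xJ yJ) _.
rewrite rr_period divff ?gt_eqF ?(cs_rr H)// mulr1 ler_wpM2r//.
have /andP[l0 l1] := cs_lam H.
by rewrite ler_wiXn2l ?(ltW l0) ?(ltW l1)// leq_pmulr// (cs_N H).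
Qed.

Lemma approx_fiberE k z : Q z ->
  approx_fiber k z = (iter (k * N) phi ((iter (k * N) W z).1, p 0%N)).2.
Proof.
move=> Qz; rewrite /approx_fiber (iter_phi_totE H)//; apply/region_iff => /=.
by have [_ -> _] := iter_shift (k * N) Qz; rewrite (J_itv H center_J).
Qed.

Lemma approx_fiberD k n z : Q z -> let y := iter (k * N) W z in
  approx_fiber (k + n) z = (iter (k * N) phi (y.1, approx_fiber n y)).2.
Proof.
move=> Qz y; have [Qy y01 _] := iter_shift (k * N) Qz.
rewrite !approx_fiberE//.
rewrite mulnDl iterD; congr (iter _ _ _).2.
rewrite addnC iterD -/y [LHS]surjective_pairing iter_phi1.
by have [_ _ ->] := iter_shift (n * N) Qy.
Qed.

Let approx_fiber_J n z : Q z -> J 0 (approx_fiber n z).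
Proof.
by move=> Qz; rewrite approx_fiberE//; apply: return_J => //; [have [] := iter_shift (n * N) Qz|exact: center_J].
Qed.

Lemma approx_fiber_dist k n z : Q z ->
  `|approx_fiber (k + n) z - approx_fiber k z| <= lam ^+ k * rr 0%N.
Proof.
move=> Qz; have [Qy y01 _] := iter_shift (k * N) Qz.
have l0 : 0 <= lam ^+ k by have /andP[l0 l1] := cs_lam H; rewrite exprn_ge0 ?(ltW l0).
rewrite (approx_fiberD k n Qz) (approx_fiberE k Qz).
apply: le_trans (contract_period k y01 (approx_fiber_J n Qy) center_J) _.
by rewrite ler_wpM2l// ltW//; exact: approx_fiber_J.
Qed.

Definition fiber z : R := lim (approx_fiber k z @[k --> \oo]).

Lemma approx_fiber_cvg z : Q z -> approx_fiber k z @[k --> \oo] --> fiber z.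
Proof.
move=> Qz; apply: cauchy_cvg; apply: cauchy_exP => e e0.
have [l0 l1] := andP (cs_lam H).
have [n0 Hn0] : exists n0, forall n, (n0 <= n)%N -> lam ^+ n < e / rr 0%N.
  by apply: small_power; rewrite ?(ltW l0)// divr_gt0// (cs_rr H).
exists (approx_fiber n0 z); exists n0 => // n /= n0n.
rewrite /ball /= -(subnKC n0n) distrC.
apply: le_lt_trans (approx_fiber_dist n0 (n - n0) Qz) _.
by rewrite -ltr_pdivlMr ?(cs_rr H)//; exact: Hn0.
Qed.

Lemma fiber_near k z : Q z -> `|fiber z - approx_fiber k z| <= lam ^+ k * rr 0%N.
Proof.
move=> Qz; apply: (cvgr_to_le (cvg_norm (cvgB (approx_fiber_cvg Qz) (cvg_cst _)))).
by exists k => // n /= kn; rewrite -(subnKC kn); exact: approx_fiber_dist.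
Qed.

Lemma fiber_core z : Q z -> `|fiber z - p 0%N| <= lam * rr 0%N.
Proof.
move=> Qz; apply: (cvgr_to_le (cvg_norm (cvgB (approx_fiber_cvg Qz) (cvg_cst _)))).
exists 1%N => // n /= n0; rewrite (_ : (_ - _) n = approx_fiber n z - p 0%N)// approx_fiberE//.
have nN : (0 < n * N)%N by rewrite muln_gt0 n0 (cs_N H).
have [_ y01 _] := iter_shift (n * N) Qz.
by have := iter_phi_core H nN y01 center_J; rewrite p_period rr_period.
Qed.

Lemma fiber_J z : Q z -> J 0 (fiber z).
Proof.
move=> Qz; apply: le_lt_trans (fiber_core Qz) _.
by have /andP[_ l1] := cs_lam H; rewrite gtr_pMl ?(cs_rr H).
Qed.

(** The limit does not depend on where in J_0 the orbits started, so coming back from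
    the remote past may be stopped k turns ago. *)
Lemma fiber_shift k z : Q z ->
  fiber z = (iter (k * N) phi ((iter (k * N) W z).1, fiber (iter (k * N) W z))).2.
Proof.
move=> Qz; set y := iter (k * N) W z.
have [Qy y01 _] := iter_shift (k * N) Qz.
apply: (@cvg_unique _ _ (approx_fiber (k + n)%N z @[n --> \oo])) => //.
  rewrite /= (eq_cvg _ (g := fun n => approx_fiber (n + k) z)); last by move=> n; rewrite addnC.
  by rewrite (cvg_shiftn k (fun n => approx_fiber n z)); exact: approx_fiber_cvg.
apply/cvgrPdist_lt => e e0.
have [l0 l1] := andP (cs_lam H).
have [n0 Hn0] : exists n0, forall n, (n0 <= n)%N -> lam ^+ n < e / rr 0%N.
  by apply: small_power; rewrite ?(ltW l0)// divr_gt0// (cs_rr H).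
exists n0 => // n /= n0n; rewrite (approx_fiberD k n Qz) -/y.
apply: le_lt_trans (contract_period k y01 (fiber_J Qy) (approx_fiber_J n Qy)) _.
apply: (@le_lt_trans _ _ (lam ^+ n * rr 0%N)); last first.
  by rewrite -ltr_pdivlMr ?(cs_rr H)//; exact: Hn0.
apply: le_trans (fiber_near n Qy); rewrite ler_piMl//.
by rewrite exprn_ile1 ?(ltW l0) ?(ltW l1).
Qed.

Definition attractor_point z : plane R := if z \in Q then (z.1, fiber z) else (1, p 0%N).

Lemma measurable_attractor_point : measurable_fun setT (attractor_point : plane R -> plane R).
Proof.
apply/measurable_fun_pairP; split.
- apply: (@measurable_fun_split _ _ _ _ Q _ fst (cst 1)) => //.
  + by apply: measurable_funTS; exact: measurable_fst.
  + by move=> z Qz; rewrite /attractor_point /= mem_set.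
  + by move=> z nQz; rewrite /attractor_point /= memNset.
- apply: (@measurable_fun_split _ _ _ _ Q _ fiber (cst (p 0%N))) => //.
  + apply: (@measurable_fun_cvg _ _ _ _ approx_fiber) => // [k|z Qz]; last exact: approx_fiber_cvg.
    apply: measurable_funTS; apply: (measurableT_comp (@measurable_snd _ _ (line R) (line R))).
    apply: measurableT_comp.
      by apply: measurable_iter; exact: (measurable_phi_tot H).
    apply/measurable_fun_pairP; split => //=.
    have mk : measurable_fun setT (iter (k * N) W : plane R -> plane R) by exact: measurable_iter.
    exact: (measurableT_comp (@measurable_fst _ _ (line R) (line R)) mk).
    exact: measurable_cst.
  + by move=> z Qz; rewrite /attractor_point /= mem_set.
  + by move=> z nQz; rewrite /attractor_point /= memNset.
Qed.

Definition section_measure : probability (plane R) R :=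
  image_probability measurable_attractor_point m.

Let mpre (F : plane R -> plane R) (A : set (plane R)) :
  measurable_fun setT F -> measurable A -> measurable (F @^-1` A).
Proof. by move=> mF mA; rewrite -[X in measurable X]setTI; exact: mF. Qed.

(** Almost every point is of the form (z.1, fiber z) with z in Q. *)
Lemma section_measure_eq (A B : set (plane R)) : measurable A -> measurable B ->
  (forall z, Q z -> A (z.1, fiber z) <-> B z) -> section_measure A = m B.
Proof.
move=> mA mB AB; rewrite image_probabilityE; apply: (probability_eq_on mQ Q1) => //.
  by apply: mpre => //; exact: measurable_attractor_point.
by move=> z Qz; rewrite /preimage /= /attractor_point mem_set//; exact: AB.
Qed.

(** The fibre coordinate of a return to J_0 lies in this compact part of J_0. *)
Definition section_core : set (plane R) :=
  `]0, 1]%classic `*` [set x : R | `|x - p 0%N| <= lam * rr 0%N].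

Lemma measurable_section_core : measurable section_core.
Proof.
apply: measurableX; first exact: measurable_itv.
rewrite (_ : [set _ | _] = `[p 0%N - lam * rr 0%N, p 0%N + lam * rr 0%N]%classic).
  exact: measurable_itv.
by apply/seteqP; split => x /=; rewrite in_itv/= ler_norml => /andP[? ?]; apply/andP; split; lra.
Qed.

Lemma section_core_region : section_core `<=` region.
Proof.
move=> z [z1 /= z2]; apply/region_iff; split => //.
apply: (@J_itv _ _ _ _ _ _ _ _ _ _ _ _ _ _ _ _ _ H 0); apply: le_lt_trans z2 _.
by have /andP[_ l1] := cs_lam H; rewrite gtr_pMl ?(cs_rr H).
Qed.

Lemma section_measure_core : section_measure section_core = 1%E.
Proof.
rewrite (@section_measure_eq _ Q) //; first exact: measurable_section_core.
move=> z Qz; split => // _; split => /=; last exact: fiber_core.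
by have [] := QW Qz.
Qed.

Lemma section_measure_base (A : set (line R)) : measurable A ->
  section_measure (fst @^-1` A) = @base_measure R m A.
Proof.
move=> mA; have mA' : measurable (fst @^-1` A : set (plane R)).
  by rewrite -[X in measurable X]setTI; exact: measurable_fst.
by rewrite base_measureE; exact: section_measure_eq.
Qed.

(** The measure m is invariant under W, and by [fiber_shift] phi^N undoes W^N on the
    attracting graph. *)
Lemma section_invariant (A : set (plane R)) : measurable A ->
  section_measure (iter N phi_tot @^-1` A) = section_measure A.
Proof.
move=> mA; have mWN : measurable_fun setT (iter N W) by exact: measurable_iter.
have mF : measurable_fun setT (iter N phi_tot : plane R -> plane R).
  by apply: measurable_iter; exact: (measurable_phi_tot H).
rewrite [LHS]image_probabilityE -(iter_invariant mW N Winv); last first.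
  by apply: mpre; [exact: measurable_attractor_point|exact: mpre].
rewrite -[RHS]/(section_measure A).
symmetry; apply: section_measure_eq => //.
  apply: (mpre mWN); apply: (mpre measurable_attractor_point); exact: (mpre mF).
move=> z Qz; have [Qy y01 gy] := iter_shift N Qz.
rewrite /preimage /= /attractor_point mem_set// (iter_phi_totE H); last first.
  by apply/region_iff; split => //=; exact: (J_itv H (fiber_J Qy)).
rewrite [iter N phi _]surjective_pairing iter_phi1 /= gy.
by have := fiber_shift 1 Qz; rewrite mul1n => <-.
Qed.

End Attractor.

(** What the later parts use of the invariant measure on ]0, 1] x J_0; T is a set of
    typical base points. *)
Record section_srb (R : realType) (d : nat) (a b : 'I_d -> R) (g : R -> R)
    (f : R * R -> R) (l r lam : R) (N : nat) (p rr : nat -> R)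
    (nu0 : probability (plane R) R) (T : set (line R)) : Prop := SectionSrb {
  ss_core : nu0 (@section_core R lam p rr) = 1%E;
  ss_inv : forall A : set (plane R), measurable A ->
    nu0 (iter N (@phi_tot R g f l r) @^-1` A) = nu0 A;
  ss_null : forall A : set (line R), measurable A -> A `<=` `]0, 1]%classic ->
    lebesgue_measure A = 0%E -> nu0 (fst @^-1` A) = 0%E;
  ss_meas : measurable T;
  ss_sub : T `<=` `]0, 1]%classic;
  ss_pos : (0 < lebesgue_measure T)%E;
  ss_full : nu0 (fst @^-1` T) = 1%E;
  ss_freq : forall t w, T t ->
    @frequency R d a b g N w n t @[n --> \oo] --> fine (nu0 (fst @^-1` (@word_cylinder R d a b g w))) }.

Theorem section_srb_exists (R : realType) (d : nat) (a b : 'I_d -> R)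
   (G dG : 'I_d -> R -> R) (K : R) (g : R -> R) (f : R * R -> R)
   (l r M Lam lam : R) (N : nat) (p rr : nat -> R) :
  contracting_skew a b G dG K g f l r M Lam lam N p rr ->
  exists nu0 T, @section_srb R d a b g f l r lam N p rr nu0 T.
Proof.
move=> H; have HB := cs_base H.
have [m [W [Q [c [C HE]]]]] := natural_extension HB; have c0 := be_c HE.
have m01 : measurable (`]0, 1]%classic : set (line R)) by exact: measurable_itv.
have [B [mB B0 tB]] := ae_typical H HE.
have mT : measurable (`]0, 1]%classic `\` B) by exact: measurableD.
exists (section_measure H HE), (`]0, 1]%classic `\` B); split.
- exact: section_measure_core.
- by move=> A mA; rewrite (section_invariant H HE).
- move=> A mA A01 A0; rewrite (section_measure_base H HE mA).
  apply/eqP; rewrite eq_le measure_ge0 andbT.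
  by have /andP[_] := base_measure_bounds HE mA A01; rewrite A0 mule0.
- exact: mT.
- exact: subDsetl.
- have mI : measurable (`]0, 1]%classic `&` B) by exact: measurableI.
  have I0 : @lebesgue_measure R (`]0, 1]%classic `&` B) = 0%E.
    have /andP[+ _] := base_measure_bounds HE mI (@subIsetl _ _ _).
    have -> : @base_measure R m (`]0, 1]%classic `&` B) = 0%E.
      by apply/eqP; rewrite eq_le measure_ge0 andbT -B0; apply: le_measure; rewrite ?inE//; exact: subIsetr.
    rewrite pmule_rle0 ?lte_fin// => h.
    by apply/eqP; rewrite eq_le h measure_ge0.
  have E : @lebesgue_measure R `]0, 1]%classic = (@lebesgue_measure R (`]0%R, 1%R] `\` B)%classic +
      @lebesgue_measure R (`]0%R, 1%R] `&` B)%classic)%E by exact: measureDI.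
  move: E; rewrite I0 adde0 lebesgue_measure_itv /= lte_fin ltr01 oppr0 adde0 => <-.
  by rewrite lte_fin.
- rewrite (section_measure_base H HE mT) -(base_measure01 HE).
  have mC : measurable (~` B) by exact: measurableC.
  have C1 : @base_measure R m (~` B) = 1%E by rewrite probability_setC// B0 sube0.
  by apply: (probability_eq_on mC C1) => // t nB; split => [[]|].
- move=> t w [t01 nB]; have [_ /(_ w)] : @typical R d a b g N m t.
    by apply: contrapT => nt; apply: nB; exact: tB.
  by rewrite (section_measure_base H HE)//; exact: (measurable_word_cylinder HB).
Qed.

(** * Integrals and averages *)

Section ProbabilityIntegral.
Context d (T : measurableType d) (R : realType) (P : probability T R).
Implicit Types (F : T -> R) (B e : R).

Lemma bounded_integrable F B : measurable_fun setT F -> (forall z, `|F z| <= B) ->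
  P.-integrable setT (EFin \o F).
Proof.
move=> mF FB; apply: measurable_bounded_integrable => //.
  by apply: (le_lt_trans (probability_le1 P measurableT)); exact: ltry.
exists B; split; first exact: num_real.
by move=> x Bx z _ /=; apply: le_trans (FB z) _; exact: ltW.
Qed.

Lemma dist_Rintegral F1 F2 (Q : set T) e :
  P.-integrable setT (EFin \o F1) -> P.-integrable setT (EFin \o F2) ->
  measurable Q -> P Q = 1%E -> (forall z, Q z -> `|F1 z - F2 z| <= e) ->
  `|\int[P]_z F1 z - \int[P]_z F2 z| <= e.
Proof.
move=> i1 i2 mQ Q1 F12; rewrite -RintegralB//.
have iB : P.-integrable setT (EFin \o (F1 \- F2)) by exact: (integrableB measurableT i1 i2).
have e0 : 0 <= e.
  have [E|/set0P[z /F12]] := eqVneq Q set0; last by apply: le_trans.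
  by move: Q1; rewrite E measure0 => /eqP; rewrite eqe eq_sym oner_eq0.
apply: (le_trans (le_normr_Rintegral _ iB)) => //.
rewrite /Rintegral -lee_fin fineK; last first.
  by apply: integrable_fin_num => //; exact: integrable_norm.
apply: (@le_trans _ _ (\int[P]_z (cst e%:E) z)%E); last first.
  rewrite integral_cst// -[leRHS]mule1 lee_wpmul2l ?lee_fin//; exact: (probability_le1 P).
have miB : measurable_fun setT (fun z => `|(F1 z - F2 z)%:E|%E).
  by apply: measurableT_comp => //; exact: measurable_int iB.
apply: ae_ge0_le_integral => //.
exists (~` Q); split.
- exact: measurableC.
- by have := probability_setC P mQ; rewrite Q1 subee.
- by move=> z /= nz Qz; apply: nz => _; rewrite lee_fin; exact: F12.
Qed.

Lemma eq_Rintegral_on F1 F2 (Q : set T) :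
  P.-integrable setT (EFin \o F1) -> P.-integrable setT (EFin \o F2) ->
  measurable Q -> P Q = 1%E -> (forall z, Q z -> F1 z = F2 z) ->
  \int[P]_z F1 z = \int[P]_z F2 z.
Proof.
move=> i1 i2 mQ Q1 F12; apply/eqP; rewrite -subr_eq0 -normr_le0.
by apply: (dist_Rintegral i1 i2 mQ Q1) => z /F12 ->; rewrite subrr normr0.
Qed.

Lemma Rintegral_invariant (tau : T -> T) F : measurable_fun setT tau ->
  (forall A, measurable A -> P (tau @^-1` A) = P A) ->
  P.-integrable setT (EFin \o F) -> \int[P]_z F (tau z) = \int[P]_z F z.
Proof.
by move=> mtau inv iF; rewrite /Rintegral (integral_invariant_set mtau inv measurableT _ iF).
Qed.

Lemma integrable_Rsum (I : Type) (s : seq I) (h : I -> T -> R) :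
  (forall i, P.-integrable setT (EFin \o h i)) ->
  P.-integrable setT (EFin \o fun z => \sum_(i <- s) h i z).
Proof.
move=> ih.
have iS := @integrable_sum _ _ _ P _ measurableT _ s xpredT (fun i z => (h i z)%:E) (fun i _ => ih i).
by apply: eq_integrable iS => // z _ /=; rewrite sumEFin.
Qed.

Lemma Rintegral_sum (I : Type) (s : seq I) (h : I -> T -> R) :
  (forall i, P.-integrable setT (EFin \o h i)) ->
  \int[P]_z (\sum_(i <- s) h i z) = \sum_(i <- s) \int[P]_z h i z.
Proof.
move=> ih; elim: s => [|i s IH].
  under eq_Rintegral do rewrite big_nil.
  by rewrite big_nil Rintegral_cst// mul0r.
under eq_Rintegral do rewrite big_cons.
by rewrite RintegralD// ?IH ?big_cons//; exact: integrable_Rsum.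
Qed.

Lemma bounded_cvg_Rintegral (F_ : nat -> T -> R) F B (Q : set T) :
  (forall n, measurable_fun setT (F_ n)) -> measurable_fun setT F ->
  (forall n z, `|F_ n z| <= B) -> measurable Q -> P Q = 1%E ->
  (forall z, Q z -> F_ n z @[n --> \oo] --> F z) ->
  \int[P]_z F_ n z @[n --> \oo] --> \int[P]_z F z.
Proof.
move=> mF_ mF FB mQ Q1 Fcvg.
have [] := @dominated_convergence _ _ _ P setT measurableT
    (fun n => EFin \o F_ n) (EFin \o F) (fun _ => B%:E).
- by move=> n; exact/measurable_EFinP.
- exact/measurable_EFinP.
- exists (~` Q); split.
  + exact: measurableC.
  + by have := probability_setC P mQ; rewrite Q1 subee.
  + move=> z /= nz Qz; apply: nz => _; apply: cvg_EFin; first exact: nearW.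
    exact: Fcvg.
- exact: finite_measure_integrable_cst.
- by apply: aeW => z n _ /=; rewrite lee_fin.
move=> iF _; rewrite -(fineK (integrable_fin_num measurableT iF)).
exact: fine_cvg.
Qed.

End ProbabilityIntegral.

Lemma Rintegral_image d1 d2 (T1 : measurableType d1) (T2 : measurableType d2) (R : realType)
    (P : probability T1 R) (h : T1 -> T2) (mh : measurable_fun setT h) (F : T2 -> R) (B : R) :
  measurable_fun setT F -> (forall z, `|F z| <= B) ->
  \int[image_probability mh P]_z F z = \int[P]_z F (h z).
Proof.
move=> mF FB; rewrite /Rintegral.
rewrite [X in fine X = _](_ : _ = (\int[pushforward P h]_z (F z)%:E)%E); last first.
  by apply: eq_measure_integral => A mA _.
rewrite integral_pushforward//; first exact/measurable_EFinP.
apply: (@bounded_integrable _ _ _ _ _ B); last by move=> z; exact: FB.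
exact: measurableT_comp.
Qed.

Lemma Rintegral_mean d (T : measurableType d) (R : realType) (c : {nonneg R})
    (m : nat -> {measure set T -> \bar R}) n (D : set T) (f : T -> R) :
  measurable D -> (forall k, (m k).-integrable D (EFin \o f)) ->
  \int[mscale c (msum m n)]_(x in D) f x =
    c%:num * \sum_(0 <= k < n) \int[m k]_(x in D) f x.
Proof.
move=> mD mi; have mf : measurable_fun D (EFin \o f) by exact: measurable_int (mi 0%N).
have part (h : T -> \bar R) : measurable_fun D h -> (forall x, D x -> 0 <= h x)%E ->
    (forall k, \int[m k]_(x in D) h x \is a fin_num)%E ->
    (\int[mscale c (msum m n)]_(x in D) h x =
      (c%:num * \sum_(0 <= k < n) fine (\int[m k]_(x in D) h x))%:E)%E.
  move=> mh h0 hfin; rewrite ge0_integral_mscale// ge0_integral_measure_sum//.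
  rewrite EFinM -sumEFin; congr (_ * _)%E; rewrite big_mkord.
  by apply: eq_bigr => k _; rewrite fineK.
have p_fin k : (\int[m k]_(x in D) ((EFin \o f)^\+ x) \is a fin_num)%E.
  exact: integrable_pos_fin_num.
have n_fin k : (\int[m k]_(x in D) ((EFin \o f)^\- x) \is a fin_num)%E.
  exact: integrable_neg_fin_num.
rewrite /Rintegral integralE (part _ _ _ p_fin)//; last exact: measurable_funepos.
rewrite (part _ _ _ n_fin)//; last exact: measurable_funeneg.
rewrite -EFinB /= -mulrBr -sumrB; congr (_ * _); apply: eq_bigr => k _.
rewrite -fineB//; congr (fine _); rewrite [RHS]integralE //.
Qed.

Section MeanProbability.
Context d (T : measurableType d) (R : realType) (P : nat -> probability T R) (n : nat).
Hypothesis n0 : (0 < n)%N.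

Definition mean_measure : {measure set T -> \bar R} :=
  mscale ((n%:R : R)^-1)%:nng (msum (fun k => P k : {measure set T -> \bar R}) n).
Definition mean_probability_fun := mean_measure : set T -> \bar R.
HB.instance Definition _ := Measure.copy mean_probability_fun mean_measure.
Lemma mean_probability_setT : mean_probability_fun setT = 1%E.
Proof.
rewrite -[LHS]/((n%:R^-1)%:E * \sum_(k < n) P k setT)%E.
under eq_bigr do rewrite probability_setT.
rewrite sumEFin -EFinM big_const_ord iter_addr_0.
by rewrite mulVf// pnatr_eq0 -lt0n.
Qed.
HB.instance Definition _ :=
  Measure_isProbability.Build _ _ _ mean_probability_fun mean_probability_setT.
Definition mean_probability : probability T R := mean_probability_fun.

Lemma mean_probabilityE A :
  mean_probability A = ((n%:R^-1)%:E * \sum_(0 <= k < n) P k A)%E.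
Proof. by rewrite big_mkord. Qed.

Lemma Rintegral_mean_probability (D : set T) (f : T -> R) : measurable D ->
  (forall k, (P k).-integrable D (EFin \o f)) ->
  \int[mean_probability]_(x in D) f x = n%:R^-1 * \sum_(0 <= k < n) \int[P k]_(x in D) f x.
Proof. by move=> mD fi; exact: (@Rintegral_mean _ _ R _ (fun k => P k : {measure set T -> \bar R}) n D f mD fi). Qed.

End MeanProbability.

Section Averages.
Context {R : realType}.
Implicit Types (u s : nat -> R) (n k : nat).

Definition average u n : R := n%:R^-1 * \sum_(0 <= k < n) u k.

Lemma dist_average u s n e : (forall k, `|u k - s k| <= e) -> 0 <= e ->
  `|average u n - average s n| <= e.
Proof.
move=> us e0; rewrite /average -mulrBr -sumrB normrM ger0_norm ?invr_ge0//.
case: n => [|n]; first by rewrite invr0 mul0r.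
rewrite mulrC ler_pdivrMr ?ltr0n//; apply: le_trans (ler_norm_sum _ _ _) _.
apply: (@le_trans _ _ (\sum_(0 <= k < n.+1) e)); first by apply: ler_sum.
by rewrite sumr_const_nat subn0 mulr_natr.
Qed.

Lemma dist_average_shift u q n B : (forall k, `|u k| <= B) ->
  `|average u n - average (fun k => u (q + k)%N) n| <= n%:R^-1 * (q%:R * B *+ 2).
Proof.
move=> uB; rewrite /average -mulrBr normrM ger0_norm ?invr_ge0// ler_wpM2l ?invr_ge0//.
elim: q => [|q IH]; first by rewrite !mul0r mul0rn subrr normr0.
have E : \sum_(0 <= k < n) u (q + k)%N - \sum_(0 <= k < n) u (q.+1 + k)%N =
    u q - u (q + n)%N.
  rewrite -sumrB; under eq_bigr do rewrite addSnnS.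
  elim: (n) => [|k IHk]; first by rewrite big_geq// addn0 subrr.
  by rewrite big_nat_recr//= IHk addrA subrK.
rewrite (_ : _ - _ = (\sum_(0 <= k < n) u k - \sum_(0 <= k < n) u (q + k)%N) + (u q - u (q + n)%N)); last first.
  by rewrite -E addrA subrK.
apply: le_trans (ler_normD _ _) _.
rewrite -natr1 mulrDl mulrnDl lerD// mul1r mulr2n.
by apply: le_trans (ler_normB _ _) _; rewrite lerD.
Qed.

(** Discarding the first q terms and replacing u by s changes the averages, in the
    limit, by at most e. *)
Lemma average_cvg u (B L : R) : (forall k, `|u k| <= B) ->
  (forall e, 0 < e -> exists q s S, [/\ forall k, `|u (q + k)%N - s k| <= e,
     average s n @[n --> \oo] --> S & `|S - L| <= e]) ->
  average u n @[n --> \oo] --> L.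
Proof.
move=> uB h; apply/cvgrPdist_lt => e e0.
have e5 : 0 < e / 5 by rewrite divr_gt0.
have [q [s [S [us sS SL]]]] := h _ e5.
move/cvgrPdist_lt : sS => /(_ _ e5) [n1 _ H1].
have [n2 Hn2] := real_lt_nat ((q%:R * B *+ 2) / (e / 5)).
exists (maxn n1 n2.+1) => // n /=; rewrite geq_max => /andP[n1n n2n].
have h1 := H1 n n1n.
have h2 := dist_average n us (ltW e5).
have h3 := dist_average_shift q n uB.
have h4 : n%:R^-1 * (q%:R * B *+ 2) < e / 5.
  have n0 : (0 : R) < n%:R by rewrite ltr0n (leq_ltn_trans _ n2n).
  rewrite mulrC ltr_pdivrMr// -ltr_pdivrMl// mulrC.
  by apply: lt_le_trans Hn2 _; rewrite ler_nat ltnW.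
move: h1 h2 h3 h4 SL; set A := average u n; set A' := average (fun k => _) n; set A'' := average s n.
rewrite !ltr_norml !ler_norml => /andP[? ?] /andP[? ?] /andP[? ?] ? /andP[? ?].
by apply/andP; split; lra.
Qed.

Lemma average_blocks u N q : average u (q * N) = average (fun k => N%:R^-1 * \sum_(0 <= j < N) u (k * N + j)%N) q.
Proof.
rewrite /average natrM invfM big_nat_mul -!mulrA; congr (_ * _).
rewrite -mulr_sumr; congr (_ * _); apply: eq_bigr => k _.
by rewrite mulSn -{1}(add0n (k * N)%N) big_addn addnK; apply: eq_bigr => j _; rewrite addnC.
Qed.

(** An incomplete block has fewer than N terms, which disappear after division by n. *)
Lemma average_cvg_blocks u N (B L : R) : (0 < N)%N -> (forall k, `|u k| <= B) ->
  average u (q * N) @[q --> \oo] --> L -> average u n @[n --> \oo] --> L.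
Proof.
move=> N0 uB uL; apply/cvgrPdist_lt => e e0.
have e2 : 0 < e / 2 by rewrite divr_gt0.
have B0 : 0 <= B by apply: le_trans (uB 0%N).
move/cvgrPdist_lt : uL => /(_ _ e2) [n1 _ H1].
have [n2 Hn2] := real_lt_nat ((N%:R * (B + `|L|)) / (e / 2)).
exists (maxn (n1 * N) n2.+1) => // n /=; rewrite geq_max => /andP[n1n n2n].
have n0 : (0 : R) < n%:R by rewrite ltr0n (leq_ltn_trans _ n2n).
pose S m := \sum_(0 <= k < m) (u k - L).
have SE m : S m = \sum_(0 <= k < m) u k - m%:R * L.
  by rewrite /S sumrB sumr_const_nat subn0 mulr_natl.
have S1 : S n = S (n %/ N * N)%N + \sum_(n %/ N * N <= k < n) (u k - L).
  by rewrite /S -big_cat_nat// leq_trunc_div.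
have h1 : `|\sum_(n %/ N * N <= k < n) (u k - L)| <= N%:R * (B + `|L|).
  apply: le_trans (ler_norm_sum _ _ _) _.
  apply: (@le_trans _ _ (\sum_(n %/ N * N <= k < n) (B + `|L|))).
    by apply: ler_sum => k _; apply: le_trans (ler_normB _ _) _; rewrite lerD.
  rewrite sumr_const_nat -[leLHS]mulr_natl; apply: ler_wpM2r; rewrite ?addr_ge0// ler_nat.
  by rewrite {1}(divn_eq n N) addKn ltnW// ltn_mod.
have h2 : `|S (n %/ N * N)%N| <= n%:R * (e / 2).
  have [->|q0] := posnP (n %/ N * N)%N; first by rewrite /S big_geq// normr0 mulr_ge0// ltW.
  have := H1 (n %/ N)%N; rewrite /= leq_divRL// => /(_ n1n) /ltW h.
  rewrite SE (_ : _ - _ = (n %/ N * N)%:R * (average u (n %/ N * N) - L)); last first.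
    by rewrite mulrBr /average mulVKf// pnatr_eq0 -lt0n.
  rewrite normrM ger0_norm// distrC ler_pM//.
  by rewrite ler_nat leq_trunc_div.
have h3 : N%:R * (B + `|L|) < n%:R * (e / 2).
  by rewrite -ltr_pdivrMr//; apply: lt_le_trans Hn2 _; rewrite ler_nat ltnW.
rewrite distrC (_ : _ - L = n%:R^-1 * S n); last first.
  by rewrite SE mulrBr mulKf// gt_eqF.
rewrite normrM gtr0_norm ?invr_gt0// mulrC ltr_pdivrMr// S1.
apply: le_lt_trans (ler_normD _ _) _.
by rewrite [X in _ < X](_ : _ = n%:R * (e / 2) + n%:R * (e / 2)); [exact: ler_ltD (le_trans _ _) (le_lt_trans h1 h3)|field].
Qed.

End Averages.

(** * Averages of observables along orbits *)

Section Convergence.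
Context {R : realType} {d : nat} {a b : 'I_d -> R} {G dG : 'I_d -> R -> R}
  {K : R} {g : R -> R} {f : R * R -> R} {l r M Lam lam : R} {N : nat}
  {p rr : nat -> R}.
Hypothesis H : contracting_skew a b G dG K g f l r M Lam lam N p rr.
Context {nu0 : probability (plane R) R} {T : set (line R)}.
Hypothesis HS : @section_srb R d a b g f l r lam N p rr nu0 T.
Implicit Types (i : 'I_d) (s t x y : R) (z : R * R) (j k n : nat) (w : seq 'I_d).
Let HB := cs_base H.
Local Notation word_cylinder := (@word_cylinder R d a b g).
Local Notation phi := (skew_product g f).
Local Notation phi_tot := (@phi_tot R g f l r).
Local Notation region := (cylinder `[l, r]%classic).
Local Notation J := (@cell R p rr).
Local Notation observable := (@observable R d a b g l r).
Local Notation core := (@section_core R lam p rr).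

Lemma core_J z : core z -> z.1 \in `]0, 1] /\ J 0 z.2.
Proof.
move=> [z1 /= z2]; split => //; apply: le_lt_trans z2 _.
by have /andP[_ l1] := cs_lam H; rewrite gtr_pMl ?(cs_rr H).
Qed.

Lemma observable_restrict u : observable u ->
  measurable_fun setT (u \_ region : plane R -> R) /\ exists B, forall z, `|(u \_ region) z| <= B.
Proof.
move=> [mu [B B0 uB] _]; split.
  by apply/(measurable_restrictT _ (@measurable_region R l r)).
by exists B => z; rewrite /patch; case: ifPn => [/set_mem/uB//|_]; rewrite normr0 ltW.
Qed.

Lemma return_inv q (A : set (plane R)) : measurable A ->
  nu0 (iter (q * N) phi_tot @^-1` A) = nu0 A.
Proof.
move=> mA; rewrite (_ : iter (q * N) phi_tot = iter q (iter N phi_tot)); last by apply/funext => z; rewrite iterM.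
 apply: iter_invariant => //; last exact: (ss_inv HS).
by apply: measurable_iter; exact: (measurable_phi_tot H).
Qed.

Lemma step_value n (v : seq 'I_d -> R) w t : size w = n -> word_cylinder w t ->
  \sum_(w' : n.-tuple 'I_d) v w' * \1_(word_cylinder w') t = v w.
Proof.
move=> /eqP sw wt; rewrite (bigD1 (Tuple sw))//= indicE mem_set// mulr1 big1 ?addr0//.
move=> w' w'w; rewrite indicE memNset ?mulr0// => w't.
move/eqP: w'w; apply; apply: val_inj => /=.
by apply: (word_cylinder_uniq HB _ w't wt); rewrite size_tuple (eqP sw).
Qed.

(** Along the orbit, u is e-close to a function of finitely many letters of the itinerary
    of t, whose averages converge because t is typical. By invariance the integral of
    that function is e-close to the integral of u. The initial height x is arbitrary in J_0,
    which is what gives the basin positive area. *)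
Theorem section_average_cvg u t x : observable u -> T t -> J 0 x ->
  average (fun k => u (iter (k * N) phi (t, x))) n @[n --> \oo] -->
    \int[nu0]_(z in region) u z.
Proof.
move=> ou Tt xJ; have t01 : t \in `]0, 1] by exact: (ss_sub HS).
have [mu0 [B uB0]] := observable_restrict ou.
rewrite Rintegral_mkcond.
have regk k : region (iter (k * N) phi (t, x)).
  by apply: (iter_phi_region H); apply/region_iff; split => //=; exact: (J_itv H xJ).
apply: (@average_cvg _ _ B) => [k|e e0].
  by have := uB0 (iter (k * N) phi (t, x)); rewrite /patch mem_set.
have [q [n [v Hv]]] := step_approximation H ou e0.
pose F (z : plane R) := \sum_(w : n.-tuple 'I_d) v w * \1_(fst @^-1` word_cylinder w) z.
exists q, (fun k => F (iter (k * N) g t, 0)),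
  (\sum_(w : n.-tuple 'I_d) v w * fine (nu0 (fst @^-1` word_cylinder w))).
have FE z w : size w = n -> word_cylinder w z.1 -> F z = v w.
  by move=> sw wz; rewrite -(step_value v sw wz).
have near_step t' x' : t' \in `]0, 1] -> J 0 x' ->
    `|u (iter (q * N) phi (t', x')) - F (t', 0)| <= e.
  move=> t'01 x'J; have [w wt'] := itinerary_word HB n t'01.
  by rewrite (FE (t', 0) w (size_tuple w) wt'); apply: Hv => //; rewrite size_tuple.
split.
- move=> k; rewrite mulnDl iterD [iter (k * N) phi _]surjective_pairing iter_phi1.
  apply: near_step; first exact: (iter_g01 HB).
  exact: (return_J H).
- have E m : average (fun k => F (iter (k * N) g t, 0)) m =
      \sum_(w : n.-tuple 'I_d) v w * @frequency R d a b g N w m t.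
    rewrite /average /F exchange_big mulr_sumr; apply: eq_bigr => w _.
    rewrite /frequency /birkhoff_sum -mulr_sumr mulrCA; congr (_ * (_ * _)).
    apply: eq_bigr => k _; rewrite -iterM (iter_g_totE H)//.
  rewrite (eq_cvg _ _ E).
  by apply: cvg_finite_sum => w; apply: cvgMr; exact: (ss_freq HS).
- have mcyl w : measurable (fst @^-1` word_cylinder w : set (plane R)).
    rewrite -[X in measurable X]setTI; apply: measurable_fst => //.
    exact: (measurable_word_cylinder HB).
  have int1 w : nu0.-integrable setT (EFin \o (\1_(fst @^-1` word_cylinder w) : plane R -> R)).
    by apply: integrable_indic.
  have int2 w : nu0.-integrable setT (EFin \o (fun z : plane R => v w * \1_(fst @^-1` word_cylinder w) z)).
    exact: (integrableZl measurableT _ (int1 w)).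
  have <- : \int[nu0]_z F z = \sum_(w : n.-tuple 'I_d) v w * fine (nu0 (fst @^-1` word_cylinder w)).
    rewrite /F Rintegral_sum//; apply: eq_bigr => w _.
    by rewrite RintegralZl// /Rintegral integral_indic// setIT.
  have mq : measurable_fun setT (iter (q * N) phi_tot : plane R -> plane R).
    by apply: measurable_iter; exact: (measurable_phi_tot H).
  have iu : nu0.-integrable setT (EFin \o (u \_ region)) by exact: bounded_integrable mu0 uB0.
  rewrite -(Rintegral_invariant mq (@return_inv q) iu) distrC.
  apply: (dist_Rintegral _ _ (@measurable_section_core R lam p rr) (ss_core HS)).
  + apply: (@bounded_integrable _ _ _ _ _ B); last by move=> z; exact: uB0.
    exact: (measurableT_comp mu0 mq).
  + exact: integrable_Rsum.
  + move=> [t' x'] /core_J[/= t'01 x'J].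
    have r' : region (t', x') by apply/region_iff; split => //=; exact: (J_itv H x'J).
    rewrite (iter_phi_totE H)// /patch mem_set; last exact: (iter_phi_region H).
    have := near_step t' x' t'01 x'J; congr (`|_ - _| <= _).
Qed.

End Convergence.

(** * Ergodicity of the section measure *)

Section Cutoff.
Context {R : realType}.
Implicit Types (a b t : R) (z : R * R) (n : nat).

(** The exponent vanishes for t <= a and equals -2 n (t - a) beyond, so these continuous
    functions decrease to the indicator of ]-oo, a]. *)
Definition cutoff n a t : R := expR (- (n%:R * (`|t - a| + (t - a)))).

Lemma cutoff_bound n a t : `|cutoff n a t| <= 1.
Proof.
rewrite ger0_norm ?expR_ge0// -expR0 ler_expR oppr_le0 mulr_ge0//.
by have := ler_norm (- (t - a)); rewrite normrN; lra.
Qed.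

Lemma cutoff_continuous n a : continuous (cutoff n a).
Proof.
move=> t; apply: continuous_comp; last exact: continuous_expR.
apply: cvgN; apply: cvgMr; apply: cvgD; first apply: cvg_norm.
  by apply: cvgB; [exact: cvg_id|exact: cvg_cst].
by apply: cvgB; [exact: cvg_id|exact: cvg_cst].
Qed.

Lemma cutoff_cvg a t : cutoff n a t @[n --> \oo] --> (\1_(`]-oo, a]%classic) t : R).
Proof.
have [ta|ta] := leP t a.
  rewrite indicE mem_set/=; last by rewrite in_itv.
  rewrite (_ : (fun n => cutoff n a t) = cst 1); first exact: cvg_cst.
  apply/funext => n; rewrite /cutoff ler0_norm ?subr_le0// addNr.
  by rewrite mulr0 oppr0 expR0.
rewrite indicE memNset/=; last by rewrite in_itv /= => /le_lt_trans/(_ ta); rewrite ltxx.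
rewrite (_ : (fun n => cutoff n a t) = (fun n => expR (- ((t - a) *+ 2)) ^+ n)).
  apply: cvg_expr; rewrite ger0_norm ?expR_ge0// -expR0 ltr_expR oppr_lt0.
  by rewrite pmulrn_lgt0// subr_gt0.
apply/funext => n; rewrite /cutoff gtr0_norm ?subr_gt0//.
by rewrite -expRM_natl mulr2n mulrN.
Qed.

Definition quadrant_cutoff n a b z : R := cutoff n a z.1 * cutoff n b z.2.

Lemma quadrant_cutoff_continuous n a b : continuous (quadrant_cutoff n a b).
Proof.
move=> z; apply: cvgM.
  apply: (@continuous_comp _ _ _ fst (cutoff n a)); first exact: cvg_fst.
  exact: cutoff_continuous.
apply: (@continuous_comp _ _ _ snd (cutoff n b)); first exact: cvg_snd.
exact: cutoff_continuous.
Qed.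

Lemma quadrant_cutoff_bound n a b z : `|quadrant_cutoff n a b z| <= 1.
Proof. by rewrite normrM mulr_ile1// cutoff_bound. Qed.

Lemma quadrant_cutoff_cvg a b z :
  quadrant_cutoff n a b z @[n --> \oo] --> (\1_(quadrant a b) z : R).
Proof.
rewrite (_ : \1_(quadrant a b) z = \1_(`]-oo, a]%classic) z.1 * \1_(`]-oo, b]%classic) z.2).
  by apply: cvgM; exact: cutoff_cvg.
by rewrite !indicE in_setX -natrM mulnb.
Qed.

End Cutoff.

(** Independence extends from quadrants to all Borel sets, and a set which is
    independent of itself has probability 0 or 1. *)
Lemma independent_of_quadrants (R : realType) (nu : probability (plane R) R) (A : set (plane R)) :
  measurable A ->
  (forall a b, nu (A `&` quadrant a b) = (nu A * nu (quadrant a b))%E) ->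
  nu A = 0%E \/ nu A = 1%E.
Proof.
move=> mA indep.
have nA : nu A \is a fin_num by exact: fin_num_measure.
have nA0 : 0 <= fine (nu A) by exact: fine_ge0.
pose m1 : {measure set (plane R) -> \bar R} := mrestr nu mA.
pose m2 : {measure set (plane R) -> \bar R} := mscale (NngNum nA0) nu.
have E : m1 A = m2 A.
  apply: plane_measure_unique => //.
    apply: (le_lt_trans _ (ltry 1)); rewrite /m1 /mrestr.
    by apply: probability_le1; exact: measurableI.
  move=> a b; rewrite -[LHS]/(nu (quadrant a b `&` A)) -[RHS]/((fine (nu A))%:E * nu (quadrant a b))%E.
  by rewrite fineK// setIC; exact: indep.
move: E; rewrite -[m1 A]/(nu (A `&` A)) -[m2 A]/((fine (nu A))%:E * nu A)%E setIid.
rewrite -(fineK nA) -EFinM /= => /eqP.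
rewrite eqe -subr_eq0 -{1}(mulr1 (fine _)) -mulrBr mulf_eq0 subr_eq0 => /orP[]/eqP.
  by move=> ->; left.
by move=> <-; right.
Qed.

Section SectionErgodicity.
Context {R : realType} {d : nat} {a b : 'I_d -> R} {G dG : 'I_d -> R -> R}
  {K : R} {g : R -> R} {f : R * R -> R} {l r M Lam lam : R} {N : nat}
  {p rr : nat -> R}.
Hypothesis H : contracting_skew a b G dG K g f l r M Lam lam N p rr.
Context {nu0 : probability (plane R) R} {T : set (line R)}.
Hypothesis HS : @section_srb R d a b g f l r lam N p rr nu0 T.
Implicit Types (i : 'I_d) (s t x y : R) (z : R * R) (j k n : nat) (w : seq 'I_d).
Local Notation phi := (skew_product g f).
Local Notation phi_tot := (@phi_tot R g f l r).
Local Notation region := (cylinder `[l, r]%classic).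
Local Notation observable := (@observable R d a b g l r).
Local Notation core := (@section_core R lam p rr).

Lemma section_full : nu0 (core `&` fst @^-1` T) = 1%E.
Proof.
have mT : measurable (fst @^-1` T : set (plane R)).
  by rewrite -[X in measurable X]setTI; apply: measurable_fst => //; exact: (ss_meas HS).
rewrite -(ss_core HS); apply: (probability_eq_on mT (ss_full HS)).
- by apply: measurableI => //; exact: measurable_section_core.
- exact: measurable_section_core.
- by move=> z zT; split => [[]|].
Qed.

Variable A : set (plane R).
Hypothesis mA : measurable A.
Hypothesis Ainv : forall z, region z -> A (iter N phi z) <-> A z.

Let full := core `&` fst @^-1` T.

Let mfull : measurable full.
Proof.
apply: measurableI; first exact: measurable_section_core.
by rewrite -[X in measurable X]setTI; apply: measurable_fst => //; exact: (ss_meas HS).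
Qed.

Let indic_iter k z : region z -> (\1_A (iter (k * N) phi_tot z) : R) = \1_A z.
Proof.
move=> rz; rewrite (iter_phi_totE H)// !indicE; congr (_%:R); congr nat_of_bool.
apply/idP/idP => /set_mem h; apply/mem_set; move: h; elim: k => //= k IH.
  rewrite mulSn iterD; move=> /Ainv h; apply: IH; apply: h.
  exact: (iter_phi_region H).
by move=> /IH h; rewrite mulSn iterD; apply/Ainv => //; exact: (iter_phi_region H).
Qed.

(** By invariance of A, the observable u may be replaced in the integral by its averages,
    which converge almost everywhere to a constant. *)
Lemma section_independence u : observable u ->
  \int[nu0]_z (\1_A z * (u \_ region) z) = fine (nu0 A) * \int[nu0]_z (u \_ region) z.
Proof.
move=> ou; have [mu0 [B uB0]] := observable_restrict ou.
set u0 := u \_ region in mu0 uB0 *; set I := \int[nu0]_z u0 z.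
have m1A : measurable_fun setT (\1_A : plane R -> R) by exact: measurable_indic.
have B0 : 0 <= B by apply: le_trans (uB0 (0, 0)).
have FB z z' : `|\1_A z * u0 z'| <= B.
  rewrite normrM -[leRHS]mul1r ler_pM// indicE.
  by case: (_ \in _); rewrite ?normr1 ?normr0.
have mk k : measurable_fun setT (iter (k * N) phi_tot : plane R -> plane R).
  by apply: measurable_iter; exact: (measurable_phi_tot H).
have mFk k : measurable_fun setT (fun z : plane R => \1_A z * u0 (iter (k * N) phi_tot z)).
  by apply: measurable_funM => //; exact: (measurableT_comp mu0 (mk k)).
have iF0 : nu0.-integrable setT (EFin \o (fun z : plane R => \1_A z * u0 z)).
  by apply: (@bounded_integrable _ _ _ _ _ B) => //; exact: measurable_funM.
have shift k : \int[nu0]_z (\1_A z * u0 (iter (k * N) phi_tot z)) = \int[nu0]_z (\1_A z * u0 z).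
  rewrite -(Rintegral_invariant (mk k) _ iF0); last exact: (return_inv H HS).
  apply: (eq_Rintegral_on _ _ mfull section_full).
  - by apply: (@bounded_integrable _ _ _ _ _ B).
  - apply: (@bounded_integrable _ _ _ _ _ B) => //.
    have m1u : measurable_fun setT (fun z : plane R => \1_A z * u0 z) by exact: measurable_funM.
    exact: (measurableT_comp m1u (mk k)).
  - by move=> z [/(section_core_region H) rz _]; rewrite indic_iter.
pose F n z := \1_A z * average (fun k => u0 (iter (k * N) phi_tot z)) n.
have FE n z : F n z = n%:R^-1 * \sum_(0 <= k < n) \1_A z * u0 (iter (k * N) phi_tot z).
  by rewrite /F /average mulrCA mulr_sumr.
have iFk k : nu0.-integrable setT (EFin \o (fun z : plane R => \1_A z * u0 (iter (k * N) phi_tot z))).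
  by apply: (@bounded_integrable _ _ _ _ _ B) => //.
have F_int n : \int[nu0]_z F n.+1 z = \int[nu0]_z (\1_A z * u0 z).
  under eq_Rintegral do rewrite FE.
  rewrite RintegralZl//; last exact: integrable_Rsum.
  rewrite Rintegral_sum//; under eq_bigr do rewrite shift.
  by rewrite sumr_const_nat subn0 -[X in _ * X]mulr_natl mulKf// pnatr_eq0.
have mF n : measurable_fun setT (F n : plane R -> R).
  rewrite (_ : F n = fun z => n%:R^-1 * \sum_(0 <= k < n) \1_A z * u0 (iter (k * N) phi_tot z)).
    by apply: measurable_funM => //; exact: measurable_sum.
  by apply/funext => z; rewrite FE.
have F_bound n z : `|F n z| <= B.
  have := @dist_average _ (fun k => u0 (iter (k * N) phi_tot z)) (fun=> 0) n B.
  rewrite {2}/average big1// mulr0 subr0 => h.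
  rewrite /F normrM -[leRHS]mul1r ler_pM//.
    by rewrite indicE; case: (_ \in _); rewrite ?normr1 ?normr0.
  by apply: h => // k; rewrite subr0.
have F_cvg z : full z -> F n z @[n --> \oo] --> \1_A z * I.
  move=> [zc zT]; have rz := section_core_region H zc; have [z01 zJ] := core_J H zc.
  apply: cvgMr; rewrite /I -Rintegral_mkcond.
  have := section_average_cvg H HS ou zT zJ.
  apply: cvg_trans; apply: near_eq_cvg; apply: nearW => n.
  congr (_ * _); apply: eq_bigr => k _.
  rewrite (iter_phi_totE H)// /u0 /patch mem_set; last exact: (iter_phi_region H).
  by rewrite [z in RHS]surjective_pairing.
have mI : measurable_fun setT (fun z : plane R => \1_A z * I) by exact: measurable_funM.
have := bounded_cvg_Rintegral mF mI F_bound mfull section_full F_cvg.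
rewrite -(cvg_shiftS) /=.
rewrite (eq_cvg _ _ F_int) => h.
rewrite (cvg_unique _ (cvg_cst _) h)//.
rewrite RintegralZr//; last exact: integrable_indic.
by rewrite /Rintegral integral_indic// setIT.
Qed.

(** Indicators of quadrants are limits of observables. *)
Theorem section_ergodic : nu0 A = 0%E \/ nu0 A = 1%E.
Proof.
apply: (independent_of_quadrants mA) => s t.
have mq := @measurable_quadrant R s t.
have mr := @measurable_region R l r.
have region1 : nu0 region = 1%E.
  apply/eqP; rewrite eq_le probability_le1//= -(ss_core HS); apply: le_measure; rewrite ?inE//.
    exact: measurable_section_core.
  exact: (section_core_region H).
pose u n := quadrant_cutoff n s t.
have ou n : observable (u n).
  by apply: (observable_continuous H); exact: quadrant_cutoff_continuous.
have mu n := (observable_restrict (ou n)).1.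
have ub n z : `|(u n \_ region) z| <= 1.
  by rewrite /patch; case: ifPn => _; [exact: quadrant_cutoff_bound|rewrite normr0].
have uc z : region z -> (u n \_ region) z @[n --> \oo] --> (\1_(quadrant s t) z : R).
  move=> rz; rewrite (_ : (fun n => (u n \_ region) z) = (fun n => u n z)).
    exact: quadrant_cutoff_cvg.
  by apply/funext => n; rewrite /patch mem_set.
have m1A : measurable_fun setT (\1_A : plane R -> R) by exact: measurable_indic.
have m1q : measurable_fun setT (\1_(quadrant s t) : plane R -> R) by exact: measurable_indic.
have h1 : \int[nu0]_z (\1_A z * (u n \_ region) z) @[n --> \oo] -->
    \int[nu0]_z (\1_A z * \1_(quadrant s t) z).
  apply: (@bounded_cvg_Rintegral _ _ _ nu0 (fun n z => \1_A z * (u n \_ region) z)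
      (fun z => \1_A z * \1_(quadrant s t) z) 1 region) => //.
  - by move=> n; exact: measurable_funM.
  - exact: measurable_funM.
  - move=> n z; rewrite normrM mulr_ile1// indicE.
    by case: (_ \in _); rewrite ?normr1 ?normr0.
  - by move=> z rz; apply: cvgMr; exact: uc.
have h2 : \int[nu0]_z (u n \_ region) z @[n --> \oo] --> \int[nu0]_z \1_(quadrant s t) z.
  by exact: (@bounded_cvg_Rintegral _ _ _ nu0 (fun n => u n \_ region) (\1_(quadrant s t)) 1 region mu m1q ub mr region1 uc).
have {}h2 : fine (nu0 A) * \int[nu0]_z (u n \_ region) z @[n --> \oo] -->
    fine (nu0 A) * \int[nu0]_z \1_(quadrant s t) z by exact: cvgMr.
rewrite -(eq_cvg _ _ (fun n => section_independence (ou n))) in h2.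
have E : \int[nu0]_z (\1_A z * \1_(quadrant s t) z) = fine (nu0 A) * \int[nu0]_z \1_(quadrant s t) z.
  exact: cvg_unique h1 h2.
have nfin (B : set (plane R)) : measurable B -> nu0 B \is a fin_num by move=> mB; exact: fin_num_measure.
rewrite -(fineK (nfin _ mA)) -(fineK (nfin _ mq)) -(fineK (nfin _ (measurableI _ _ mA mq))) -EFinM.
congr (_%:E).
rewrite (_ : fine (nu0 (A `&` quadrant s t)) = \int[nu0]_z \1_(A `&` quadrant s t) z); last first.
  by rewrite /Rintegral integral_indic ?setIT//; exact: measurableI.
rewrite indicI [LHS]E; congr (_ * _).
by rewrite /Rintegral integral_indic// setIT.
Qed.

End SectionErgodicity.

(** * The SRB measure of the cycle *)

Section CycleMeasure.
Context {R : realType} {d : nat} {a b : 'I_d -> R} {G dG : 'I_d -> R -> R}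
  {K : R} {g : R -> R} {f : R * R -> R} {l r M Lam lam : R} {N : nat}
  {p rr : nat -> R}.
Hypothesis H : contracting_skew a b G dG K g f l r M Lam lam N p rr.
Context {nu0 : probability (plane R) R} {T : set (line R)}.
Hypothesis HS : @section_srb R d a b g f l r lam N p rr nu0 T.
Implicit Types (i : 'I_d) (s t x y : R) (z : R * R) (j k n : nat) (w : seq 'I_d).
Local Notation phi := (skew_product g f).
Local Notation phi_tot := (@phi_tot R g f l r).
Local Notation region := (cylinder `[l, r]%classic).
Local Notation J := (@cell R p rr).
Local Notation observable := (@observable R d a b g l r).
Local Notation core := (@section_core R lam p rr).

Let miter n : measurable_fun setT (iter n phi_tot : plane R -> plane R).
Proof. by apply: measurable_iter; exact: (measurable_phi_tot H). Qed.

Let mpre n (A : set (plane R)) : measurable A -> measurable (iter n phi_tot @^-1` A : set (plane R)).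
Proof. by move=> mA; rewrite -[X in measurable X]setTI; exact: miter. Qed.

Definition cycle_measure : probability (plane R) R :=
  mean_probability (fun k => image_probability (miter k) nu0) (cs_N H).

Lemma cycle_measureE A : cycle_measure A =
  ((N%:R^-1)%:E * \sum_(0 <= k < N) nu0 (iter k phi_tot @^-1` A))%E.
Proof. by rewrite /cycle_measure mean_probabilityE. Qed.

Lemma cycle_measure_const (A : set (plane R)) (v : R) :
  (forall k, nu0 (iter k phi_tot @^-1` A) = v%:E) -> cycle_measure A = v%:E.
Proof.
move=> h; rewrite cycle_measureE; under eq_bigr do rewrite h.
rewrite sumEFin -EFinM sumr_const_nat subn0 -[X in _ * X]mulr_natl mulKf//.
by rewrite pnatr_eq0 -lt0n (cs_N H).
Qed.

Lemma section_region : nu0 region = 1%E.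
Proof.
apply/eqP; rewrite eq_le probability_le1//=; last exact: measurable_region.
rewrite -(ss_core HS); apply: le_measure; rewrite ?inE//.
- exact: measurable_section_core.
- exact: measurable_region.
- exact: (section_core_region H).
Qed.

Lemma cycle_region : cycle_measure region = 1%E.
Proof.
apply: cycle_measure_const => k; rewrite -section_region.
apply: (probability_eq_on (@measurable_region R l r) section_region).
- by apply: mpre; exact: measurable_region.
- exact: measurable_region.
- move=> z rz; split=> // _; rewrite /preimage/= (iter_phi_totE H)//.
  exact: (iter_phi_region H).
Qed.

Lemma cycle_invariant_tot (A : set (plane R)) : measurable A ->
  cycle_measure (phi_tot @^-1` A) = cycle_measure A.
Proof.
move=> mA; rewrite !cycle_measureE; congr (_ * _)%E.
rewrite (eq_bigr (fun k => nu0 (iter k.+1 phi_tot @^-1` A))); last first.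
  by move=> k _; congr (nu0 _); apply/seteqP; split => z; rewrite /preimage /= -iterS iterSr.
have N1 := cs_N H; have -> : N = N.-1.+1 by rewrite prednK.
rewrite big_nat_recr// big_nat_recl// addeC; congr (_ + _)%E.
by rewrite prednK// -[RHS]/(nu0 A) (ss_inv HS).
Qed.

Lemma cycle_invariant : invariant_measure l r phi cycle_measure.
Proof.
split; first exact: cycle_region.
move=> A mA; rewrite -(cycle_invariant_tot mA).
have mt : measurable (phi_tot @^-1` A : set (plane R)) by exact: (mpre 1).
have E : region `&` phi @^-1` A = region `&` phi_tot @^-1` A.
  by apply/seteqP; split => z [rz]; rewrite /preimage/= (phi_totE rz).
rewrite E; apply: (probability_eq_on (@measurable_region R l r) cycle_region) => //.
  by apply: measurableI => //; exact: measurable_region.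
by move=> z rz; split => [[]|].
Qed.

Lemma cycle_ergodic : ergodic_measure l r phi cycle_measure.
Proof.
move=> A mA Areg Ainv.
have inv n z : region z -> A (iter n phi z) <-> A z.
  move=> rz; elim: n => //= n IH; rewrite -IH.
  have rn := iter_phi_region H n rz.
  by rewrite -{2}Ainv; split => [|[]].
have := section_ergodic H HS mA (inv N).
have E k : nu0 (iter k phi_tot @^-1` A) = nu0 A.
  apply: (probability_eq_on (@measurable_region R l r) section_region) => //.
    exact: mpre.
  by move=> z rz; rewrite /preimage /= (iter_phi_totE H)//; exact: inv.
by case=> A01; [left|right]; apply: cycle_measure_const => k; rewrite E.
Qed.

Lemma Rintegral_cycle u : observable u ->
  \int[cycle_measure]_(z in region) u z =
    N%:R^-1 * \sum_(0 <= k < N) \int[nu0]_(z in region) u (iter k phi z).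
Proof.
move=> ou; have [mu [B uB]] := observable_restrict ou.
rewrite Rintegral_mkcond Rintegral_mean_probability//; last first.
  by move=> k; exact: bounded_integrable mu uB.
congr (_ * _); apply: eq_bigr => k _; rewrite (Rintegral_image _ _ mu uB).
have [muk [Bk ukB]] := observable_restrict (observable_iter H k ou).
rewrite [RHS]Rintegral_mkcond.
apply: (eq_Rintegral_on _ _ (@measurable_region R l r) section_region).
- apply: (@bounded_integrable _ _ _ _ _ B); last by move=> z; exact: uB.
  exact: (measurableT_comp mu (miter k)).
- exact: bounded_integrable muk ukB.
- move=> z rz; rewrite (iter_phi_totE H)// /patch !mem_set//.
  exact: (iter_phi_region H).
Qed.

Lemma empirical_average (psi : R * R -> R) z n : observable psi -> region z ->
  \int[empirical_measure phi z n]_(z in region) psi z = average (fun k => psi (iter k phi z)) n.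
Proof.
move=> [mu _ _] rz.
have dE k : (\int[\d_(iter k phi z : plane R)]_(z in region) (psi z)%:E = (psi (iter k phi z))%:E)%E.
  rewrite integral_dirac//; first by rewrite diracE mem_set ?mul1e//; exact: (iter_phi_region H).
  - exact: measurable_region.
  - exact/measurable_EFinP.
rewrite /empirical_measure Rintegral_mean.
- by congr (_ * _); apply: eq_bigr => k _; rewrite /Rintegral dE.
- exact: measurable_region.
- move=> k; apply/integrableP; split; first exact/measurable_EFinP.
  rewrite integral_dirac//; first by rewrite diracE mem_set ?mul1e ?ltry//; exact: (iter_phi_region H).
  + exact: measurable_region.
  + by apply: measurableT_comp => //; exact/measurable_EFinP.
Qed.

(** Averages along phi split into N averages along phi^N, of the observables
    psi o phi^j. *)
Lemma cycle_basin t x : T t -> J 0 x -> basin l r phi cycle_measure (t, x).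
Proof.
move=> Tt xJ; have t01 : t \in `]0, 1] by exact: (ss_sub HS).
have rz : region (t, x) by apply/region_iff; split => //=; exact: (J_itv H xJ).
split => // psi cpsi _.
have opsi := observable_continuous H cpsi.
rewrite (eq_cvg _ _ (fun n => empirical_average n opsi rz)) Rintegral_cycle//.
have [_ [B _ Bpsi] _] := opsi.
apply: (@average_cvg_blocks _ _ N B); first exact: (cs_N H).
  by move=> k; apply: Bpsi; exact: (iter_phi_region H).
have E q : average (fun k => psi (iter k phi (t, x))) (q * N) = N%:R^-1 * \sum_(0 <= j < N)
   average (fun k => psi (iter j phi (iter (k * N) phi (t, x)))) q.
  rewrite average_blocks /average -!mulr_sumr mulrCA; congr (_ * (_ * _)).
  rewrite exchange_big; apply: eq_bigr => j _; apply: eq_bigr => k _.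
  by rewrite -iterD addnC.
rewrite (eq_cvg _ _ E).
apply: cvgMr; apply: cvg_finite_sum => j.
exact: (section_average_cvg H HS (observable_iter H j opsi) Tt xJ).
Qed.

Theorem cycle_SRB : SRB_measure l r phi cycle_measure.
Proof.
split; [exact: cycle_invariant|exact: cycle_ergodic|].
have mT := ss_meas HS.
have mJ : measurable (`]p 0%N - rr 0%N, p 0%N + rr 0%N[%classic : set (line R)) by exact: measurable_itv.
exists (T `*` `]p 0%N - rr 0%N, p 0%N + rr 0%N[%classic); split.
- exact: measurableX.
- move=> [t x] [/= Tt]; rewrite in_itv/= => /andP[x1 x2]; apply: cycle_basin => //.
  by rewrite /cell /= ltr_norml; apply/andP; split; lra.
- rewrite /lebesgue2 product_measure1E//; apply: mule_gt0; first exact: (ss_pos HS).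
  have r0 := cs_rr H 0%N.
  rewrite -[X in (0 < X)%E]/(@lebesgue_measure R `]p 0%N - rr 0%N, p 0%N + rr 0%N[%classic).
  by rewrite lebesgue_measure_itv /= lte_fin ifT ?lte_fin; lra.
Qed.

End CycleMeasure.

(** * The attractor *)

Lemma lipschitz_within (R : realType) (A : set (R * R)) (h : R * R -> R * R) (L : R) :
  0 < L ->
  (forall z z' e, A z -> A z' -> `|z.1 - z'.1| < e -> `|z.2 - z'.2| < e ->
     `|(h z).1 - (h z').1| < L * e /\ `|(h z).2 - (h z').2| < L * e) ->
  {within A, continuous h}.
Proof.
move=> L0 hL; apply/subspace_continuousP => z Az; apply/cvg_ballP => e e0.
apply/nbhs_ballP; exists (e / L) => /=; first by rewrite divr_gt0.
move=> z' [/= z1 z2] Az'; have [h1 h2] := hL z z' _ Az Az' z1 z2.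
by move: h1 h2; rewrite mulrC divfK ?gt_eqF// => h1 h2; split.
Qed.

Section ProperAttractor.
Context {R : realType} {d : nat} {a b : 'I_d -> R} {G dG : 'I_d -> R -> R}
  {K : R} {g : R -> R} {f : R * R -> R} {l r M Lam lam : R} {N : nat}
  {p rr : nat -> R}.
Hypothesis H : contracting_skew a b G dG K g f l r M Lam lam N p rr.
Context {nu0 : probability (plane R) R} {T : set (line R)}.
Hypothesis HS : @section_srb R d a b g f l r lam N p rr nu0 T.
Implicit Types (i : 'I_d) (s t x y : R) (z : R * R) (j k n : nat) (w : seq 'I_d).
Let HB := cs_base H.
Local Notation word_cylinder := (@word_cylinder R d a b g).
Local Notation psi_word := (@psi_word R d a b G).
Local Notation phi := (skew_product g f).
Local Notation phi_tot := (@phi_tot R g f l r).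
Local Notation region := (cylinder `[l, r]%classic).
Local Notation J := (@cell R p rr).
Local Notation core := (@section_core R lam p rr).

(** The n-th iterate of phi over the cylinder of w, parametrised by the image of the base
    point. In this parameter it is Lipschitz, although phi^n expands the base. *)
Definition word_chart w z : R * R := iter (size w) phi (psi_word w z.1, z.2).

Lemma word_chart_lip w t t' x x' : t \in `]0, 1] -> t' \in `]0, 1] ->
  x \in `[l, r] -> x' \in `[l, r] ->
  `|(word_chart w (t, x)).2 - (word_chart w (t', x')).2| <=
    (1 + M + Lam) ^+ size w * (`|t - t'| + `|x - x'|).
Proof.
have [M0 L0] := (cs_M H, cs_Lam H).
elim: w x x' => [|i w IH] x x' t01 t'01 xI x'I.
  by rewrite /word_chart /= expr0 mul1r lerDr.
have psi_in s : s \in `]0, 1] -> psi_word w s \in `]0, 1].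
  by move=> s01; have [] := word_cylinder_psi HB (psi_word_cylinder HB w s01).
have step s y : s \in `]0, 1] -> word_chart (i :: w) (s, y) = word_chart w (s, f (psi_word (i :: w) s, y)).
  move=> s01; rewrite /word_chart [size _]/= iterSr; congr (iter _ _ _).
  by rewrite /skew_product /= (g_psi HB)//; exact: psi_in.
rewrite !step//.
have pI s : s \in `]0, 1] -> psi_word (i :: w) s \in `]a i, b i].
  by move=> s01; apply: (psi_oc HB); exact: psi_in.
have fI s y : s \in `]0, 1] -> y \in `[l, r] -> f (psi_word (i :: w) s, y) \in `[l, r].
  by move=> s01 yI; apply: (cs_itv H) => //; apply: (piece_sub HB (pI s s01)).
apply: le_trans (IH _ _ t01 t'01 (fI _ _ t01 xI) (fI _ _ t'01 x'I)) _.
rewrite [size _]/= exprSr -mulrA ler_wpM2l ?exprn_ge0 ?addr_ge0//.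
have h1 := cs_theta H (pI t t01) (pI t' t'01) xI.
have h2 := cs_x H (piece_sub HB (pI t' t'01)) xI x'I.
have h3 := psi_word_lip HB (i :: w) t t'.
have h4 : `|psi_word (i :: w) t - psi_word (i :: w) t'| <= `|t - t'|.
  apply: le_trans h3 _; rewrite -[leRHS]mul1r ler_wpM2r// invf_le1 ?exprn_gt0//.
  by rewrite exprn_ege1// ler1n.
have := ler_distD (f (psi_word (i :: w) t', x)) (f (psi_word (i :: w) t, x)) (f (psi_word (i :: w) t', x')).
have := normr_ge0 (t - t'); have := normr_ge0 (x - x').
have : M * `|psi_word (i :: w) t - psi_word (i :: w) t'| <= M * `|t - t'| by rewrite ler_wpM2l.
move: h1 h2; set A := `|t - t'|; set B := `|x - x'|.
set f1 := `|_ - _| => h1; set f2 := `|_ - _| => h2 h5 B0 A0 h6.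
have MB : 0 <= M * B by rewrite mulr_ge0.
have LA : 0 <= Lam * A by rewrite mulr_ge0.
by rewrite !mulrDl !mulrDr !mul1r; lra.
Qed.

(** Images of cylinders under phi^n are countable unions of compact sets, hence Borel:
    each word gives a Lipschitz chart and ]0, 1] is exhausted by compact intervals. *)
Lemma image_word_charts n (u v : R) : `[u, v] `<=` `[l, r] ->
  iter n phi @` (`]0, 1]%classic `*` `[u, v]%classic) =
  \bigcup_(w in [set: n.-tuple 'I_d]) \bigcup_m
    (word_chart w @` (`[m.+1%:R^-1, 1]%classic `*` `[u, v]%classic)).
Proof.
move=> uvlr; apply/seteqP; split.
- move=> _ [[s x] [/= s01 xI] <-].
  have [w ws] := itinerary_word HB n s01.
  have [_ E] := word_cylinder_psi HB ws.
  have t01 := iter_g01 HB n s01.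
  exists w => //; have [m Hm] := real_lt_nat (iter n g s)^-1.
  move: t01 (t01); rewrite in_itv/= => /andP[t0 t1] t01.
  exists m => //; exists (iter n g s, x).
    split => //=; rewrite in_itv/= t1 andbT.
    rewrite invf_ple ?posrE// ltW// (lt_trans Hm)// ltr_nat//.
  by rewrite /word_chart size_tuple /=; rewrite size_tuple in E; rewrite E.
- move=> z [w _ [m _ [[t x] [/= tm xI] <-]]].
  have t01 : t \in `]0, 1].
    move: tm; rewrite !in_itv/= => /andP[h ->]; rewrite andbT.
    by apply: lt_le_trans h; rewrite invr_gt0.
  exists (psi_word w t, x); last by rewrite /word_chart size_tuple.
  by split => //=; have [] := word_cylinder_psi HB (psi_word_cylinder HB w t01).
Qed.

Lemma measurable_image n (u v : R) : `[u, v] `<=` `[l, r] ->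
  measurable (iter n phi @` (`]0, 1]%classic `*` `[u, v]%classic) : set (plane R)).
Proof.
move=> uvlr; rewrite image_word_charts//.
apply: fin_bigcup_measurable; first exact: finite_finset.
move=> w _; apply: bigcupT_measurable => m.
rewrite -[X in measurable X]setCK; apply: measurableC.
apply: open_measurable_plane; apply: closed_openC.
apply: compact_closed; first exact: norm_hausdorff.
apply: continuous_compact; last first.
  by apply: compact_setX; exact: segment_compact.
have [M0 L0] := (cs_M H, cs_Lam H).
have C0 : 0 < (1 + M + Lam) ^+ size w by rewrite exprn_gt0//; lra.
have C1 : 1 <= (1 + M + Lam) ^+ size w by rewrite exprn_ege1//; lra.
apply: (@lipschitz_within _ _ _ (2 * (1 + M + Lam) ^+ size w)); first by rewrite mulr_gt0.
have in01 t : t \in `[m.+1%:R^-1, 1] -> t \in `]0, 1].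
  rewrite !in_itv/= => /andP[h ->]; rewrite andbT.
  by apply: lt_le_trans h; rewrite invr_gt0.
move=> [t x] [t' x'] e [/= /in01 t01 /uvlr xI] [/= /in01 t'01 /uvlr x'I] te xe.
have e0 : 0 <= e by apply: le_trans (ltW te).
split.
  rewrite /word_chart !iter_phi1 /= !(iter_g_psi_word HB)//.
  apply: lt_le_trans te _; rewrite ler_peMl//; lra.
apply: le_lt_trans (word_chart_lip w t01 t'01 xI x'I) _.
rewrite -mulrA mulrCA ltr_pM2l//; lra.
Qed.

Local Notation centers := (fun j => `[p j - lam * rr j, p j + lam * rr j]%classic).

Let centers_J j x : centers j x -> J j x.
Proof.
rewrite /= in_itv/= => /andP[x1 x2]; have r0 := cs_rr H j.
have /andP[_ l1] := cs_lam H.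
have : lam * rr j < rr j by rewrite gtr_pMl.
by rewrite /cell /= ltr_norml => h; apply/andP; split; lra.
Qed.

Let J_centers j x : `|x - p j| <= lam * rr j -> centers j x.
Proof. by rewrite ler_norml /= in_itv/= => /andP[? ?]; apply/andP; split; lra. Qed.

Lemma J_mod n : (J n = J (n %% N)%N) * (centers n = centers (n %% N)%N).
Proof.
have E m q : p (m + q * N)%N = p m /\ rr (m + q * N)%N = rr m.
  elim: q => [|q [IH1 IH2]]; first by rewrite mul0n addn0.
  by rewrite mulSn addnCA addnC (cs_p H) (cs_rrN H).
have [Ep Er] := E (n %% N)%N (n %/ N)%N.
by rewrite /cell; move: Ep Er; rewrite addnC -divn_eq => -> ->.
Qed.

Let trapping : set R := \bigcup_(j in `I_N) J j.

Let phi_trapping z : cylinder trapping z -> cylinder trapping (phi z).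
Proof.
case: z => t x [/= z1 [j _ zj]].
split; first exact: (g01 HB).
exists (j.+1 %% N)%N; first by rewrite /= ltn_mod (cs_N H).
rewrite -(J_mod j.+1).1 -addn1; exact: (iter_phi_J H 1 (t := t)).
Qed.

(** The compact cores of the cells, rather than the cells, have Borel images by
    [measurable_image]. *)
Let core_image n : set (plane R) :=
  \bigcup_(j in `I_N) (iter n phi @` (`]0, 1]%classic `*` centers j)).

Let centers_itv j : centers j `<=` `[l, r].
Proof. by move=> x /centers_J/(J_itv H). Qed.

Let measurable_core_image n : measurable (core_image n).
Proof.
apply: fin_bigcup_measurable => [|j _]; first exact: finite_II.
by apply: measurable_image; exact: centers_itv.
Qed.

Let iter_centers n j z : z.1 \in `]0, 1] -> centers j z.2 -> centers (j + n)%N (iter n phi z).2.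
Proof.
move=> z1 zj; case: n => [|n]; first by rewrite addn0.
apply: J_centers; case: z z1 zj => t x /= z1 zj.
exact: (iter_phi_core H (ltn0Sn n) z1 (centers_J zj)).
Qed.

(** By invariance nu (phi^n C) is the measure of the set of points whose n-th image
    lies in phi^n C, a set that contains C. *)
Let cycle_core_image n : cycle_measure H (nu0 := nu0) (core_image n) = 1%E.
Proof.
have -> : cycle_measure H (nu0 := nu0) (core_image n) = cycle_measure H (nu0 := nu0) (iter n phi_tot @^-1` core_image n).
  by rewrite (iter_invariant (measurable_phi_tot H) n (cycle_invariant_tot H HS)).
apply: cycle_measure_const => k; rewrite -(ss_core HS).
have mc := @measurable_section_core R lam p rr.
apply: (probability_eq_on mc (ss_core HS)) => //.
  rewrite -[X in measurable X]setTI; apply: measurable_iter => //.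
    exact: (measurable_phi_tot H).
  rewrite -[X in measurable X]setTI; apply: measurable_iter => //.
  exact: (measurable_phi_tot H).
move=> z zc; split=> // _; have rz := section_core_region H zc.
have [z1 /= z2] := zc; have rk := iter_phi_region H k rz.
rewrite /preimage /= (iter_phi_totE H)// (iter_phi_totE H)//.
exists (k %% N)%N; first by rewrite /= ltn_mod (cs_N H).
exists (iter k phi z) => //; split; first by have /region_iff[] := rk.
rewrite -((J_mod k).2) -(add0n k).
apply: iter_centers => //; exact: J_centers.
Qed.

Theorem cycle_proper_attractor : supported_in_proper_attractor l r phi (cycle_measure H (nu0 := nu0)).
Proof.
exists [seq (p j - rr j, p j + rr j) | j <- iota 0 N], 1%N => U.
have UE : U = trapping.
  apply/seteqP; split => x.
    move=> [q /mapP[j]]; rewrite mem_iota add0n => jN -> /=; rewrite in_itv/= => /andP[x1 x2].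
    by exists j => //; rewrite /cell /= ltr_norml; apply/andP; split; lra.
  move=> [j /= jN]; rewrite /cell /= ltr_norml => /andP[x1 x2].
  exists (p j - rr j, p j + rr j); last by rewrite /= in_itv/=; apply/andP; split; lra.
  by apply/mapP; exists j => //; rewrite mem_iota add0n.
rewrite UE; split => //.
- split.
    by move=> z [z1 [j _ zj]]; apply/region_iff; split => //; exact: (J_itv H zj).
  move=> /(_ (1, l)); have lr : l <= r.
    by have [h1 h2] := cs_J H 0%N; have := cs_rr H 0%N; lra.
  have rl : region (1, l) by apply/region_iff; rewrite !in_itv/= ltr01 !lexx.
  move=> /(_ rl)[/= _ [j _]]; rewrite /cell /= ltr_norml => /andP[h _].
  by have [h1 h2] := cs_J H j; move: h h1; lra.
- by move=> _ [z zU <-]; exact: phi_trapping.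
- have : (cycle_measure H (nu0 := nu0)).-negligible (\bigcup_n ~` core_image n).
    apply: negligible_bigcup => n; exists (~` core_image n); split => //.
      by apply: measurableC; exact: measurable_core_image.
    by have := probability_setC (cycle_measure H (nu0 := nu0)) (measurable_core_image n); rewrite cycle_core_image subee.
  apply: negligibleS.
  rewrite -setC_bigcap; apply: subsetC => z zn n _.
  have [j jN [y [/= y1 yj] <-]] := zn n I.
  exists y => //; split => //; exists j => //; exact: centers_J.
Qed.

End ProperAttractor.

(** * Birkhoff's theorem for nonnegative extended functions *)

Section NonnegativeBirkhoff.
Context d (T : measurableType d) (R : realType) (P : probability T R).
Variable tau : T -> T.
Hypothesis mtau : measurable_fun setT tau.
Hypothesis tau_inv : forall A, measurable A -> P (tau @^-1` A) = P A.
Hypothesis tau_erg : forall A, measurable A -> tau @^-1` A = A -> P A = 0%E \/ P A = 1%E.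

Lemma ae_orbit (Q : T -> Prop) : {ae P, forall x, Q x} ->
  {ae P, forall x n, Q (iter n tau x)}.
Proof.
move=> [B [mB B0 QB]]; apply: ae_foralln => n.
exists (iter n tau @^-1` B); split.
- by rewrite -[X in measurable X]setTI; exact: measurable_iter.
- by apply: (etrans _ B0); exact: (iter_invariant mtau n tau_inv).
- by move=> x /= nQ; exact: QB.
Qed.

Variable F : T -> \bar R.
Hypothesis mF : measurable_fun setT F.
Hypothesis F0 : forall x, (0 <= F x)%E.

Let truncate M x : R := fine (mine (F x) M%:R%:E).

Let truncateE M x : ((truncate M x)%:E = mine (F x) M%:R%:E)%E.
Proof.
rewrite /truncate fineK//; apply/fin_numPlt; rewrite lt_min ltNyr (lt_le_trans _ (F0 x)) ?ltNy0//=.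
by rewrite gt_min ltry orbT.
Qed.

Let truncate_ge0 M x : 0 <= truncate M x.
Proof. by rewrite -lee_fin truncateE le_min F0 lee_fin ler0n. Qed.

Let truncate_le M x : truncate M x <= M%:R.
Proof. by rewrite -lee_fin truncateE ge_min lexx orbT. Qed.

Let measurable_truncate M : measurable_fun setT (fun x => (truncate M x)%:E).
Proof.
by under eq_fun do rewrite truncateE; exact: measurable_mine.
Qed.

Let truncate_integrable M : P.-integrable setT (EFin \o truncate M).
Proof.
apply: (@bounded_integrable _ _ _ _ _ M%:R) => [|x]; last by rewrite ger0_norm.
by apply/measurable_EFinP; exact: measurable_truncate.
Qed.

Let truncate_cvg x : (truncate M x)%:E @[M --> \oo] --> F x.
Proof.
case E : (F x) (F0 x) => [s| |] // s0.
  have [n Hn] := real_lt_nat s.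
  apply: cvg_near_cst; exists n => // M /= nM; rewrite truncateE E.
  by apply/min_idPl; rewrite lee_fin ltW// (lt_le_trans Hn)// ler_nat.
apply/cvgeyPge => A; have [n Hn] := real_lt_nat A.
exists n => // M /= nM; rewrite truncateE E min_r ?leey//.
by rewrite lee_fin ltW// (lt_le_trans Hn)// ler_nat.
Qed.

Let truncate_integral_cvg :
  (\int[P]_x (truncate M x)%:E @[M --> \oo] --> \int[P]_x F x)%E.
Proof.
have := @cvg_monotone_convergence _ _ _ P setT measurableT
  (fun M x => (truncate M x)%:E) (measurable_truncate) _ _.
have -> : (\int[P]_x limn (fun M => (truncate M x)%:E) = \int[P]_x F x)%E.
  by apply: eq_integral => x _; apply: cvg_lim => //; exact: truncate_cvg.
apply.
- by move=> M x _; rewrite lee_fin.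
- move=> x _ M1 M2 M12; rewrite !truncateE le_min ge_min lexx /=.
  by rewrite ge_min lee_fin ler_nat M12 orbT.
Qed.

(** If the integral is infinite, the averages are bounded below by those of truncations
    of F, whose integrals tend to infinity. *)
Theorem birkhoff_ge0 : {ae P, forall x,
  ((n%:R^-1)%:E * \sum_(0 <= k < n) F (iter k tau x))%E @[n --> \oo] --> (\int[P]_x F x)%E}.
Proof.
have FF : Filter (almost_everywhere P) by exact: ae_filter_ringOfSetsType.
have [Foo|Foo] := eqVneq (\int[P]_x F x)%E +oo%E.
  have H1 : {ae P, forall x M, n%:R^-1 * birkhoff_sum tau (truncate M) n x @[n --> \oo] -->
      \int[P]_x truncate M x}.
    by apply: ae_foralln => M; apply: (birkhoff mtau tau_inv tau_erg); exact: truncate_integrable.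
  apply: filterS H1 => x Hx; rewrite Foo; apply/cvgeyPge => A.
  have := truncate_integral_cvg; rewrite Foo => /cvgeyPge /(_ (A + 1)) [M _ HM].
  have : A + 1 <= \int[P]_x truncate M x.
    rewrite -lee_fin /Rintegral fineK; first exact: (HM M (leqnn M)).
    by apply: integrable_fin_num => //; exact: truncate_integrable.
  move=> AM; have /cvgrPdist_lt /(_ 1 ltr01) [n0 _ Hn0] := Hx M.
  exists n0 => // n /= n0n; have := Hn0 n n0n; rewrite ltr_norml => /andP[_ h].
  apply: (@le_trans _ _ (n%:R^-1 * birkhoff_sum tau (truncate M) n x)%:E).
    by rewrite lee_fin; lra.
  rewrite EFinM lee_wpmul2l ?lee_fin ?invr_ge0// /birkhoff_sum -sumEFin.
  by apply: lee_sum => k _; rewrite truncateE ge_min lexx.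
have iF : P.-integrable setT F.
  apply/integrableP; split => //; under eq_integral do rewrite gee0_abs//.
  by rewrite ltey.
have F_fin := ae_orbit (integrable_ae measurableT iF).
have iF' : P.-integrable setT (EFin \o (fine \o F)).
  apply: (le_integrable measurableT _ _ iF).
  - by apply/measurable_EFinP; apply: measurableT_comp => //; exact: measurable_fine.
  - move=> x _ /=; case: (F x) (F0 x) => [s| |] //=.
    by rewrite normr0 leey.
have E : (\int[P]_x F x)%E = (\int[P]_x (fine \o F) x)%:E.
  rewrite /Rintegral fineK; last exact: integrable_fin_num.
  apply: ae_eq_integral => //; first exact: measurable_int iF'.
  by apply: filterS (integrable_ae measurableT iF) => x h xT /=; rewrite fineK// h.
rewrite E; apply: filterS2 (birkhoff mtau tau_inv tau_erg iF') F_fin => x hx Fx.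
rewrite (_ : (fun n => _) = (fun n => (n%:R^-1 * birkhoff_sum tau (fine \o F) n x)%:E)).
  by apply: cvg_EFin => //; exact: nearW.
apply/funext => n; rewrite EFinM /birkhoff_sum -sumEFin; congr (_ * _)%E.
by apply: eq_bigr => k _ /=; rewrite fineK// Fx.
Qed.

End NonnegativeBirkhoff.

(** * Derivatives of the iterates *)

Lemma derive_bound (R : realType) (V : normedModType R) (F : V -> R) (z v : V) (B : R) :
  derivable F z v -> (\forall h \near (0 : R)^'+, `|F (h *: v + z) - F z| <= B * h) ->
  `|'D_v F z| <= B.
Proof.
move=> dF nB; have h0 : h^-1 *: (F (h *: v + z) - F z) @[h --> (0 : R)^'+] --> 'D_v F z.
  have /cvg_ex[L HL] := dF; rewrite /derive (cvg_lim _ HL)//.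
  move=> E /HL [e e0 He]; exists e => // x xe x0.
  by apply: He => //; rewrite gt_eqF.
apply: (cvgr_to_le (cvg_norm h0)).
near=> h; rewrite normrZ normrV ?unitfE; last by rewrite gt_eqF.
rewrite gtr0_norm// ler_pdivrMl// mulrC.
by near: h; exact: nB.
Unshelve. all: by end_near. Qed.

Lemma diff_comp_apply (R : realType) (V : normedModType R) (F P : V -> V) (dP : V -> V) z v :
  differentiable F z -> is_diff (F z) P dP -> 'd (P \o F) z v = dP ('d F z v).
Proof. by move=> dF [dP' <-]; rewrite diff_comp. Qed.

Lemma periodic_bounds (R : realType) (w : nat -> R) (N : nat) : (0 < N)%N ->
  (forall j, w (j + N)%N = w j) -> (forall j, 0 < w j) ->
  exists c0 c1, 0 < c0 /\ forall k, c0 <= w k <= c1.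
Proof.
move=> N0 wN w0; have per k : w k = w (k %% N)%N.
  rewrite {1}(divn_eq k N); elim: (k %/ N)%N => [|q IH]; first by rewrite mul0n.
  by rewrite mulSn -addnA addnC wN.
pose S := \sum_(k < N) ((w k)^-1 + w k).
have S_ge k : (w k)^-1 + w k <= S.
  have kN : (k %% N < N)%N by rewrite ltn_mod.
  rewrite per /S (bigD1 (Ordinal kN))//= lerDl sumr_ge0// => j _.
  by rewrite addr_ge0 ?invr_ge0// ltW.
have S0 : 0 < S by apply: lt_le_trans (S_ge 0%N); rewrite addr_gt0 ?invr_gt0.
exists S^-1, S; split=> [|k]; first by rewrite invr_gt0.
have := S_ge k; have : 0 < (w k)^-1 by rewrite invr_gt0.
have := w0 k => wk ik h; apply/andP; split; last by lra.
by rewrite -[leRHS]invrK lef_pV2 ?posrE//; lra.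
Qed.

Section Smooth.
Context {R : realType} {d : nat} {a b : 'I_d -> R} {G dG : 'I_d -> R -> R}
  {K : R} {g : R -> R} {f : R * R -> R} {l r M Lam lam : R} {N : nat}
  {p rr : nat -> R}.
Hypothesis H : contracting_skew a b G dG K g f l r M Lam lam N p rr.
Hypothesis f_diff : forall i t x, t \in `]a i, b i[ -> x \in `]l, r[ ->
  differentiable f (t, x).
Implicit Types (i : 'I_d) (s t x y : R) (z v : R * R) (j k n : nat) (w : seq 'I_d).
Let HB := cs_base H.
Local Notation phi := (skew_product g f).
Local Notation phi_tot := (@phi_tot R g f l r).
Local Notation region := (cylinder `[l, r]%classic).
Local Notation J := (@cell R p rr).

Definition smooth_region : set (R * R) :=
  \bigcup_i (`]a i, b i[%classic `*` `]l, r[%classic).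

Definition fiber_slope z : R := 'D_((0, 1) : R * R) f z.
Definition shear z : R := 'D_((1, 0) : R * R) f z.

Lemma base_is_derive i t : t \in `]a i, b i[ -> is_derive t 1 g (dG i t).
Proof.
move=> ti; have tc : t \in `[a i, b i] by exact: subset_itv_oo_cc.
apply: (near_eq_is_derive (f := G i)); last exact: (mm_deriv HB).
near=> s; apply/esym; apply: (mm_g HB); apply: subset_itv_oo_oc.
by near: s; exact: near_in_itvoo.
Unshelve. all: by end_near. Qed.

Lemma phi_is_diff i z : z.1 \in `]a i, b i[ -> z.2 \in `]l, r[ ->
  is_diff z phi (fun v => (dG i z.1 * v.1, v.1 * shear z + v.2 * fiber_slope z)).
Proof.
move=> z1 z2; have df : differentiable f z by case: z z1 z2 => t x /=; exact: f_diff.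
have Hf : is_diff z f (fun v => v.1 * shear z + v.2 * fiber_slope z).
  apply: DiffDef => //; apply/funext => v.
  rewrite /shear /fiber_slope !deriveE// -!linearZ -linearD; congr ('d f z _).
  case: v => v1 v2; rewrite -[RHS]/(v1 * 1 + v2 * 0, v1 * 0 + v2 * 1).
  by rewrite !mulr0 !mulr1 addr0 add0r.
have Hg : is_diff (z.1) g (fun y => dG i z.1 * y).
  have [dg Eg] := base_is_derive z1.
  have dg' : differentiable g z.1 by apply/derivable1_diffP.
  apply: DiffDef => //; apply/funext => y.
  by rewrite -Eg deriveE// -[in LHS](mulr1 y) -[y * 1]/(y *: 1) linearZ /= mulrC.
exact: (is_diff_pair (is_diff_comp (fst_is_diff z) Hg) Hf).
Qed.

Lemma iter_is_diff n z : (forall k, (k < n)%N -> smooth_region (iter k phi z)) ->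
  differentiable (iter n phi : R * R -> R * R) z.
Proof.
elim: n => [|n IH] h; first by have [] := is_diff_id z.
rewrite (_ : iter n.+1 phi = phi \o iter n phi)//.
have [i _ [/= z1 z2]] := h n (ltnSn n).
apply: differentiable_comp; first by apply: IH => k kn; apply: h; rewrite ltnW.
by have [] := phi_is_diff z1 z2.
Qed.

Lemma derive_iterS n z v i : (forall k, (k <= n)%N -> smooth_region (iter k phi z)) ->
  (iter n phi z).1 \in `]a i, b i[ ->
  'D_v (iter n.+1 phi) z =
    (dG i (iter n phi z).1 * ('D_v (iter n phi) z).1,
     ('D_v (iter n phi) z).1 * shear (iter n phi z) +
     ('D_v (iter n phi) z).2 * fiber_slope (iter n phi z)).
Proof.
move=> h zi; have dn : differentiable (iter n phi : R * R -> R * R) z.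
  by apply: iter_is_diff => k kn; apply: h; rewrite ltnW.
have dn1 : differentiable (iter n.+1 phi : R * R -> R * R) z by exact: iter_is_diff.
rewrite !deriveE//; have [i' _ [/= z1 z2]] := h n (leqnn n).
exact: (diff_comp_apply v dn (phi_is_diff zi z2)).
Qed.

End Smooth.

(** * Growth of tangent vectors *)

Section Growth.
Context {R : realType} {d : nat} {a b : 'I_d -> R} {G dG : 'I_d -> R -> R}
  {K : R} {g : R -> R} {f : R * R -> R} {l r M Lam lam : R} {N : nat}
  {p rr : nat -> R}.
Hypothesis H : contracting_skew a b G dG K g f l r M Lam lam N p rr.
Hypothesis f_diff : forall i t x, t \in `]a i, b i[ -> x \in `]l, r[ ->
  differentiable f (t, x).
Implicit Types (i : 'I_d) (s t x y : R) (z v : R * R) (j k n : nat) (w : seq 'I_d).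
Let HB := cs_base H.
Local Notation phi := (skew_product g f).
Local Notation region := (cylinder `[l, r]%classic).
Local Notation J := (@cell R p rr).
Local Notation smooth_region := (@smooth_region R d a b l r).
Local Notation fiber_slope := (@fiber_slope R f).
Local Notation shear := (@shear R f).

Let f_derivable z v : smooth_region z -> derivable f z v.
Proof.
move=> [i _ [/= z1 z2]]; apply: diff_derivable.
by case: z z1 z2 => t x /=; exact: f_diff.
Qed.

Lemma shear_bound z : smooth_region z -> `|shear z| <= M.
Proof.
move=> zs; apply: derive_bound; first exact: f_derivable.
have [i _ [/= z1 z2]] := zs; case: z z1 z2 zs => t x /= t1 x1 zs.
move: (t1); rewrite in_itv/= => /andP[at_ tb].
have x2 : x \in `[l, r] by exact: subset_itv_oo_cc.
near=> h; rewrite [h *: _ + _](_ : _ = (h + t, x)); last first.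
  by rewrite -[LHS]/(h * 1 + t, h * 0 + x) mulr1 mulr0 add0r.
have h0 : 0 < h by near: h; exact: nbhs_right_gt.
have hb : h < b i - t by near: h; apply: nbhs_right_lt; rewrite subr_gt0.
have th : h + t \in `]a i, b i] by rewrite in_itv/=; apply/andP; split; lra.
apply: le_trans (cs_theta H th (subset_itv_oo_oc t1) x2) _.
by rewrite addrK gtr0_norm.
Unshelve. all: by end_near. Qed.

Let slope_bound (B : R) z : smooth_region z ->
  (\forall h \near (0 : R)^'+, `|f (z.1, h + z.2) - f (z.1, z.2)| <= B * h) ->
  `|fiber_slope z| <= B.
Proof.
move=> zs nB; apply: derive_bound; first exact: f_derivable.
apply: filterS nB => h; congr (`|f _ - f _| <= _); last by case: z zs.
by case: z zs => t x zs; rewrite -[RHS]/(h * 0 + t, h * 1 + x) mulr1 mulr0 add0r.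
Qed.

Lemma fiber_slope_bound z : smooth_region z -> `|fiber_slope z| <= Lam.
Proof.
move=> zs; apply: slope_bound => //.
have [i _ [/= z1 z2]] := zs; case: z z1 z2 zs => t x /= t1 x1 zs.
move: (x1); rewrite in_itv/= => /andP[lx xr].
have t01 := piece_sub HB (subset_itv_oo_oc t1).
near=> h.
have h0 : 0 < h by near: h; exact: nbhs_right_gt.
have hb : h < r - x by near: h; apply: nbhs_right_lt; rewrite subr_gt0.
have xh : h + x \in `[l, r] by rewrite in_itv/=; apply/andP; split; lra.
apply: le_trans (cs_x H t01 xh (subset_itv_oo_cc x1)) _.
by rewrite addrK gtr0_norm.
Unshelve. all: by end_near. Qed.

Lemma fiber_slope_contract j z : smooth_region z -> J j z.2 ->
  `|fiber_slope z| <= lam * (rr j.+1 / rr j).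
Proof.
move=> zs zJ; apply: slope_bound => //.
have [i _ [/= z1 z2]] := zs; case: z z1 z2 zs zJ => t x /= t1 x1 zs xJ.
have t01 := piece_sub HB (subset_itv_oo_oc t1).
move: (xJ); rewrite /cell /= ltr_norml => /andP[x2 x3].
near=> h.
have h0 : 0 < h by near: h; exact: nbhs_right_gt.
have hb : h < p j + rr j - x by near: h; apply: nbhs_right_lt; lra.
have xh : J j (h + x) by rewrite /cell /= ltr_norml; apply/andP; split; lra.
apply: le_trans (cs_contr H t01 xh xJ) _.
by rewrite addrK gtr0_norm.
Unshelve. all: by end_near. Qed.

Lemma rr_bounds : exists c0 c1, 0 < c0 /\ forall k, c0 <= rr k <= c1.
Proof.
exact: periodic_bounds (cs_N H) (cs_rrN H) (cs_rr H).
Qed.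

Lemma slope_ge16 z : smooth_region z -> 16%:R <= derive1 g z.1.
Proof.
move=> [i _ [/= z1 _]]; have [_ E] := base_is_derive H z1.
rewrite derive1E E; apply: (mm_exp HB); exact: subset_itv_oo_cc.
Qed.

Section Orbit.
Variables (z : R * R) (j0 : nat).
Hypothesis smooth_orbit : forall k, smooth_region (iter k phi z).
Hypothesis z_J : J j0 z.2.

Let z01 : z.1 \in `]0, 1].
Proof.
by have [i _ [/= z1 _]] := smooth_orbit 0; apply: (piece_sub HB); exact: (subset_itv_oo_oc z1).
Qed.

Let orbit_J k : J (j0 + k) (iter k phi z).2.
Proof. by rewrite [z]surjective_pairing; exact: (iter_phi_J H). Qed.

Lemma derive_rec v n : 'D_v (iter n.+1 phi) z =
  (derive1 g (iter n phi z).1 * ('D_v (iter n phi) z).1,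
   ('D_v (iter n phi) z).1 * shear (iter n phi z) +
   ('D_v (iter n phi) z).2 * fiber_slope (iter n phi z)).
Proof.
have [i _ [/= z1 z2]] := smooth_orbit n.
rewrite (derive_iterS H f_diff v _ z1); last by move=> k _; exact: smooth_orbit.
by have [_ <-] := base_is_derive H z1; rewrite derive1E.
Qed.

Let derive0 v : 'D_v (iter 0 phi) z = v.
Proof. by rewrite (_ : iter 0 phi = id)// derive_id. Qed.

Lemma expanding_component v n : v.1 != 0 -> ('D_v (iter n phi) z).1 != 0 /\
  ln `|('D_v (iter n phi) z).1| =
    ln `|v.1| + \sum_(0 <= k < n) ln (derive1 g (iter k phi z).1).
Proof.
move=> v0; elim: n => [|n [IH1 IH2]]; first by rewrite derive0 big_geq// addr0.
have s16 := slope_ge16 (smooth_orbit n).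
have s0 : 0 < derive1 g (iter n phi z).1 by apply: lt_le_trans s16; rewrite ltr0n.
rewrite derive_rec /=; split; first by rewrite mulf_neq0// gt_eqF.
rewrite normrM lnM ?posrE ?normr_gt0 ?IH1 ?gt_eqF// IH2 big_nat_recr//=.
by rewrite gtr0_norm//; lra.
Qed.

(** Measured in units of rr, the fibre component is contracted by lam at each step and
    receives at most M / c0 times the base component, where c0 is a lower bound of the radii;
    the base component meanwhile grows by a factor at least 16. So the ratio of the two stays
    below the sum of its initial value and M / c0. *)
Lemma cone_bound v : v.1 != 0 -> exists2 C : R, 1 <= C &
  forall n, `|('D_v (iter n phi) z).1| <= `|'D_v (iter n phi) z|
    <= C * `|('D_v (iter n phi) z).1|.
Proof.
move=> v0; have [c0 [c1 [c00 cr]]] := rr_bounds.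
have M0 := cs_M H; have r0 := cs_rr H.
pose C := M / c0 + `|v.2| / (rr j0 * `|v.1|).
have C0 : 0 <= C by rewrite addr_ge0// divr_ge0// ?mulr_ge0// ltW// c00.
have b_le n : `|('D_v (iter n phi) z).2| <= rr (j0 + n)%N * C * `|('D_v (iter n phi) z).1|.
  elim: n => [|n IH].
    rewrite derive0 addn0 /C mulrDr mulrDl.
    rewrite [X in _ + X](_ : _ = `|v.2|); last first.
      by field; rewrite normr_eq0 v0 gt_eqF.
    have [rj c0'] := (ltW (r0 j0), ltW c00); rewrite lerDr.
    by do 2 apply: mulr_ge0 => //; exact: divr_ge0.
  rewrite derive_rec /= normrM addnS.
  set A := `|('D_v (iter n phi) z).1| in IH *.
  have s16 := slope_ge16 (smooth_orbit n).
  have A0 : 0 <= A by exact: normr_ge0.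
  set Rn := rr (j0 + n).+1.
  have Rn0 : 0 < Rn by exact: r0.
  apply: le_trans (ler_normD _ _) _; rewrite !normrM -/A.
  have h1 : A * `|shear (iter n phi z)| <= Rn * C * A.
    rewrite mulrC ler_wpM2r//; apply: le_trans (shear_bound (smooth_orbit n)) _.
    have /andP[cRn _] := cr (j0 + n).+1.
    rewrite /C mulrDr; apply: (@le_trans _ _ (Rn * (M / c0))).
      by rewrite mulrCA ler_peMr// ler_pdivlMr// mul1r.
    by rewrite lerDl mulr_ge0 ?divr_ge0// ?mulr_ge0// ltW.
  have h2 : `|('D_v (iter n phi) z).2| * `|fiber_slope (iter n phi z)| <= Rn * C * A.
    have fs := fiber_slope_contract (smooth_orbit n) (orbit_J n).
    apply: le_trans (ler_pM _ _ IH fs) _ => //.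
    have /andP[l0 l1] := cs_lam H.
    rewrite [leLHS](_ : _ = lam * (Rn * C * A)); last by rewrite /Rn; field; rewrite gt_eqF.
    by rewrite ler_piMl ?(ltW l1)// !mulr_ge0// ltW.
  have h3 : 2 * (Rn * C * A) <= Rn * C * (`|derive1 g (iter n phi z).1| * A).
    rewrite mulrCA ler_wpM2l ?mulr_ge0 ?(ltW Rn0)// ler_wpM2r//.
    by apply: le_trans (ler_norm _); lra.
  by rewrite mulr_natl mulr2n in h3; apply: le_trans (lerD h1 h2) h3.
exists (1 + c1 * C) => [|n].
  have /andP[h1 h2] := cr 0%N; rewrite lerDl mulr_ge0//.
  by apply: le_trans h2; apply: le_trans h1; rewrite ltW.
rewrite [X in _ <= X <= _]prod_normE.
rewrite le_max lexx /= ge_max; apply/andP; split.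
  rewrite ler_peMl// lerDl mulr_ge0//.
  by have /andP[h1 h2] := cr 0%N; apply: le_trans h2; apply: le_trans h1; rewrite ltW.
apply: le_trans (b_le n) _; rewrite mulrDl mul1r -[leLHS]add0r lerD// ler_wpM2r//.
by rewrite ler_wpM2r//; have /andP[] := cr (j0 + n)%N.
Qed.

Lemma fiber_component v n : v.1 = 0 -> ('D_v (iter n phi) z).1 = 0 /\
  `|('D_v (iter n phi) z).2| = `|v.2| * \prod_(0 <= k < n) `|fiber_slope (iter k phi z)|.
Proof.
move=> v0; elim: n => [|n [IH1 IH2]]; first by rewrite derive0 big_geq// mulr1.
by rewrite derive_rec /= IH1 mulr0 mul0r add0r normrM IH2 big_nat_recr//= mulrA.
Qed.

Lemma fiber_contraction n :
  \prod_(0 <= k < n) `|fiber_slope (iter k phi z)| <= lam ^+ n * (rr (j0 + n)%N / rr j0).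
Proof.
have r0 := cs_rr H; have /andP[l0 l1] := cs_lam H.
elim: n => [|n IH]; first by rewrite big_geq// addn0 mul1r divff// gt_eqF.
rewrite big_nat_recr//= exprSr addnS.
apply: le_trans (ler_pM _ _ IH (fiber_slope_contract (smooth_orbit n) (orbit_J n))) _ => //.
  by apply: prodr_ge0 => k _.
rewrite le_eqVlt; apply/orP; left; apply/eqP; field.
by rewrite !gt_eqF.
Qed.

End Orbit.

End Growth.

(** * Lyapunov exponents *)

Section Lyapunov.
Context {R : realType} {d : nat} {a b : 'I_d -> R} {G dG : 'I_d -> R -> R}
  {K : R} {g : R -> R} {f : R * R -> R} {l r M Lam lam : R} {N : nat}
  {p rr : nat -> R}.
Hypothesis H : contracting_skew a b G dG K g f l r M Lam lam N p rr.
Hypothesis f_diff : forall i t x, t \in `]a i, b i[ -> x \in `]l, r[ ->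
  differentiable f (t, x).
Context {nu0 : probability (plane R) R} {T : set (line R)}.
Hypothesis HS : @section_srb R d a b g f l r lam N p rr nu0 T.
Implicit Types (i : 'I_d) (s t x y : R) (z v : R * R) (j k n : nat) (w : seq 'I_d).
Let HB := cs_base H.
Local Notation phi := (skew_product g f).
Local Notation phi_tot := (@phi_tot R g f l r).
Local Notation region := (cylinder `[l, r]%classic).
Local Notation J := (@cell R p rr).
Local Notation smooth_region := (@smooth_region R d a b l r).
Local Notation fiber_slope := (@fiber_slope R f).
Local Notation core := (@section_core R lam p rr).
Local Notation nu := (cycle_measure H (nu0 := nu0)).

Lemma smooth_region_sub : smooth_region `<=` region.
Proof.
move=> z [i _ [/= z1 z2]]; apply/region_iff; split.
  by apply: (piece_sub HB); exact: (subset_itv_oo_oc z1).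
exact: subset_itv_oo_cc.
Qed.

Lemma measurable_smooth_region : measurable (smooth_region : set (plane R)).
Proof.
apply: fin_bigcup_measurable; first exact: finite_finset.
by move=> i _; apply: measurableX; exact: measurable_itv.
Qed.

Lemma measurable_base_slope :
  measurable_fun smooth_region (fun z : plane R => derive1 g z.1).
Proof.
apply: measurable_fun_piecewise => i; first by apply: measurableX; exact: measurable_itv.
apply: (eq_measurable_fun (fun z : plane R => dG i z.1)).
  by move=> z /set_mem[/= z1 _]; have [_ <-] := base_is_derive H z1; rewrite derive1E.
apply: (@measurable_comp _ _ _ _ _ _ (`[a i, b i]%classic : set (line R))).
- exact: measurable_itv.
- by move=> _ [z [/= z1 _] <-]; exact: subset_itv_oo_cc.
- apply: subspace_continuous_measurable_fun; first exact: measurable_itv.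
  by apply: continuous_in_subspaceT => t /set_mem ti; exact: (mm_cont HB).
- by apply: measurable_funTS; exact: measurable_fst.
Qed.

Lemma measurable_fiber_slope : measurable_fun smooth_region (fiber_slope : plane R -> R).
Proof.
pose h n (z : plane R) := n.+1%:R * ((phi_tot (z.1, n.+1%:R^-1 + z.2)).2 - (phi_tot z).2).
apply: (@measurable_fun_cvg _ _ _ _ h) => [n|z zs].
  apply: measurable_funTS; apply: measurable_funM => //.
  have m2 := measurableT_comp (@measurable_snd _ _ (line R) (line R)) (measurable_phi_tot H).
  apply: measurable_funB; last exact: m2.
  apply: (measurableT_comp m2); apply/measurable_fun_pairP; split => /=.
    exact: measurable_fst.
  by apply: measurable_funD => //; exact: measurable_snd.
have dz : derivable f z (0, 1).
  apply: diff_derivable; have [i _ [/= z1 z2]] := zs.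
  by case: z z1 z2 {zs} => t x /=; exact: f_diff.
have h0 : h^-1 *: (f (h *: (0, 1) + z) - f z) @[h --> (0 : R)^'] --> fiber_slope z.
  by have /cvg_ex[L HL] := dz; rewrite -[fiber_slope z]/(lim _) (cvg_lim _ HL).
have e0 : (n.+1%:R^-1 : R) @[n --> \oo] --> (0 : R)^'.
  move=> E [e e0 He]; have [n0 Hn0] := real_lt_nat e^-1.
  exists n0 => // n /= n0n; apply: He; last by rewrite /= invr_eq0 pnatr_eq0.
  rewrite /= sub0r normrN gtr0_norm ?invr_gt0// invf_plt ?posrE//.
  by apply: lt_le_trans Hn0 _; rewrite ler_nat ltnW.
have := cvg_comp _ _ e0 h0; apply: cvg_trans; apply: near_eq_cvg.
have [i _ [/= z1 z2]] := zs; move: (z2); rewrite in_itv/= => /andP[lz zr].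
have [n0 Hn0] := real_lt_nat (r - z.2)^-1.
exists n0 => // n /= n0n.
have en : n.+1%:R^-1 < r - z.2.
  rewrite invf_plt ?posrE ?subr_gt0//.
  by apply: lt_le_trans Hn0 _; rewrite ler_nat ltnW.
have en0 : (0 : R) < n.+1%:R^-1 by rewrite invr_gt0.
have rz := smooth_region_sub zs; have /region_iff[z01 _] := rz.
rewrite /h invrK (phi_totE rz) phi_totE; last first.
  apply/region_iff; split => //=; rewrite in_itv/=; move: en en0.
  by set e := _^-1 => en en0; apply/andP; split; lra.
congr (_ * (f _ - _)).
case: (z) => t x; rewrite -[LHS]/(n.+1%:R^-1 * 0 + t, n.+1%:R^-1 * 1 + x).
by rewrite mulr0 mulr1 add0r.
Qed.

(** Preimages of finite sets under g^k are finite. Thus almost no orbit meets the ends of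
    the pieces, where phi is not differentiable. *)
Lemma finite_orbit_null k (Y : set R) : finite_set Y ->
  measurable ([set z | region z /\ Y (iter k g z.1)] : set (plane R)) /\
  nu0 [set z | region z /\ Y (iter k g z.1)] = 0%E.
Proof.
move=> finY; have mY : measurable (Y : set (line R)).
  by apply: countable_measurable => //; exact: finite_set_countable.
pose B : set (line R) := `]0, 1]%classic `&` (iter k (@base_tot R g) @^-1` Y).
have mB : measurable B.
  apply: measurableI; first exact: measurable_itv.
  rewrite -[X in measurable X]setTI; apply: measurable_iter => //.
  exact: (measurable_g_tot H).
have B0 : lebesgue_measure B = 0%E.
  apply: countable_lebesgue_measure0; apply: finite_set_countable.
  apply: (@sub_finite_set _ _ (\bigcup_(w in [set: k.-tuple 'I_d]) (@psi_word R d a b G w @` Y))); last first.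
    by apply: bigcup_finite => [|w _]; [exact: finite_finset|exact: finite_image].
  move=> t [t01 /= ty]; have [w wt] := itinerary_word HB k t01.
  exists w => //; exists (iter k (@base_tot R g) t) => //; rewrite (iter_g_totE H)//.
  by have [_] := word_cylinder_psi HB wt; rewrite size_tuple.
have B0' := ss_null HS mB (@subIsetl _ _ _) B0.
have mE : measurable ([set z | region z /\ Y (iter k g z.1)] : set (plane R)).
  rewrite (_ : [set z | _] = region `&` (fst @^-1` B)).
    apply: measurableI; first exact: measurable_region.
    by rewrite -[X in measurable X]setTI; exact: measurable_fst.
  apply/seteqP; split => z /= [rz]; have /region_iff[z1 _] := rz.
    by move=> zy; split => //; split => //=; rewrite (iter_g_totE H).
  by move=> [_ /=]; rewrite (iter_g_totE H).
split=> //; apply/eqP; rewrite eq_le measure_ge0 andbT -B0'.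
apply: le_measure; rewrite ?inE//.
  by rewrite -[X in measurable X]setTI; exact: measurable_fst.
move=> z /= [/region_iff[z1 _] zy]; split => //=.
by rewrite (iter_g_totE H).
Qed.

Lemma ae_region : {ae nu, forall z, region z /\ exists j, J j z.2}.
Proof.
pose Tr : set (plane R) := \bigcup_(j in `I_N) (`]0, 1]%classic `*` `]p j - rr j, p j + rr j[%classic).
have mTr : measurable Tr.
  by apply: fin_bigcup_measurable => [|j _]; [exact: finite_II|apply: measurableX; exact: measurable_itv].
exists (~` Tr); split; first exact: measurableC.
  have := probability_setC nu mTr; suff -> : nu Tr = 1%E by rewrite subee.
  apply: cycle_measure_const => k; rewrite -(ss_core HS).
  apply: (probability_eq_on (@measurable_section_core R lam p rr) (ss_core HS)).
  - rewrite -[X in measurable X]setTI; apply: measurable_iter => //.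
    exact: (measurable_phi_tot H).
  - exact: measurable_section_core.
  - move=> z zc; split=> // _; have rz := section_core_region H zc.
    have [z1 zJ] := core_J H zc; have /region_iff[k1 _] := iter_phi_region H k rz.
    rewrite /preimage /= (iter_phi_totE H)//.
    exists (k %% N)%N; first by rewrite /= ltn_mod (cs_N H).
    split => //=; move: (iter_phi_J H k z1 zJ); rewrite -surjective_pairing add0n.
    rewrite (J_mod H k).1 /cell /= ltr_norml in_itv/= => /andP[x1 x2].
    by apply/andP; split; lra.
move=> z nz zT; apply: nz; have [j _ [/= z1]] := zT; rewrite in_itv/= => /andP[x1 x2].
have zJ : J j z.2 by rewrite /cell /= ltr_norml; apply/andP; split; lra.
by split; [apply/region_iff; split => //; exact: (J_itv H zJ)|exists j].
Qed.

Lemma ae_smooth : {ae nu, forall z, smooth_region z}.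
Proof.
have FF : Filter (almost_everywhere nu) by exact: ae_filter_ringOfSetsType.
have finb : finite_set (range b) by apply: finite_image; exact: finite_finset.
have [mS0 _] := finite_orbit_null 0 finb.
have S0 : {ae nu, forall z, ~ (region z /\ range b z.1)}.
  exists [set z | region z /\ range b z.1]; split => //; last by move=> z /= /contrapT.
  apply: cycle_measure_const => k; have [mSk Sk0] := finite_orbit_null k finb.
  apply: (etrans _ Sk0); apply: (probability_eq_on (@measurable_region R l r) (section_region H HS)) => //.
    rewrite -[X in measurable X]setTI; apply: measurable_iter => //.
    exact: (measurable_phi_tot H).
  move=> z rz; rewrite /preimage /= (iter_phi_totE H)// iter_phi1; split => [[]|[]] //.
  by split => //; exact: (iter_phi_region H).
apply: filterS2 ae_region S0 => z [rz [j zJ]] nS.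
have /region_iff[z1 _] := rz; have [i zi] := piece_ex HB z1.
exists i => //; split => /=; last first.
  have [lp pr] := cs_J H j; move: zJ; rewrite /cell /= ltr_norml in_itv/= => /andP[x1 x2].
  by apply/andP; split; lra.
move: zi; rewrite !in_itv/= => /andP[-> ]; rewrite le_eqVlt => /orP[/eqP E|//].
by exfalso; apply: nS; split => //; exists i.
Qed.

Lemma cycle_ergodic_tot (A : set (plane R)) : measurable A -> phi_tot @^-1` A = A ->
  nu A = 0%E \/ nu A = 1%E.
Proof.
move=> mA Ainv; have mr := @measurable_region R l r.
have <- : nu (A `&` region) = nu A.
  apply: (probability_eq_on mr (cycle_region H HS)) => //; first exact: measurableI.
  by move=> z rz; split => [[]|].
apply: (cycle_ergodic H HS); [exact: measurableI|exact: subIsetr|].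
apply/seteqP; split => z.
  move=> [rz [+ _]]; rewrite -[A (phi z)]/((phi @^-1` A) z) => Az; split => //.
  by rewrite -Ainv /preimage /= phi_totE.
move=> [Az rz]; split => //; split; last exact: (phi_region H).
by move: Az; rewrite -{1}Ainv /preimage /= phi_totE.
Qed.

Definition log_expansion z : \bar R :=
  if z \in smooth_region then (ln (derive1 g z.1))%:E else (ln 16%:R)%:E.

(** Nonnegative because |f_x| <= Lam, and +oo at critical points, so that averages of the
    logarithm of the fibre derivative fall under [birkhoff_ge0]. *)
Definition log_contraction z : \bar R :=
  if z \in smooth_region then
    if fiber_slope z == 0 then +oo%E else (ln (Lam + 1) - ln `|fiber_slope z|)%:E
  else 0%E.

Lemma measurable_log_expansion : measurable_fun setT (log_expansion : plane R -> \bar R).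
Proof.
apply: (@measurable_fun_split _ _ _ _ smooth_region _
  (fun z : plane R => (ln (derive1 g z.1))%:E) (cst (ln 16%:R)%:E)).
- exact: measurable_smooth_region.
- apply/measurable_EFinP; apply: (@measurableT_comp _ _ _ _ _ _ (@ln R)).
    exact: measurable_ln.
  exact: measurable_base_slope.
- exact: measurable_cst.
- by move=> z zs; rewrite /log_expansion mem_set.
- by move=> z zs; rewrite /log_expansion memNset.
Qed.

Lemma measurable_log_contraction : measurable_fun setT (log_contraction : plane R -> \bar R).
Proof.
have ms := measurable_smooth_region.
apply: (@measurable_fun_split _ _ _ _ smooth_region _
  (fun z : plane R => if fiber_slope z == 0 then +oo%E else (ln (Lam + 1) - ln `|fiber_slope z|)%:E) (cst 0%E)) => //.
- apply: measurable_fun_if => //.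
  + by apply: measurable_fun_eqr => //; exact: measurable_fiber_slope.
  + apply: (measurable_funS ms); first by move=> z [].
    apply/measurable_EFinP; apply: measurable_funB => //.
    apply: (@measurableT_comp _ _ _ _ _ _ (@ln R)); first exact: measurable_ln.
    by apply: measurableT_comp => //; exact: measurable_fiber_slope.
- by move=> z zs; rewrite /log_contraction mem_set.
- by move=> z zs; rewrite /log_contraction memNset.
Qed.

Lemma log_expansion_ge z : ((ln 16%:R)%:E <= log_expansion z)%E.
Proof.
rewrite /log_expansion; case: ifPn => // /set_mem zs; rewrite lee_fin ler_ln ?posrE.
- exact: (slope_ge16 H).
- by rewrite ltr0n.
- by apply: lt_le_trans (slope_ge16 H zs); rewrite ltr0n.
Qed.

Lemma log_contraction_ge0 z : (0 <= log_contraction z)%E.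
Proof.
rewrite /log_contraction; case: ifPn => // /set_mem zs; case: eqP => // /eqP s0.
have L0 := cs_Lam H; have sL := fiber_slope_bound H f_diff zs.
rewrite lee_fin subr_ge0 ler_ln ?posrE ?normr_gt0//; lra.
Qed.

End Lyapunov.

Lemma bounded_div_nat_cvg0 (R : realType) (u : nat -> R) (B : R) :
  (forall n, `|u n| <= B) -> n%:R^-1 * u n @[n --> \oo] --> (0 : R).
Proof.
move=> uB; apply/cvgrPdist_lt => e e0; have [n0 Hn0] := real_lt_nat (B / e).
have B0 : 0 <= B by apply: le_trans (uB 0%N).
exists n0.+1 => // n /= n0n; have n_gt0 : (0 : R) < n%:R by rewrite ltr0n (leq_ltn_trans _ n0n).
rewrite sub0r normrN normrM gtr0_norm ?invr_gt0// mulrC ltr_pdivrMr//.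
apply: le_lt_trans (uB n) _; rewrite mulrC -ltr_pdivrMr//.
by apply: lt_le_trans Hn0 _; rewrite ler_nat ltnW.
Qed.

Section Hyperbolicity.
Context {R : realType} {d : nat} {a b : 'I_d -> R} {G dG : 'I_d -> R -> R}
  {K : R} {g : R -> R} {f : R * R -> R} {l r M Lam lam : R} {N : nat}
  {p rr : nat -> R}.
Hypothesis H : contracting_skew a b G dG K g f l r M Lam lam N p rr.
Hypothesis f_diff : forall i t x, t \in `]a i, b i[ -> x \in `]l, r[ ->
  differentiable f (t, x).
Context {nu0 : probability (plane R) R} {T : set (line R)}.
Hypothesis HS : @section_srb R d a b g f l r lam N p rr nu0 T.
Implicit Types (i : 'I_d) (s t x y : R) (z v : R * R) (j k n : nat) (w : seq 'I_d).
Let HB := cs_base H.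
Local Notation phi := (skew_product g f).
Local Notation phi_tot := (@phi_tot R g f l r).
Local Notation region := (cylinder `[l, r]%classic).
Local Notation J := (@cell R p rr).
Local Notation smooth_region := (@smooth_region R d a b l r).
Local Notation fiber_slope := (@fiber_slope R f).
Local Notation nu := (cycle_measure H (nu0 := nu0)).
Local Notation base_rate := (@log_expansion R d a b g l r).
Local Notation fiber_rate := (@log_contraction R d a b f l r Lam).

Definition unstable_exponent : \bar R := (\int[nu]_z base_rate z)%E.
Definition stable_exponent : \bar R := ((ln (Lam + 1))%:E - \int[nu]_z fiber_rate z)%E.

Record regular_point z : Prop := RegularPoint {
  rp_region : region z;
  rp_J : exists j, J j z.2;
  rp_smooth : forall k, smooth_region (iter k phi z);
  rp_expansion : ((n%:R^-1)%:E * \sum_(0 <= k < n) base_rate (iter k phi z))%E @[n --> \oo] -->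
    unstable_exponent;
  rp_contraction : ((n%:R^-1)%:E * \sum_(0 <= k < n) fiber_rate (iter k phi z))%E @[n --> \oo] -->
    (\int[nu]_z fiber_rate z)%E }.

Lemma ae_regular : {ae nu, forall z, regular_point z}.
Proof.
have FF : Filter (almost_everywhere nu) by exact: ae_filter_ringOfSetsType.
have mt := measurable_phi_tot H.
have inv := cycle_invariant_tot H HS.
have erg := cycle_ergodic_tot H HS.
have sm := ae_orbit mt inv (ae_smooth H HS).
have ex0 z : (0 <= base_rate z)%E.
  by apply: le_trans (log_expansion_ge H z); rewrite lee_fin ln_ge0// ler1n.
have be := birkhoff_ge0 mt inv erg (measurable_log_expansion H) ex0.
have bc := birkhoff_ge0 mt inv erg (measurable_log_contraction H f_diff) (log_contraction_ge0 H f_diff).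
apply: filterS2 (filterI (ae_region H HS) sm) (filterI be bc) => z [[rz jz] sz] [ez cz].
have E k : iter k phi_tot z = iter k phi z by exact: (iter_phi_totE H).
split; [exact: rz|exact: jz|by move=> k; rewrite -E| |].
- have En n : ((n%:R^-1)%:E * \sum_(0 <= k < n) base_rate (iter k phi_tot z) =
      (n%:R^-1)%:E * \sum_(0 <= k < n) base_rate (iter k phi z))%E.
    by congr (_ * _)%E; apply: eq_bigr => k _; rewrite E.
  by rewrite -(eq_cvg _ _ En).
- have En n : ((n%:R^-1)%:E * \sum_(0 <= k < n) fiber_rate (iter k phi_tot z) =
      (n%:R^-1)%:E * \sum_(0 <= k < n) fiber_rate (iter k phi z))%E.
    by congr (_ * _)%E; apply: eq_bigr => k _; rewrite E.
  by rewrite -(eq_cvg _ _ En).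
Qed.

(** By [cone_bound] the norm of the image vector and the modulus of its base component
    differ by a bounded factor, which does not affect the rate. *)
Lemma lyapunov_unstable z v : regular_point z -> v.1 != 0 ->
  lyapunov_at phi z v unstable_exponent.
Proof.
move=> [rz [j zJ] sz ez _] v0; have [C C1 HC] := cone_bound H f_diff sz zJ v0.
pose D n : R := `|'D_v (iter n phi) z|; pose A n : R := `|('D_v (iter n phi) z).1|.
have An n := expanding_component H f_diff sz n v0.
have A0 n : 0 < A n by rewrite normr_gt0; have [] := An n.
have D0 n : 0 < D n by apply: lt_le_trans (A0 n) _; have /andP[] := HC n.
have e_cvg : n%:R^-1 * (ln (D n) - ln (A n) + ln `|v.1|) @[n --> \oo] --> (0 : R).
  apply: (@bounded_div_nat_cvg0 _ _ (ln C + `|ln `|v.1| |)) => n.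
  apply: le_trans (ler_normD _ _) _; rewrite lerD2r.
  have /andP[h1 h2] := HC n.
  have l1 : ln (A n) <= ln (D n) by rewrite ler_ln ?posrE.
  have C0 : 0 < C by apply: lt_le_trans C1.
  have l2 : ln (D n) <= ln C + ln (A n) by rewrite -lnM ?posrE// ler_ln ?posrE// mulr_gt0.
  by rewrite ger0_norm; lra.
have E n : ((n%:R^-1)%:E * lne (D n)%:E = (n%:R^-1)%:E * \sum_(0 <= k < n) base_rate (iter k phi z) +
    (n%:R^-1 * (ln (D n) - ln (A n) + ln `|v.1|))%:E)%E.
  rewrite (eq_bigr (fun k => (ln (derive1 g (iter k phi z).1))%:E)); last first.
    by move=> k _; rewrite /log_expansion mem_set.
  rewrite sumEFin lne_EFin// -!EFinM -EFinD -mulrDr; congr (_ * _)%:E.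
  by have [_ ->] := An n; lra.
rewrite /lyapunov_at (eq_cvg _ _ E) -[unstable_exponent]adde0.
by apply: cvgeD => //; [exact: fin_num_adde_defl|apply: cvg_EFin => //; exact: nearW].
Qed.

(** The two sides of the formula for lne are infinite together as soon as the orbit meets
    a critical point. *)
Lemma lyapunov_stable z v : regular_point z -> v.1 = 0 -> v.2 != 0 ->
  lyapunov_at phi z v stable_exponent.
Proof.
move=> [rz [j zJ] sz _ cz] v1 v2.
have L1 : 0 < Lam + 1 by have := cs_Lam H; lra.
have E n : (lne (`|'D_v (iter n phi) z|%:E) =
   (n%:R * ln (Lam + 1) + ln `|v.2|)%:E - \sum_(0 <= k < n) fiber_rate (iter k phi z))%E.
  have [D1 D2] := fiber_component H f_diff sz n v1.
  rewrite [`|'D_v _ _|]prod_normE D1 normr0 max_r// D2.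
  elim: n {D1 D2} => [|n IH].
    by rewrite !big_geq// mulr1 mul0r add0r sube0 lne_EFin// normr_gt0.
  rewrite !big_nat_recr// mulrA.
  have S0 : (0 <= \sum_(0 <= k < n) fiber_rate (iter k phi z))%E.
    by apply: sume_ge0 => k _; exact: (log_contraction_ge0 H f_diff).
  move: IH S0; set B := _ * _; set S := (\sum_(0 <= k < n) _)%E => IH S0.
  have B0 : 0 <= B by rewrite mulr_ge0// prodr_ge0.
  clearbody B S.
  rewrite {1}/log_contraction mem_set//; case: eqP => [->|/eqP s0].
    by rewrite normr0 mulr0 le0_lneNy//; case: S S0 {IH}.
  case: S IH S0 => [s'| |] // IH _; have [B00|B1] := eqVneq B 0.
  - by move: IH; rewrite B00 le0_lneNy.
  - have Bp : 0 < B by rewrite lt_neqAle eq_sym B1.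
    move: IH; rewrite !lne_EFin ?mulr_gt0 ?normr_gt0// => -[IH].
    by rewrite lnM ?posrE ?normr_gt0// -EFinB; congr (_%:E); rewrite IH -natr1; lra.
  - by rewrite B00 mul0r le0_lneNy.
  - by move: IH; rewrite lne_EFin// lt_neqAle eq_sym B1.
rewrite /lyapunov_at (eq_cvg _ (g := fun n => ((n%:R^-1 * (n%:R * ln (Lam + 1) + ln `|v.2|))%:E -
    (n%:R^-1)%:E * \sum_(0 <= k < n) fiber_rate (iter k phi z))%E)); last first.
  by move=> n; rewrite E muleBr// fin_num_adde_defr.
apply: cvgeB => //.
apply: cvg_EFin; first exact: nearW.
have : ln (Lam + 1) + n%:R^-1 * ln `|v.2| @[n --> \oo] --> ln (Lam + 1) + 0.
  apply: cvgD; first exact: cvg_cst.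
  by apply: (@bounded_div_nat_cvg0 _ _ `|ln `|v.2| |).
rewrite addr0; apply: cvg_trans; apply: near_eq_cvg; exists 1%N => // n /= n0.
by rewrite mulrDr mulKf// pnatr_eq0 -lt0n.
Qed.

Lemma unstable_exponent_gt0 : (0 < unstable_exponent)%E.
Proof.
apply: (@lt_le_trans _ _ (ln 16%:R)%:E); first by rewrite lte_fin ln_gt0// ltr1n.
have -> : ((ln 16%:R)%:E = \int[nu]_z (cst (ln 16%:R : R)%:E) z)%E.
  rewrite integral_cst//= -[X in (_ * X)%E]/(nu setT) -[LHS]mule1; congr (_ * _)%E.
  by apply/esym; exact: probability_setT.
apply: ge0_le_integral => //.
- by move=> z _; rewrite /= lee_fin ln_ge0// ler1n.
- exact: (measurable_log_expansion H).
- by move=> z _; exact: (log_expansion_ge H).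
Qed.

(** The exponent is the rate of growth of a vertical vector at some regular point, and
    [fiber_contraction] bounds that rate by ln lam. *)
Lemma stable_exponent_lt0 : (stable_exponent < 0)%E.
Proof.
have [z zr] : exists z, regular_point z.
  apply: contrapT => nz; have [A [mA A0 nA]] := ae_regular.
  have : nu setT = 0%E.
    apply/eqP; rewrite eq_le measure_ge0 andbT -A0; apply: le_measure; rewrite ?inE//.
    by move=> z _; apply: nA => zr; apply: nz; exists z.
  by rewrite probability_setT => /eqP; rewrite eqe oner_eq0.
have v2 : ((0 : R, 1 : R)).2 != 0 by rewrite /= oner_eq0.
have := lyapunov_stable zr (erefl : (0 : R, 1 : R).1 = 0) v2.
have [rz [j zJ] sz _ _] := zr.
have [l0 l1] := andP (cs_lam H); have r0 := cs_rr H.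
have [c0 [c1 [c00 cr]]] := rr_bounds H.
move=> L; apply: (@le_lt_trans _ _ (ln lam)%:E); last by rewrite lte_fin ln_lt0// l0.
have U : ((ln lam + n%:R^-1 * ln (c1 / rr j))%:E)%E @[n --> \oo] --> (ln lam)%:E.
  apply: cvg_EFin; first exact: nearW.
  rewrite -[X in _ --> X]addr0; apply: cvgD; first exact: cvg_cst.
  by apply: (@bounded_div_nat_cvg0 _ _ `|ln (c1 / rr j)|).
apply: (lee_cvg_to L U); exists 1%N => // n n0; rewrite /mkset in n0.
have n_gt0 : (0 : R) < n%:R by rewrite ltr0n.
have [D1 D2] := fiber_component H f_diff sz n (erefl : (0 : R, 1 : R).1 = 0).
rewrite [`|'D_((0, 1) : R * R) _ _|]prod_normE D1 normr0 max_r// D2 normr1 mul1r.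
set B := \prod_(0 <= k < n) _.
have B0 : 0 <= B by exact: prodr_ge0.
have c10 : 0 < c1 by have /andP[h1 h2] := cr 0%N; lra.
have [->|Bn0] := eqVneq B 0; first by rewrite le0_lneNy// gt0_muleNy ?leNye// lte_fin invr_gt0.
have Bp : 0 < B by rewrite lt_neqAle eq_sym Bn0.
rewrite lne_EFin// lee_fin mulrC ler_pdivrMr//.
have BB : B <= lam ^+ n * (c1 / rr j).
  apply: le_trans (fiber_contraction H f_diff sz zJ n) _.
  rewrite ler_wpM2l ?exprn_ge0 ?(ltW l0)// ler_wpM2r ?invr_ge0 ?(ltW (r0 j))//.
  by have /andP[] := cr (j + n)%N.
have X0 : 0 < lam ^+ n * (c1 / rr j) by rewrite mulr_gt0 ?exprn_gt0// divr_gt0.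
have : ln B <= ln (lam ^+ n * (c1 / rr j)) by rewrite ler_ln ?posrE.
rewrite lnM ?posrE ?exprn_gt0 ?divr_gt0// lnXn// => h.
by rewrite mulrDl mulrAC mulVf ?gt_eqF// mul1r mulr_natr.
Qed.

Theorem cycle_hyperbolic : hyperbolic_measure phi nu.
Proof.
have ug := unstable_exponent_gt0; have sl := stable_exponent_lt0.
exists [:: unstable_exponent; stable_exponent]; split.
- have FF : Filter (almost_everywhere nu) by exact: ae_filter_ringOfSetsType.
  apply: filterS ae_regular => z zr; have [rz jz sz _ _] := zr; split.
  + by move=> n; apply: (iter_is_diff H f_diff) => k _; exact: sz.
  + move=> v v0; have [v1|v1] := eqVneq v.1 0.
      exists stable_exponent; first by rewrite !inE eqxx orbT.
      apply: lyapunov_stable => //; apply: contra v0 => /eqP v2.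
      by rewrite [v]surjective_pairing v1 v2.
    by exists unstable_exponent; [rewrite inE eqxx|exact: lyapunov_unstable].
  + move=> lambda; rewrite !inE => /orP[]/eqP->.
      exists (1, 0); last by apply: lyapunov_unstable => //=; rewrite oner_eq0.
      by rewrite xpair_eqE oner_eq0.
    exists (0, 1); last by apply: lyapunov_stable => //=; rewrite oner_eq0.
    by rewrite xpair_eqE oner_eq0 andbF.
- rewrite !inE negb_or; apply/andP; split; last by rewrite gt_eqF.
  by rewrite lt_eqF.
- by exists unstable_exponent; rewrite ?inE ?eqxx.
- by exists stable_exponent; rewrite ?inE ?eqxx ?orbT.
Qed.

End Hyperbolicity.

Theorem contracting_skew_SRB (R : realType) (d : nat) (a b : 'I_d -> R)
    (G dG : 'I_d -> R -> R) (K : R) (g : R -> R) (f : R * R -> R)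
    (l r M Lam lam : R) (N : nat) (p rr : nat -> R) :
  contracting_skew a b G dG K g f l r M Lam lam N p rr ->
  (forall i t x, t \in `]a i, b i[ -> x \in `]l, r[ -> differentiable f (t, x)) ->
  has_hyperbolic_SRB l r (skew_product g f).
Proof.
move=> H f_diff; have [nu0 [T HS]] := section_srb_exists H.
exists (cycle_measure H (nu0 := nu0)); split.
- exact: (cycle_SRB H HS).
- exact: (cycle_hyperbolic H f_diff HS).
- exact: (cycle_proper_attractor H HS).
Qed.

(** * Attracting cycles of the quadratic map *)

Lemma mvt_segment (R : realType) (F dF : R -> R) (u v : R) : u < v ->
  (forall x, x \in `[u, v] -> is_derive x 1 F (dF x)) ->
  exists2 c : R, c \in `]u, v[ & F v - F u = dF c * (v - u).
Proof.
move=> uv dFx.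
have dI : forall x, x \in `]u, v[ -> is_derive x 1 F (dF x).
  by move=> x xI; apply: dFx; exact: subset_itv_oo_cc.
have cF : {within `[u, v], continuous F}.
  by apply: derivable_within_continuous => x xI; have [] := dFx x xI.
exact: (MVT uv dI cF).
Qed.

Lemma prod_perturb (R : realType) (m : nat -> R) (N : nat) :
  \prod_(0 <= j < N) m j < 1 -> exists2 s : R, 0 < s & \prod_(0 <= j < N) (m j + s) < 1.
Proof.
move=> m1.
have : \prod_(0 <= j < N) (m j + s) @[s --> (0 : R)^'+] --> \prod_(0 <= j < N) m j.
  elim: N {m1} => [|N IH].
    rewrite big_geq// (_ : (fun s : R => _) = cst 1); first exact: cvg_cst.
    by apply/funext => s; rewrite big_geq.
  rewrite big_nat_recr//= (_ : (fun s : R => _) = (fun s => \prod_(0 <= j < N) (m j + s) * (m N + s))).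
    apply: cvgM => //; rewrite -[X in _ --> X]addr0; apply: cvgD; first exact: cvg_cst.
    exact: cvg_at_right_filter cvg_id.
  by apply/funext => s; rewrite big_nat_recr.
move=> /cvgr_lt /(_ _ m1) nP; near (0 : R)^'+ => s.
exists s; last by near: s; exact: nP.
by near: s; exact: nbhs_right_gt.
Unshelve. all: by end_near. Qed.

Section QuadraticCycle.
Context {R : realType}.
Variables (a0 l r : R).
Local Notation h := (fun x : R => a0 - x ^+ 2).
Implicit Types (x y : R) (n j k : nat).

Lemma quadratic_is_derive x : is_derive x 1 h (- (2 * x)).
Proof.
have -> : h = cst a0 - (id : R -> R) ^+ 2 by apply/funext => y.
have D := is_deriveB (is_derive_cst a0 x 1) (is_deriveX 2 (is_derive_id x 1)).
by apply: (is_derive_eq D); rewrite sub0r expr1 /GRing.scale /= mulr1.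
Qed.

Lemma iter_quadratic_is_derive n x :
  is_derive x 1 (iter n h) (\prod_(0 <= k < n) (- (2 * iter k h x))).
Proof.
elim: n => [|n IH]; first by rewrite big_geq//; exact: is_derive_id.
rewrite big_nat_recr//= mulrC.
exact: (is_derive1_comp (quadratic_is_derive (iter n h x)) IH).
Qed.

(** Otherwise all of [l, r] would be expanding, whereas the mean value theorem gives a
    point where the derivative of h^n, a self-map of [l, r], is at most 1. *)
Lemma attracting_point_exists : l < r -> hyperbolic_endo l r h ->
  exists p, attracting_periodic l r h p.
Proof.
move=> lr [_ hlr _ [_ _ [C [lam [C0 lam1 Hexp]]]]]; apply: contrapT => noA.
have A0 : attracting_periodic l r h = set0.
  by apply/seteqP; split => // p pA; apply: noA; exists p.
have iter_in n x : x \in `[l, r] -> iter n h x \in `[l, r].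
  by move=> xI; elim: n => //= n IH; apply: hlr; exists (iter n h x).
have lin : l \in `[l, r] by rewrite in_itv/= lexx ltW.
have rin : r \in `[l, r] by rewrite in_itv/= lexx ltW.
have bound n : C * lam ^+ n <= 1.
  have [c clr E] := mvt_segment lr (fun x _ => iter_quadratic_is_derive n x).
  have cI : (`[l, r] `\` \bigcup_(p in attracting_periodic l r h) periodic_basin l r h p) c.
    by split; [exact: subset_itv_oo_cc|rewrite A0 bigcup_set0].
  apply: le_trans (Hexp n c cI) _; rewrite derive1E.
  have [_ ->] := iter_quadratic_is_derive n c.
  have rl : 0 < r - l by rewrite subr_gt0.
  rewrite -(ler_pM2r rl) mul1r -[X in _ * X]gtr0_norm// -normrM -E.
  move: (iter_in n l lin) (iter_in n r rin); rewrite !in_itv/= ler_norml.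
  by move=> /andP[? ?] /andP[? ?]; apply/andP; split; lra.
have [n Hn] : exists n0, forall n, (n0 <= n)%N -> lam^-1 ^+ n < C.
  by apply: small_power => //; rewrite invr_ge0 invf_lt1 ?(lt_trans ltr01)// (ltW (lt_trans ltr01 lam1)).
have := Hn n (leqnn n); have := bound n.
rewrite exprVn -ler_pdivlMr ?exprn_gt0 ?(lt_trans ltr01)// mul1r => h1 h2.
by have := le_lt_trans h1 h2; rewrite ltxx.
Qed.

Lemma attracting_multiplier p : attracting_periodic l r h p ->
  exists N, [/\ (0 < N)%N, iter N h p = p & \prod_(0 <= j < N) `|2 * iter j h p| < 1].
Proof.
move=> [_ [N [N0 pN p1]]]; exists N; split => //.
have [_ E] := iter_quadratic_is_derive N p.
move: p1; rewrite derive1E E normr_prod; congr (_ < _).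
by apply: eq_bigr => j _; rewrite normrN.
Qed.

Lemma quadratic_secant x y : h x - h y = - ((x + y) * (x - y)).
Proof. by move=> /=; ring. Qed.

(** Let m_j = |h' (p_j)|, so that the product of the m_j over the cycle is below 1, and keep
    some room: rho, the product of the m_j + sigma, is still below 1. With
    q = rho^(-1/N) > 1, the weights w_(j+1) = q * (m_j + sigma) * w_j are N-periodic; if
    the radii are proportional to w_j, every map with slope at most m_j + sigma on J_j
    contracts by 1 / q in the scale of the radii. The common factor s of the radii makes
    h' vary by at most sigma / 2 on each J_j and keeps J_j in [l, r]; the remaining
    sigma / 2 absorbs the distance from h to F. *)
Lemma trapping_cycle (alpha : R) : 0 < alpha ->
  (forall x, x \in `[l, r] -> l + alpha <= h x <= r - alpha) ->
  (exists p, attracting_periodic l r h p) ->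
  exists (eta lam : R) (N : nat) (p rr : nat -> R),
    [/\ 0 < eta, 0 < lam < 1, (0 < N)%N,
      forall j, p (j + N)%N = p j /\ rr (j + N)%N = rr j &
      forall j, [/\ 0 < rr j, l <= p j - rr j & p j + rr j <= r]] /\
    forall (F : R -> R), (forall x, x \in `[l, r] -> `|F x - h x| <= eta) ->
      (forall x y, x \in `[l, r] -> y \in `[l, r] ->
         `|(F x - h x) - (F y - h y)| <= eta * `|x - y|) ->
      forall j, (forall x y, `|x - p j| < rr j -> `|y - p j| < rr j ->
          `|F x - F y| <= lam * (rr j.+1 / rr j) * `|x - y|) /\
        (forall x, `|x - p j| < rr j -> `|F x - p j.+1| <= lam * rr j.+1).
Proof.
move=> alpha0 hI [p0 pA]; have [p0I _] := pA.
have [N [N0 pN m1]] := attracting_multiplier pA.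
pose p j := iter j h p0; pose m j := `|2 * p j|.
have p_per j : p (j + N)%N = p j by rewrite /p iterD pN.
have p_in j : l + alpha <= p j <= r - alpha.
  rewrite -p_per /p -(prednK N0) addnS iterS; apply: (hI).
  elim: (j + N.-1)%N => [|k IH]; first by rewrite in_itv.
  by rewrite iterS; have := hI _ IH; rewrite in_itv/= => /andP[? ?]; apply/andP; split; lra.
have [sigma s0 rho1] := prod_perturb (m := m) m1.
set rho := \prod_(0 <= j < N) (m j + sigma) in rho1.
have tau0 j : 0 < m j + sigma by rewrite ltr_wpDl// /m normr_ge0.
have rho0 : 0 < rho by apply: prodr_gt0.
have N_gt0 : (0 : R) < N%:R by rewrite ltr0n.
pose q := expR (- ln rho / N%:R).
have q1 : 1 < q.
  rewrite /q -[X in X < _]expR0 ltr_expR; apply: divr_gt0 => //.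
  by rewrite oppr_gt0; apply: ln_lt0; rewrite rho0 rho1.
have q0 : 0 < q by exact: expR_gt0.
have qN : q ^+ N * rho = 1.
  rewrite /q -expRM_natl mulrCA divff ?gt_eqF// mulr1 expRN lnK ?posrE//.
  by rewrite mulVf// gt_eqF.
pose w j := \prod_(0 <= i < j) (q * (m i + sigma)).
have wS j : w j.+1 = w j * (q * (m j + sigma)) by rewrite /w big_nat_recr.
have w0 j : 0 < w j by apply: prodr_gt0 => i _; rewrite mulr_gt0.
have w_per j : w (j + N)%N = w j.
  elim: j => [|j IH].
    have -> : w 0%N = 1 by rewrite /w big_geq.
    by rewrite add0n -qN /w big_split/= prodr_const_nat subn0.
  by rewrite addSn !wS IH /m p_per.
have [c0 [c1 [c00 cw]]] := periodic_bounds N0 w_per w0.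
have c10 : 0 < c1 by have /andP[h1 h2] := cw 0%N; lra.
pose s := Num.min (alpha / c1) (sigma / (4 * c1)).
have s_gt0 : 0 < s by rewrite lt_min !divr_gt0// mulr_gt0.
have sw j : s * w j <= alpha /\ s * w j <= sigma / 4.
  have /andP[_ wc] := cw j; split.
    apply: (@le_trans _ _ (alpha / c1 * c1)); last by rewrite divfK ?gt_eqF.
    by rewrite ler_pM ?(ltW s_gt0) ?(ltW (w0 j))// /s ge_min lexx.
  apply: (@le_trans _ _ (sigma / (4 * c1) * c1)).
    by rewrite ler_pM ?(ltW s_gt0) ?(ltW (w0 j))// /s ge_min lexx orbT.
  by rewrite le_eqVlt; apply/orP; left; apply/eqP; field; rewrite gt_eqF.
pose eta := Num.min (sigma / 2) (sigma / 2 * (s * c0)).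
have eta0 : 0 < eta by rewrite lt_min divr_gt0//= mulr_gt0 ?divr_gt0// mulr_gt0.
exists eta, q^-1, N, p, (fun j => s * w j); split.
  split => //.
  - by rewrite invr_gt0 q0 invf_lt1.
  - by move=> j; rewrite p_per w_per.
  - move=> j; have [h1 _] := sw j; have /andP[h2 h3] := p_in j.
    by split; [rewrite mulr_gt0|lra|lra].
move=> F Fh FL j; have [sw1 sw2] := sw j; have /andP[pl pr] := p_in j.
set rj := s * w j in sw1 sw2 *.
have rj0 : 0 < rj by rewrite mulr_gt0.
have rjS : s * w j.+1 = q * ((m j + sigma) * rj) by rewrite wS /rj; ring.
have in_lr x : `|x - p j| < rj -> x \in `[l, r].
  by rewrite ltr_norml in_itv/= => /andP[? ?]; apply/andP; split; lra.
have eta_s : eta <= sigma / 2 by rewrite /eta ge_min lexx.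
have eta_r : eta <= sigma / 2 * rj.
  apply: (@le_trans _ _ (sigma / 2 * (s * c0))); first by rewrite /eta ge_min lexx orbT.
  by rewrite ler_wpM2l ?divr_ge0 ?(ltW s0)// ler_wpM2l ?(ltW s_gt0)//; have /andP[] := cw j.
have sum_le x y : `|x - p j| < rj -> `|y - p j| <= rj -> `|x + y| <= m j + sigma / 2.
  rewrite /m => hx hy; have -> : x + y = 2 * p j + ((x - p j) + (y - p j)) by ring.
  apply: le_trans (ler_normD _ _) _; rewrite lerD2l.
  by apply: le_trans (ler_normD _ _) _; lra.
have pp : `|p j - p j| <= rj by rewrite subrr normr0 ltW.
split=> [x y hx hy|x hx].
  have -> : F x - F y = ((F x - h x) - (F y - h y)) + (h x - h y) by ring.
  apply: le_trans (ler_normD _ _) _; rewrite quadratic_secant normrN normrM.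
  have h1 := FL x y (in_lr x hx) (in_lr y hy); have h2 := sum_le x y hx (ltW hy).
  have -> : q^-1 * (s * w j.+1 / rj) = m j + sigma by rewrite rjS; field; rewrite !gt_eqF.
  have : `|x + y| * `|x - y| <= (m j + sigma / 2) * `|x - y| by rewrite ler_wpM2r.
  have : eta * `|x - y| <= sigma / 2 * `|x - y| by rewrite ler_wpM2r.
  by rewrite !mulrDl; move: h1; lra.
have -> : F x - p j.+1 = (F x - h x) + (h x - h (p j)) by rewrite /p iterS; ring.
apply: le_trans (ler_normD _ _) _; rewrite quadratic_secant normrN normrM.
have h1 := Fh x (in_lr x hx); have h2 := sum_le x (p j) hx pp.
have -> : q^-1 * (s * w j.+1) = (m j + sigma) * rj by rewrite rjS mulKf// gt_eqF.
have : `|x + p j| * `|x - p j| <= (m j + sigma / 2) * rj by rewrite ler_pM// ltW.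
by rewrite !mulrDl; move: h1; lra.
Qed.

End QuadraticCycle.

(** * Skew-products close to a quadratic map *)

(** The constant eta depends only on h and the interval: neither the base map nor the Lipschitz constant
    M of the fibre maps in the base direction has to be small. *)
Theorem near_quadratic_SRB (R : realType) (a0 l r alpha : R) :
  l < r -> 0 < alpha ->
  (forall x, x \in `[l, r] -> l + alpha <= a0 - x ^+ 2 <= r - alpha) ->
  hyperbolic_endo l r (fun x : R => a0 - x ^+ 2) ->
  exists2 eta : R, 0 < eta &
  forall (d : nat) (a b : 'I_d -> R) (G dG : 'I_d -> R -> R) (K : R) (g : R -> R)
    (f : R * R -> R) (M : R),
  markov_map a b G dG K g -> 0 <= M ->
  (forall t x, t \in `]0, 1] -> x \in `[l, r] -> f (t, x) \in `[l, r]) ->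
  (forall t x, t \in `]0, 1] -> x \in `[l, r] -> `|f (t, x) - (a0 - x ^+ 2)| <= eta) ->
  (forall t x y, t \in `]0, 1] -> x \in `[l, r] -> y \in `[l, r] ->
     `|(f (t, x) - (a0 - x ^+ 2)) - (f (t, y) - (a0 - y ^+ 2))| <= eta * `|x - y|) ->
  (forall i t t' x, t \in `]a i, b i] -> t' \in `]a i, b i] -> x \in `[l, r] ->
     `|f (t, x) - f (t', x)| <= M * `|t - t'|) ->
  (forall i t x, t \in `]a i, b i[ -> x \in `]l, r[ -> differentiable f (t, x)) ->
  has_hyperbolic_SRB l r (skew_product g f).
Proof.
move=> lr alpha0 hI hyp.
have [eta [lam [N [p [rr [[eta0 lam01 N0 per J] trap]]]]]] :=
  trapping_cycle alpha0 hI (attracting_point_exists lr hyp).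
exists eta => // d a b G dG K g f M HB M0 f_in f_h f_lip f_theta f_diff.
apply: (@contracting_skew_SRB R d a b G dG K g f l r M (2 * (`|l| + `|r|) + eta) lam N p rr) => //.
(* Secants of h on [l, r] have slope x + y, at most 2 (|l| + |r|) in modulus. *)
have abs_le x : x \in `[l, r] -> `|x| <= `|l| + `|r|.
  rewrite in_itv/= ler_norml => /andP[lx xr].
  have := ler_norm r; have := ler_norm (- l); rewrite normrN => h1 h2.
  by have := normr_ge0 l; have := normr_ge0 r => h3 h4; apply/andP; split; lra.
split => //.
- by rewrite addr_ge0 ?(ltW eta0)// mulr_ge0// addr_ge0.
- move=> t x y t01 xI yI.
  have -> : f (t, x) - f (t, y) = ((f (t, x) - (a0 - x ^+ 2)) - (f (t, y) - (a0 - y ^+ 2)))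
     + - ((x + y) * (x - y)) by ring.
  apply: le_trans (ler_normD _ _) _; rewrite normrN normrM mulrDl addrC.
  rewrite lerD ?f_lip// ler_wpM2r//.
  apply: le_trans (ler_normD _ _) _.
  by have := abs_le x xI; have := abs_le y yI; lra.
- by move=> j; have [] := per j.
- by move=> j; have [] := per j.
- by move=> j; have [] := J j.
- by move=> j; have [] := J j.
- move=> j t x y t01.
  by have [h _] := trap (fun x => f (t, x)) (f_h t ^~ t01) (fun x y => @f_lip t x y t01) j; exact: h.
- move=> j t x t01.
  by have [_ h] := trap (fun x => f (t, x)) (f_h t ^~ t01) (fun x y => @f_lip t x y t01) j; exact: h.
Qed.

(** * Branches of Markov expanding maps *)

Lemma Ck_open_derive (R : realType) (U : set R) (G : R -> R) : Ck_open 3 U G ->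
  forall t, U t -> [/\ is_derive t 1 G (derive1 G t),
    {for t, continuous (derive1 G)} &
    is_derive t 1 (derive1 G) (derive1n 2 G t)].
Proof.
move=> [oU cG dG] t Ut.
have E1 : Defs.iterD G [:: 1] = derive1 G by apply/funext => x; rewrite derive1E.
have E2 : 'D_1 (derive1 G) t = derive1n 2 G t by rewrite derive1nS derive1E; congr ('D_1 _ t); rewrite derive1n1.
split.
- by rewrite derive1E; apply: derivableP; exact: (dG [::] 1 t).
- by rewrite -E1; exact: (cG [:: 1] t).
- by rewrite -E2 -E1; apply: derivableP; exact: (dG [:: 1] 1 t).
Qed.

Section MarkovBranch.
Context {R : realType}.
Variables (a b D K : R) (g : R -> R) (U : set R) (G : R -> R).
Hypothesis ab : a < b.
Hypothesis bij : set_bij `]a, b] `]0, 1] g.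
Hypothesis CG : Ck_open 3 U G.
Hypothesis abU : `[a, b] `<=` U.
Hypothesis Gg : forall t, t \in `]a, b] -> G t = g t.
Hypothesis D16 : 16%:R <= D.
Hypothesis GD : forall t, t \in `]a, b] -> D <= `|derive1 G t|.
Hypothesis GK : forall t, t \in `]a, b] -> `|derive1n 2 G t| <= K * `|derive1 G t| ^+ 2.
Implicit Types (s t x : R).

Let derG t : t \in `[a, b] -> is_derive t 1 G (derive1 G t).
Proof. by move=> /abU /(Ck_open_derive CG)[]. Qed.

Let contdG t : t \in `[a, b] -> {for t, continuous (derive1 G)}.
Proof. by move=> /abU /(Ck_open_derive CG)[]. Qed.

Let contG t : t \in `[a, b] -> {for t, continuous G}.
Proof. by move=> tI; apply/differentiable_continuous/derivable1_diffP; have [] := derG tI. Qed.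

Let near_a (P : R -> Prop) : (forall t, t \in `]a, b] -> P t) -> \forall t \near a^'+, P t.
Proof.
move=> h; near=> t; apply: h; rewrite in_itv/=; apply/andP; split.
  by near: t; exact: nbhs_right_gt.
by near: t; exact: nbhs_right_le.
Unshelve. all: by end_near. Qed.

Let ain : a \in `[a, b]. Proof. by rewrite in_itv/= lexx ltW. Qed.
Let bin : b \in `[a, b]. Proof. by rewrite in_itv/= lexx ltW. Qed.

Let g01 t : t \in `]a, b] -> 0 < G t <= 1.
Proof. by move=> tI; rewrite Gg//; have [h _ _] := bij; have := h t tI; rewrite /= in_itv. Qed.

Let g_surj y : y \in `]0, 1] -> exists2 t, t \in `]a, b] & G t = y.
Proof.
move=> yI; have [_ _ h] := bij; have [t tI E] := h y yI.
by exists t => //; rewrite Gg.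
Qed.

Let slope16 t : t \in `[a, b] -> 16%:R <= `|derive1 G t|.
Proof.
move=> tI; apply: (le_trans D16); move: (tI); rewrite in_itv/= => /andP[].
rewrite le_eqVlt => /predU1P[<- _|at_ tb]; last by apply: GD; rewrite in_itv/= at_ tb.
apply: (cvgr_to_ge (cvg_norm (cvg_at_right_filter (contdG ain)))).
exact: near_a.
Qed.

Let sub_in u v x : u \in `[a, b] -> v \in `[a, b] -> x \in `[u, v] -> x \in `[a, b].
Proof.
rewrite !in_itv/= => /andP[? ?] /andP[? ?] /andP[? ?]; apply/andP; split; lra.
Qed.

Let same_sign u v : u \in `[a, b] -> v \in `[a, b] -> u <= v ->
  (derive1 G u < 0 -> derive1 G v < 0) /\ (derive1 G v < 0 -> derive1 G u < 0).
Proof.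
move=> uI vI uv.
have cont : {within `[u, v], continuous (derive1 G)}.
  apply: continuous_in_subspaceT => x /set_mem xI; apply: contdG.
  exact: (sub_in uI vI).
have no_zero c : c \in `[u, v] -> derive1 G c = 0 -> False.
  move=> cI c0; have := slope16 (sub_in uI vI cI); rewrite c0 normr0.
  by rewrite lern0.
split=> neg; rewrite ltNge; apply/negP => pos.
  have [c cI c0] : exists2 c, c \in `[u, v] & derive1 G c = 0.
    by apply: (IVT uv cont); rewrite ge_min le_max (ltW neg) pos ?orbT.
  exact: (no_zero c cI c0).
have [c cI c0] : exists2 c, c \in `[u, v] & derive1 G c = 0.
  by apply: (IVT uv cont); rewrite ge_min le_max (ltW neg) pos ?orbT.
exact: (no_zero c cI c0).
Qed.

(** The slope has constant sign; a decreasing branch on ]a, b] would not attain the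
    value 1, its supremum being approached only at the end a which is not in the piece. *)
Let slope_pos t : t \in `[a, b] -> 0 < derive1 G t.
Proof.
move=> tI; rewrite ltNge le_eqVlt; apply/negP => /predU1P[t0|neg].
  by have := slope16 tI; rewrite t0 normr0 lern0.
have all_neg x : x \in `[a, b] -> derive1 G x < 0.
  move=> xI; case: (leP x t) => [xt|/ltW tx].
    by have [_] := same_sign xI tI xt; exact.
  by have [h _] := same_sign tI xI tx; exact: h.
have [|t1 t1I E1] := @g_surj 1; first by rewrite in_itv/= ltr01 lexx.
move: (t1I); rewrite in_itv/= => /andP[at1 t1b].
pose u := (a + t1) / 2.
have ut1 : u < t1 by rewrite /u; lra.
have au : a < u by rewrite /u; lra.
have uI : u \in `]a, b] by rewrite in_itv/= au (le_trans (ltW ut1)).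
have dI x : x \in `[u, t1] -> is_derive x 1 G (derive1 G x).
  by move=> xI; apply: derG; apply: sub_in xI; exact: subset_itv_oc_cc.
have [c cI E] := mvt_segment ut1 dI.
have cI' : c \in `[a, b].
  by apply: (@sub_in u t1); [exact: subset_itv_oc_cc|exact: subset_itv_oc_cc|exact: subset_itv_oo_cc].
have : derive1 G c * (t1 - u) < 0 by rewrite nmulr_rlt0 ?all_neg// subr_gt0.
by rewrite -E E1; have /andP[_ h] := g01 uI; lra.
Qed.

Let G_lt u v : u \in `[a, b] -> v \in `[a, b] -> u < v -> G u < G v.
Proof.
move=> uI vI uv; have dI x : x \in `[u, v] -> is_derive x 1 G (derive1 G x).
  by move=> xI; apply: derG; exact: sub_in xI.
have [c cI E] := mvt_segment uv dI.
rewrite -subr_gt0 E mulr_gt0 ?subr_gt0// slope_pos//.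
by apply: (sub_in uI vI); exact: subset_itv_oo_cc.
Qed.

(** The bound on G'' makes ln G' Lipschitz with constant K as a function of the image
    point G t. *)
Let log_slope u v : u \in `[a, b] -> v \in `[a, b] -> u < v ->
  `|ln (derive1 G v) - ln (derive1 G u)| <= K * (G v - G u).
Proof.
move=> uI vI uv.
have ddG x : x \in `[a, b] -> is_derive x 1 (derive1 G) (derive1n 2 G x).
  by move=> /abU /(Ck_open_derive CG)[].
have der (e : R) x : x \in `[u, v] -> is_derive x 1 (fun y => e * ln (derive1 G y) - K * G y)
    (e * ((derive1 G x)^-1 * derive1n 2 G x) - K * derive1 G x).
  move=> xI; have xab := sub_in uI vI xI.
  have d1 := is_derive1_comp (is_derive1_ln (slope_pos xab)) (ddG x xab).
  exact: is_deriveB (is_deriveZ e d1) (is_deriveZ K (derG xab)).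
have le_e (e : R) : `|e| = 1 -> e * (ln (derive1 G v) - ln (derive1 G u)) <= K * (G v - G u).
  move=> e1; have [c cI E] := mvt_segment uv (der e).
  have cab : c \in `]a, b].
    by move: uI vI cI; rewrite !in_itv/= => /andP[? ?] /andP[? ?] /andP[? ?]; apply/andP; split; lra.
  have c0 := slope_pos (subset_itv_oc_cc cab).
  have h : e * ((derive1 G c)^-1 * derive1n 2 G c) <= K * derive1 G c.
    apply: le_trans (ler_norm _) _; rewrite normrM e1 mul1r normrM gtr0_norm ?invr_gt0//.
    by rewrite mulrC ler_pdivrMr// -mulrA -expr2 -{1}(gtr0_norm c0); exact: GK.
  have : (e * ((derive1 G c)^-1 * derive1n 2 G c) - K * derive1 G c) * (v - u) <= 0.
    by rewrite pmulr_lle0 ?subr_gt0// subr_le0.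
  rewrite -E => h0; rewrite -subr_le0; apply: le_trans h0.
  by rewrite le_eqVlt; apply/orP; left; apply/eqP; ring.
have := le_e 1; have := le_e (-1); rewrite normrN normr1 mul1r mulN1r => /(_ erefl) h1 /(_ erefl) h2.
by rewrite ler_norml lerNl h1.
Qed.

(** The distortion bound is [log_slope] after exponentiation. The values at the ends follow
    from surjectivity onto ]0, 1], the branch being increasing. *)
Lemma markov_branchP :
  [/\ forall t, t \in `[a, b] -> is_derive t 1 G (derive1 G t),
      forall t, t \in `[a, b] -> {for t, continuous (derive1 G)},
      forall t, t \in `[a, b] -> 16%:R <= derive1 G t,
      forall s t, s \in `[a, b] -> t \in `[a, b] ->
        derive1 G s <= expR (K * `|G s - G t|) * derive1 G t &
      G a = 0 /\ G b = 1].
Proof.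
have G_b : G b = 1.
  have [|t tI E] := @g_surj 1; first by rewrite in_itv/= ltr01 lexx.
  apply/eqP; rewrite eq_le; apply/andP; split.
    have bI : b \in `]a, b] by rewrite in_itv/= ab lexx.
    by have /andP[] := g01 bI.
  rewrite -E; move: (tI); rewrite in_itv/= => /andP[_].
  rewrite le_eqVlt => /predU1P[->//|tb]; apply: ltW; apply: G_lt => //.
  exact: subset_itv_oc_cc.
have G_a0 : 0 <= G a.
  apply: (cvgr_to_ge (cvg_at_right_filter (contG ain))); apply: near_a => t tI.
  by have /andP[/ltW] := g01 tI.
split => //.
- by move=> t tI; rewrite -(gtr0_norm (slope_pos tI)); exact: slope16.
- move=> s t sI tI; have [s0 t0] := (slope_pos sI, slope_pos tI).
  rewrite -ler_ln ?posrE ?mulr_gt0 ?expR_gt0// lnM ?posrE ?expR_gt0// expRK.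
  have [st|ts|->] := ltgtP s t; last by rewrite subrr normr0 mulr0 add0r.
    have h := log_slope sI tI st; rewrite distrC gtr0_norm ?subr_gt0 ?G_lt//.
    by rewrite -lerBlDr (le_trans (ler_norm _))// distrC.
  have h := log_slope tI sI ts; rewrite gtr0_norm ?subr_gt0 ?G_lt//.
  by rewrite -lerBlDr (le_trans (ler_norm _)).
- split => //; apply/eqP; rewrite eq_le G_a0 andbT leNgt; apply/negP => Ga0.
  have [|t tI E] := @g_surj (G a).
    by rewrite in_itv/= Ga0 -G_b ltW// G_lt.
  have at_ : a < t by move: tI; rewrite in_itv/= => /andP[].
  by have := G_lt ain (subset_itv_oc_cc tI) at_; rewrite E ltxx.
Qed.

End MarkovBranch.

Lemma markov_expanding_map (R : realType) (d : nat) (a b : 'I_d -> R) (g : R -> R) :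
  markov_expanding a b g -> exists G dG K, markov_map a b G dG K g.
Proof.
move=> [[ab triv cover] [D [K [D16 K0 branch]]] _].
have branches : forall i, exists G : R -> R,
    [/\ forall t, t \in `[a i, b i] -> is_derive t 1 G (derive1 G t),
      forall t, t \in `[a i, b i] -> {for t, continuous (derive1 G)},
      forall t, t \in `[a i, b i] -> 16%:R <= derive1 G t,
      forall s t, s \in `[a i, b i] -> t \in `[a i, b i] ->
        derive1 G s <= expR (K * `|G s - G t|) * derive1 G t &
      [/\ G (a i) = 0, G (b i) = 1 & forall t, t \in `]a i, b i] -> g t = G t]].
  move=> i; have [bij [U [G [CG abU Gg GD GK]]]] := branch i.
  exists G; have [h1 h2 h3 h4 [h5 h6]] := markov_branchP (ab i) bij CG abU Gg D16 GD GK.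
  by split => //; split => // t ti; rewrite Gg.
have [G HG] := choice branches.
exists G, (fun i => derive1 (G i)), K; split => //.
- by move=> i t; have [h _ _ _ _] := HG i; exact: h.
- by move=> i t; have [_ h _ _ _] := HG i; exact: h.
- by move=> i t; have [_ _ h _ _] := HG i; exact: h.
- by move=> i s t; have [_ _ _ h _] := HG i; exact: h.
- by move=> i; have [_ _ _ _ [h _ _]] := HG i.
- by move=> i; have [_ _ _ _ [_ h _]] := HG i.
- by move=> i t; have [_ _ _ _ [_ _ h]] := HG i; exact: h.
Qed.

(** * Continuous partial derivatives *)

Lemma increment_bound (R : realType) (F dF : R -> R) (x y c e : R) :
  (forall s, `|s - x| <= `|y - x| -> is_derive s 1 F (dF s) /\ `|dF s - c| <= e) ->
  `|F y - F x - c * (y - x)| <= e * `|y - x|.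
Proof.
move=> h; have [xy|yx|->] := ltgtP x y; last by rewrite !subrr mulr0 subr0 normr0 mulr0.
- have dI s : s \in `[x, y] -> is_derive s 1 F (dF s).
    rewrite in_itv/= => /andP[s1 s2]; have [|//] := h s.
    by rewrite !ger0_norm ?subr_ge0 ?lerB// ltW.
  have [s sI ->] := mvt_segment xy dI.
  have [|_ hs] := h s.
    move: sI; rewrite in_itv/= => /andP[s1 s2].
    by rewrite !ger0_norm ?subr_ge0 ?lerB// ltW.
  by rewrite -mulrBl normrM ler_wpM2r.
- have dI s : s \in `[y, x] -> is_derive s 1 F (dF s).
    rewrite in_itv/= => /andP[s1 s2]; have [|//] := h s.
    by rewrite !ler0_norm ?subr_le0 ?lerN2 ?lerB// ltW.
  have [s sI E] := mvt_segment yx dI.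
  have [|_ hs] := h s.
    move: sI; rewrite in_itv/= => /andP[s1 s2].
    by rewrite !ler0_norm ?subr_le0 ?lerN2 ?lerB// ltW.
  have -> : F y - F x - c * (y - x) = - ((dF s - c) * (x - y)) by rewrite mulrBl -E; ring.
  by rewrite normrN normrM (distrC y) ler_wpM2r.
Qed.

Lemma grid_increment (R : realType) (F d1 d2 : R -> R -> R) (x y u v c1 c2 e : R) :
  (forall s t, `|s - x| <= `|u| -> `|t - y| <= `|v| ->
     [/\ is_derive s 1 (fun s => F s t) (d1 s t), is_derive t 1 (F s) (d2 s t),
        `|d1 s t - c1| <= e & `|d2 s t - c2| <= e]) ->
  `|F (x + u) (y + v) - F x y - (c1 * u + c2 * v)| <= e * (`|u| + `|v|).
Proof.
move=> h; have xu : x + u - x = u by ring.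
have yv : y + v - y = v by ring.
have I1 : `|F (x + u) (y + v) - F x (y + v) - c1 * u| <= e * `|u|.
  rewrite -{2 3}xu; apply: (@increment_bound _ (fun s => F s (y + v)) (d1 ^~ (y + v))) => s.
  by rewrite xu => hs; have [] := h s (y + v) hs _; rewrite ?yv.
have I2 : `|F x (y + v) - F x y - c2 * v| <= e * `|v|.
  rewrite -{2 3}yv; apply: (@increment_bound _ (F x) (d2 x)) => t.
  by rewrite yv => ht; have [] := h x t _ ht; rewrite ?subrr ?normr0.
have -> : F (x + u) (y + v) - F x y - (c1 * u + c2 * v) =
    (F (x + u) (y + v) - F x (y + v) - c1 * u) + (F x (y + v) - F x y - c2 * v) by ring.
by apply: le_trans (ler_normD _ _) _; rewrite mulrDr lerD.
Qed.

Section PartialDerivatives.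
Context {R : realType}.
Implicit Types (F : R * R -> R) (z v : R * R) (s t x y : R).

Lemma partial1_is_derive F x y : derivable F (x, y) (1, 0) ->
  is_derive x 1 (fun s => F (s, y)) ('D_((1, 0) : R * R) F (x, y)).
Proof.
have E : (fun h : R => h^-1 *: (((fun s => F (s, y)) \o shift x) (h *: 1) - F (x, y))) =
    (fun h : R => h^-1 *: ((F \o shift (x, y)) (h *: ((1, 0) : R * R)) - F (x, y))).
  apply/funext => h; congr (_ *: (F _ - _)).
  by rewrite -[RHS]/(h *: 1 + x, h * 0 + y) mulr0 add0r.
move=> dF; split; first by rewrite /derivable E.
by rewrite /derive E.
Qed.

Lemma partial2_is_derive F x y : derivable F (x, y) (0, 1) ->
  is_derive y 1 (fun s => F (x, s)) ('D_((0, 1) : R * R) F (x, y)).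
Proof.
have E : (fun h : R => h^-1 *: (((fun s => F (x, s)) \o shift y) (h *: 1) - F (x, y))) =
    (fun h : R => h^-1 *: ((F \o shift (x, y)) (h *: ((0, 1) : R * R)) - F (x, y))).
  apply/funext => h; congr (_ *: (F _ - _)).
  by rewrite -[RHS]/(h * 0 + x, h *: 1 + y) mulr0 add0r.
move=> dF; split; first by rewrite /derivable E.
by rewrite /derive E.
Qed.

Variables c1 c2 : R.
Definition plane_form z : R := z.1 * c1 + z.2 * c2.
Lemma plane_form_linear : linear plane_form.
Proof.
move=> k z v; rewrite /plane_form -[(k *: z + v).1]/(k * z.1 + v.1).
by rewrite -[(k *: z + v).2]/(k * z.2 + v.2) -[k *: _]/(k * _); ring.
Qed.
HB.instance Definition _ := GRing.isLinear.Build R (R * R)%type R *:%R plane_form plane_form_linear.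

Lemma plane_form_continuous : continuous plane_form.
Proof.
move=> z; apply: cvgD; apply: cvgMl; [exact: cvg_fst|exact: cvg_snd].
Qed.

End PartialDerivatives.

Lemma near_dist (R : realType) (V : topologicalType) (u : V -> R) (z : V) (e : R) :
  {for z, continuous u} -> 0 < e -> \forall z' \near z, `|u z' - u z| <= e.
Proof. by move/cvgrPdistC_le => h e0; exact: h. Qed.

(** Go from z to a nearby point along one coordinate and then along the other, and
    apply the mean value inequality on each segment. *)
Lemma C1_differentiable (R : realType) (U : set (R * R)) (F d1 d2 : R * R -> R) (z : R * R) :
  open U -> U z ->
  (forall s t, U (s, t) -> is_derive s 1 (fun s => F (s, t)) (d1 (s, t)) /\
     is_derive t 1 (fun t => F (s, t)) (d2 (s, t))) ->
  {for z, continuous d1} -> {for z, continuous d2} ->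
  differentiable F z.
Proof.
move=> oU Uz dF cont1 cont2.
have Fo : F \o shift z = cst (F z) + plane_form (d1 z) (d2 z) +o_ (0 : R * R) id.
  apply/eqaddoP => e e0; have e2 : 0 < e / 2 by rewrite divr_gt0.
  have n0 : \forall z' \near z, U z' by exact: open_nbhs_nbhs.
  have n1 := near_dist cont1 e2; have n2 := near_dist cont2 e2.
  have n012 : \forall z' \near z, U z' /\ (`|d1 z' - d1 z| <= e / 2 /\ `|d2 z' - d2 z| <= e / 2).
    by apply: filterI => //; apply: filterI.
  move: n012 => /nbhs_ballP[r1 r10 H1].
  have near_r1 : \forall h \near (0 : R * R), ball (0 : R * R) r1 h by exact: nbhsx_ballx.
  apply: filterS near_r1 => -[u v] [hu' hv'].
  have hu : `|u| < r1 by move: hu'; rewrite /ball /= sub0r normrN.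
  have hv : `|v| < r1 by move: hv'; rewrite /ball /= sub0r normrN.
  clear n0 n1 n2 hu' hv' cont1 cont2 Uz.
  case: z H1 => x y H1.
  have grid (s t : R) : `|s - x| <= `|u| -> `|t - y| <= `|v| ->
     [/\ is_derive s 1 (fun s => F (s, t)) (d1 (s, t)), is_derive t 1 (fun t => F (s, t)) (d2 (s, t)),
        `|d1 (s, t) - d1 (x, y)| <= e / 2 & `|d2 (s, t) - d2 (x, y)| <= e / 2].
    move=> hs ht; have b : ball (x, y) r1 (s, t).
      by split; rewrite /ball /= distrC; [exact: le_lt_trans hs hu|exact: le_lt_trans ht hv].
    by have [Us [h1 h2]] := H1 _ b; have [dF1 dF2] := dF _ _ Us.
  have I := @grid_increment _ (fun s t => F (s, t)) (fun s t => d1 (s, t)) (fun s t => d2 (s, t)) _ _ _ _ _ _ _ grid.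
  rewrite -[_ (u, v)]/(F (u + x, v + y) - (F (x, y) + (u * d1 (x, y) + v * d2 (x, y)))).
  have nu : `|u| <= `|(u, v)| by rewrite prod_normE le_max lexx.
  have nv : `|v| <= `|(u, v)| by rewrite prod_normE le_max lexx orbT.
  rewrite (addrC u) (addrC v) opprD addrA (mulrC u) (mulrC v).
  apply: le_trans I _; rewrite -[id (u, v)]/(u, v).
  have : e / 2 * (`|u| + `|v|) <= e / 2 * (`|(u, v)| + `|(u, v)|) by rewrite ler_wpM2l ?(ltW e2)// lerD.
  by lra.
have E := diff_unique (@plane_form_continuous R (d1 z) (d2 z)) Fo.
apply/diff_locallyP; rewrite E; split => //.
exact: plane_form_continuous.
Qed.

(** * Perturbed fibre maps *)

Lemma Ck_on_differentiable (R : realType) (k : nat) (A : set (R * R)) (f : R * R -> R) (z : R * R) :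
  Ck_on k.+1 A f -> open A -> A z -> differentiable f z.
Proof.
move=> [U [F [[oU cF dF] AU Ff]]] oA Az.
have near_f y : A y -> \forall y' \near y, F y' = f y'.
  move=> Ay; have : \forall y' \near y, A y' by exact: open_nbhs_nbhs.
  by apply: filterS => y'; exact: Ff.
have contF (v : R * R) : {for z, continuous ('D_v F)}.
  by apply: (cF [:: v]) => //; exact: AU.
have derF (v : R * R) y : A y -> derivable F y v.
  by move=> Ay; apply: (dF [::]) => //; exact: AU.
have derA (v : R * R) y : A y -> derivable f y v /\ 'D_v f y = 'D_v F y.
  move=> Ay; split.
    by exact: near_eq_derivable (near_f y Ay) (derF v y Ay).
  by apply/esym; apply: near_eq_derive => //; exact: near_f.
apply: (@C1_differentiable R A f ('D_((1, 0) : R * R) F) ('D_((0, 1) : R * R) F) z oA Az).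
- move=> s t st; have [d1 E1] := derA (1, 0) _ st; have [d2 E2] := derA (0, 1) _ st.
  by have D1 := partial1_is_derive d1; have D2 := partial2_is_derive d2; rewrite -E1 -E2.
- exact: contF.
- exact: contF.
Qed.

Lemma Ck_norm_bound (R : realType) (V : normedModType R) (k : nat) (A : set V) (F : V -> R) (e : R) vs x :
  (Ck_norm k A F < e%:E)%E -> (size vs <= k)%N -> all (fun v => `|v| <= 1) vs -> A x ->
  `|Defs.iterD F vs x| <= e.
Proof.
move=> h sz nv Ax; rewrite -lee_fin; apply: le_trans (ltW h).
by apply: ereal_sup_ubound; exists vs, x.
Qed.

(** Closeness is stated on open pieces; by continuity from the left it reaches the right
    end of the piece. *)
Lemma endpoint_le (R : realType) (u v : R -> R) (a b : R) :
  u @ b^'- --> u b -> v @ b^'- --> v b ->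
  (forall s, s \in `]a, b[ -> u s <= v s) -> forall s, s \in `]a, b] -> u s <= v s.
Proof.
move=> cu cv h s; rewrite in_itv/= => /andP[as_]; rewrite le_eqVlt => /predU1P[sb|sb]; last first.
  by apply: h; rewrite in_itv/= as_.
have ab : a < b by rewrite -sb.
rewrite sb; apply: ler_cvg_to cu cv _.
near=> y; apply: h; rewrite in_itv/=; apply/andP; split; last by near: y; exact: nbhs_left_lt.
by near: y; exact: nbhs_left_gt.
Unshelve. all: by end_near. Qed.

Section PerturbedBranch.
Context {R : realType}.
Variables (f f' : R * R -> R) (a b a' b' eps : R).
Hypotheses (ab : a < b) (ab' : a' < b').
Hypothesis f_diff : forall z, differentiable f z.
Hypothesis Cf' : Ck_on 3 (`]a', b']%classic `*` setT) f'.
Hypothesis close : (Ck_norm 3 (`]a, b[%classic `*` [set: R])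
  (fun z : R * R => (f z - f' (affine_piece a b a' b' z.1, z.2))%R) < eps%:E)%E.
Implicit Types (s t x y : R) (z : R * R).

Let E z := f z - f' (affine_piece a b a' b' z.1, z.2).
Let slope := (b' - a') / (b - a).
Let slope0 : 0 < slope. Proof. by rewrite divr_gt0 ?subr_gt0. Qed.
Let pull s := a + (s - a') / slope.

Let pullK s : affine_piece a b a' b' (pull s) = s.
Proof.
rewrite /affine_piece /pull -/slope.
by rewrite [a + _]addrC addrK mulrCA divff ?gt_eqF// mulr1; ring.
Qed.

Let pull_in s : s \in `]a', b'[ -> pull s \in `]a, b[.
Proof.
rewrite !in_itv/= /pull => /andP[h1 h2]; apply/andP; split.
  by rewrite ltrDl divr_gt0 ?subr_gt0.
rewrite -ltrBrDl ltr_pdivrMr// /slope mulrCA divff ?mulr1 ?ltrD2r//.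
by rewrite subr_eq0 gt_eqF.
Qed.

Let E_pull s x : f' (s, x) = f (pull s, x) - E (pull s, x).
Proof. by rewrite /E /= pullK; ring. Qed.

Lemma perturbed_branch_diff s x : s \in `]a', b'[ -> differentiable f' (s, x).
Proof.
move=> sI.
have [U [F [CF AU Ff]]] := Cf'.
apply: (@Ck_on_differentiable _ 2 (`]a', b'[%classic `*` setT)) => //.
  exists U, F; split => //.
    by move=> z [z1 _]; apply: AU; split => //; exact: subset_itv_oo_oc.
  by move=> z [z1 _]; apply: Ff; split => //; exact: subset_itv_oo_oc.
rewrite setXT; apply: open_comp; last exact: interval_open.
by move=> z _; exact: cvg_fst.
Qed.

Let E_diff t x : t \in `]a, b[ -> differentiable E (t, x).
Proof.
move=> tI.
have tI' : affine_piece a b a' b' t \in `]a', b'[.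
  move: tI; rewrite !in_itv/= /affine_piece -/slope => /andP[h1 h2]; apply/andP; split.
    by rewrite ltrDl mulr_gt0 ?subr_gt0.
  rewrite -ltrBrDl /slope mulrAC ltr_pdivrMr ?subr_gt0// ltr_pM2l ?subr_gt0//.
  by rewrite ltrD2r.
apply: differentiableB; first exact: f_diff.
apply: (@differentiable_comp _ _ _ _ (fun z => (affine_piece a b a' b' z.1, z.2)) f'); last exact: perturbed_branch_diff.
have [[fst_d _] [snd_d _]] := (fst_is_diff (t, x), snd_is_diff (t, x)).
apply: differentiable_pair; last exact: snd_d.
apply: differentiableD; first exact: differentiable_cst.
apply: differentiableM; first exact: differentiable_cst.
exact: differentiableB.
Qed.

Let E_le t x : t \in `]a, b[ -> `|E (t, x)| <= eps.
Proof. by move=> tI; apply: (Ck_norm_bound (vs := [::]) close). Qed.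

Let E_le1 t x : t \in `]a, b[ -> `|'D_((1, 0) : R * R) E (t, x)| <= eps.
Proof.
move=> tI; apply: (Ck_norm_bound (vs := [:: ((1, 0) : R * R)]) close) => //.
by rewrite /= prod_normE /= normr1 normr0 ge_max lexx ler01.
Qed.

Let E_le2 t x : t \in `]a, b[ -> `|'D_((0, 1) : R * R) E (t, x)| <= eps.
Proof.
move=> tI; apply: (Ck_norm_bound (vs := [:: ((0, 1) : R * R)]) close) => //.
by rewrite /= prod_normE /= normr1 normr0 ge_max lexx ler01.
Qed.

Let E_lip2 t x y : t \in `]a, b[ -> `|E (t, x) - E (t, y)| <= eps * `|x - y|.
Proof.
move=> tI.
rewrite (_ : E (t, x) - E (t, y) = E (t, x) - E (t, y) - 0 * (x - y)); last by ring.
apply: (@increment_bound _ (fun x => E (t, x)) (fun x => 'D_((0, 1) : R * R) E (t, x))) => s _.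
rewrite subr0; split; last exact: E_le2.
by apply: partial2_is_derive; apply: diff_derivable; exact: E_diff.
Qed.

Let E_lip1 t t' x : t \in `]a, b[ -> t' \in `]a, b[ ->
  `|E (t, x) - E (t', x)| <= eps * `|t - t'|.
Proof.
wlog tt : t t' / t' < t.
  move=> W tI t'I; have [h|h|->] := ltgtP t t'; [|exact: W|by rewrite !subrr normr0 mulr0].
  by rewrite distrC (distrC t); exact: W.
move=> tI t'I.
have dI s : s \in `[t', t] -> is_derive s 1 (fun s => E (s, x)) ('D_((1, 0) : R * R) E (s, x)).
  move=> sI; apply: partial1_is_derive; apply: diff_derivable; apply: E_diff.
  by move: tI t'I sI; rewrite !in_itv/= => /andP[? ?] /andP[? ?] /andP[? ?]; apply/andP; split; lra.
have [s sI ->] := mvt_segment tt dI.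
rewrite normrM ler_wpM2r// E_le1//.
by move: tI t'I sI; rewrite !in_itv/= => /andP[? ?] /andP[? ?] /andP[? ?]; apply/andP; split; lra.
Qed.

Let f'_left x : (fun s => f' (s, x)) @ b'^'- --> f' (b', x).
Proof.
have [U [F [[oU cF _] AU Ff]]] := Cf'.
have bI : (`]a', b']%classic `*` setT) (b', x) by split => //=; rewrite in_itv/= ab' lexx.
rewrite -Ff//.
have c : (fun s => F (s, x)) @ b'^'- --> F (b', x).
  apply: cvg_at_left_filter.
  apply: (@continuous_comp _ _ _ (fun s : R => (s, x)) F); last exact: (cF [::] _ isT (AU _ bI)).
  by apply: (@cvg_pair _ _ _ _ (nbhs b') (nbhs x)); [exact: cvg_id|exact: cvg_cst].
apply: cvg_trans c; apply: near_eq_cvg.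
near=> s; apply: Ff; split => //=; rewrite in_itv/=; apply/andP; split.
  by near: s; exact: nbhs_left_gt.
by apply: ltW; near: s; exact: nbhs_left_lt.
Unshelve. all: by end_near. Qed.

(** On a piece the perturbed fibre map is f minus the error E, both read at the pulled-back
    base point; E is bounded by eps together with its first derivatives. *)
Lemma perturbed_branch_C0 (h : R -> R) (c : R) x : (forall t, `|f (t, x) - h x| <= c) ->
  forall s, s \in `]a', b'] -> `|f' (s, x) - h x| <= c + eps.
Proof.
move=> fh; apply: endpoint_le.
- by apply: cvg_norm; apply: cvgB; [exact: f'_left|exact: cvg_cst].
- exact: cvg_cst.
move=> s sI; rewrite E_pull.
rewrite (_ : _ - _ - _ = (f (pull s, x) - h x) + - E (pull s, x)); last by ring.
apply: le_trans (ler_normD _ _) _; rewrite normrN lerD ?fh// E_le//.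
exact: pull_in.
Qed.

Lemma perturbed_branch_fiber (h : R -> R) x y :
  (forall t, f (t, x) - h x = f (t, y) - h y) ->
  forall s, s \in `]a', b'] ->
    `|(f' (s, x) - h x) - (f' (s, y) - h y)| <= eps * `|x - y|.
Proof.
move=> fh; apply: endpoint_le.
- apply: cvg_norm; apply: cvgB; (apply: cvgB; [exact: f'_left|exact: cvg_cst]).
- exact: cvg_cst.
move=> s sI; rewrite !E_pull.
have e := fh (pull s).
rewrite (_ : _ - (_ - _ - h y) = - (E (pull s, x) - E (pull s, y))).
  by rewrite normrN; apply: E_lip2; exact: pull_in.
have -> : f (pull s, x) = f (pull s, y) - h y + h x by rewrite -e subrK.
by ring.
Qed.

Lemma perturbed_branch_theta (M : R) x :
  (forall t t', `|f (t, x) - f (t', x)| <= M * `|t - t'|) ->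
  forall s s', s \in `]a', b'] -> s' \in `]a', b'] ->
    `|f' (s, x) - f' (s', x)| <= (M + eps) * ((b - a) / (b' - a')) * `|s - s'|.
Proof.
move=> fM; set C := _ * (_ / _).
have inner s s' : s \in `]a', b'[ -> s' \in `]a', b'[ ->
    `|f' (s, x) - f' (s', x)| <= C * `|s - s'|.
  move=> sI s'I; rewrite !E_pull.
  rewrite (_ : _ - (_ - _) = (f (pull s, x) - f (pull s', x)) - (E (pull s, x) - E (pull s', x))); last by ring.
  have -> : C * `|s - s'| = M * `|pull s - pull s'| + eps * `|pull s - pull s'|.
    rewrite -mulrDl /C -mulrA; congr (_ * _).
    have -> : pull s - pull s' = (s - s') / slope by rewrite /pull; field; rewrite gt_eqF.
    by rewrite normrM (gtr0_norm (x := slope^-1)) ?invr_gt0// /slope invf_div mulrC.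
  apply: le_trans (ler_normB _ _) _; rewrite lerD ?fM// E_lip1//; exact: pull_in.
(* The right end b' is reached in one argument at a time. *)
have half s : s \in `]a', b'] -> forall s', s' \in `]a', b'[ ->
    `|f' (s, x) - f' (s', x)| <= C * `|s - s'|.
  move=> sI s' s'I; move: s sI; apply: endpoint_le.
  - by apply: cvg_norm; apply: cvgB; [exact: f'_left|exact: cvg_cst].
  - apply: cvgM; first exact: cvg_cst.
    apply: cvg_norm; apply: cvgB; last exact: cvg_cst.
    by apply: cvg_at_left_filter; exact: cvg_id.
  - by move=> s sI; exact: inner.
move=> s s' sI; move: s'; apply: endpoint_le.
- by apply: cvg_norm; apply: cvgB; [exact: cvg_cst|exact: f'_left].
- apply: cvgM; first exact: cvg_cst.
  apply: cvg_norm; apply: cvgB; first exact: cvg_cst.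
  by apply: cvg_at_left_filter; exact: cvg_id.
- by move=> t; exact: half.
Qed.

End PerturbedBranch.

(** * The quadratic skew-product and its perturbations *)

Section QuadraticFiber.
Context {R : realType}.
Variables (a0 alpha : R).
Hypothesis alpha0 : 0 < alpha.
Implicit Types (t x : R).

Lemma quad_fiber_diff (z : R * R) : differentiable (quad_fiber a0 alpha) z.
Proof.
have [[fst_d _] [snd_d _]] := (fst_is_diff z, snd_is_diff z).
have -> : quad_fiber a0 alpha = (fun z => a0 + alpha * sin (2%:R * pi * z.1) - z.2 * z.2).
  by apply/funext => w; rewrite /quad_fiber expr2.
apply: differentiableB; last exact: differentiableM.
apply: differentiableD; first exact: differentiable_cst.
apply: differentiableM; first exact: differentiable_cst.
apply: (@differentiable_comp _ _ _ _ (fun z : R * R => 2%:R * pi * z.1) sin).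
  exact: differentiableM.
by apply/derivable1_diffP; exact: derivable_sin.
Qed.

Lemma quad_fiber_near t x : `|quad_fiber a0 alpha (t, x) - (a0 - x ^+ 2)| <= alpha.
Proof.
rewrite /quad_fiber /= (_ : _ - _ = alpha * sin (2%:R * pi * t)); last by ring.
rewrite normrM (gtr0_norm alpha0) -[leRHS]mulr1 ler_wpM2l ?(ltW alpha0)//.
by rewrite ler_norml sin_le1 sin_geN1.
Qed.

Lemma quad_fiber_theta t t' x :
  `|quad_fiber a0 alpha (t, x) - quad_fiber a0 alpha (t', x)| <= alpha * (2%:R * pi) * `|t - t'|.
Proof.
rewrite /quad_fiber /= (_ : _ - _ = alpha * (sin (2%:R * pi * t) - sin (2%:R * pi * t'))); last by ring.
rewrite normrM (gtr0_norm alpha0) -[leRHS]mulrA ler_wpM2l ?(ltW alpha0)//.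
have pi2 : 0 <= 2%:R * pi :> R by rewrite mulr_ge0// pi_ge0.
rewrite -[X in X * `|_|](ger0_norm pi2) -normrM mulrBr.
have sin_lip (u v : R) : `|sin u - sin v - 0 * (u - v)| <= 1 * `|u - v|.
  apply: (@increment_bound _ _ cos) => s _; split; first exact: is_derive_sin.
  by rewrite subr0 ler_norml cos_le1 cos_geN1.
by have := sin_lip (2%:R * pi * t) (2%:R * pi * t'); rewrite mul0r subr0 mul1r.
Qed.

End QuadraticFiber.

(** The slope is constant, so that any positive distortion constant will do. *)
Lemma times_mod1_map (R : realType) (d : nat) : (16 <= d)%N ->
  markov_map (fun i : 'I_d => i%:R / d%:R) (fun i : 'I_d => i.+1%:R / d%:R)
    (fun (i : 'I_d) t => d%:R * t - i%:R) (fun=> cst d%:R) 1 (@times_mod1 R d).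
Proof.
move=> d16; have d0 : 0 < d%:R :> R by rewrite ltr0n; lia.
have piece (i : 'I_d) (t : R) : t \in `](i%:R / d%:R), (i.+1%:R / d%:R)] -> Num.ceil (d%:R * t) = i.+1.
  rewrite in_itv/= ltr_pdivrMr// ler_pdivlMr// => h; apply: ceil_def.
  by rewrite -addn1 PoszD addrK -!pmulrn addn1 (mulrC _ t).
have d_neq0 : d%:R != 0 :> R by rewrite gt_eqF.
split => //.
- by move=> i; rewrite ltr_pM2r ?invr_gt0// ltr_nat.
- move=> i j _ _ [t [/= ti tj]]; apply: val_inj; apply: succn_inj.
  by have := piece i t ti; rewrite (piece j t tj) => /eqP; rewrite eqz_nat => /eqP.
- apply/seteqP; split => t /=.
    move=> [i _ /=]; rewrite !in_itv/= => /andP[h1 h2]; apply/andP; split.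
      by apply: le_lt_trans h1; rewrite divr_ge0// ltW.
    by apply: le_trans h2 _; rewrite ler_pdivrMr// mul1r ler_nat.
  rewrite in_itv/= => /andP[t0 t1].
  have := ceil_itv (d%:R * t : R); set m := Num.ceil _.
  have m0 : 0 < m by rewrite /m ceil_gt0 mulr_gt0.
  case: m m0 => [[//|n]|//] _; rewrite -addn1 PoszD addrK -!pmulrn addn1 => /andP[h1 h2].
  have nd : (n < d)%N.
    by rewrite -(ltr_nat R); apply: lt_le_trans h1 _; rewrite ler_piMr// ltW.
  by exists (Ordinal nd) => //=; rewrite in_itv/= ltr_pdivrMr// ler_pdivlMr// (mulrC t) h1.
- move=> i t _.
  have h1 := is_deriveZ (d%:R : R) (is_derive_id t (1 : R)).
  have h := is_deriveB h1 (is_derive_cst (i%:R : R) t (1 : R)).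
  by move: h; rewrite subr0 /GRing.scale /= mulr1.
- by move=> i t _; exact: cvg_cst.
- by move=> i t _; rewrite /cst ler_nat.
- move=> i s t _ _; rewrite /cst ler_peMl//.
  by rewrite mul1r -[leLHS]expR0 ler_expR.
- by move=> i; rewrite mulrC divfK// subrr.
- by move=> i; rewrite mulrC divfK// -addn1 natrD addrAC subrr add0r.
- by move=> i t ti; rewrite /times_mod1 (piece i t ti) -pmulrn -addn1 natrD; ring.
Qed.

Lemma cylinder_fiber_in (R : realType) (l r : R) (g : R -> R) (f : R * R -> R) :
  skew_product g f @` cylinder `[l, r] `<=` cylinder `[l, r] ->
  forall t x, t \in `]0, 1] -> x \in `[l, r] -> f (t, x) \in `[l, r].
Proof. by move=> h t x t01 xI; have [|] := h (skew_product g f (t, x)); first by exists (t, x). Qed.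

Theorem corollary1 (R : realType) (d : nat) (a0 l r : R)
  (hd : (16 <= d)%N) (ha0 : 0 < a0 <= 2%:R) (hlr : l < r)
  (hI : exists2 alpha1 : R, 0 < alpha1 & forall alpha : R,
     0 < alpha < alpha1 ->
     viana_map d a0 alpha @` cylinder `[l, r] `<=` cylinder `[l, r])
  (hh : hyperbolic_endo l r (fun x : R => a0 - x ^+ 2)) :
  exists2 alpha0 : R, 0 < alpha0 & forall alpha : R, 0 < alpha < alpha0 ->
    has_hyperbolic_SRB l r (viana_map d a0 alpha) /\
    exists2 eps : R, 0 < eps &
      forall (g' : R -> R) (f' : R * R -> R),
        C3_close l r
          (fun i : 'I_d => i%:R / d%:R) (fun i : 'I_d => i.+1%:R / d%:R)
          (times_mod1 d) (quad_fiber a0 alpha) eps g' f' ->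
        has_hyperbolic_SRB l r (skew_product g' f').
Proof.
have [alpha1 alpha1_gt0 hI1] := hI.
(* For alpha = alpha1 / 2 the fibre maps over 1/4 and 3/4 are h + alpha1 / 2 and
   h - alpha1 / 2; as both preserve [l, r], h leaves a margin alpha1 / 2. *)
have margin x : x \in `[l, r] -> l + alpha1 / 2 <= a0 - x ^+ 2 <= r - alpha1 / 2.
  move=> xI; have half : 0 < alpha1 / 2 < alpha1 by apply/andP; split; lra.
  have f_in := cylinder_fiber_in (hI1 _ half).
  have sin1 : sin (2%:R * pi * 4^-1) = 1 :> R.
    by rewrite -[RHS]sin_pihalf; congr sin; field.
  have sin3 : sin (2%:R * pi * (3 / 4)) = -1 :> R.
    have -> : 2%:R * pi * (3 / 4) = pi / 2 + pi :> R by field.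
    by rewrite sinDpi sin_pihalf.
  have := f_in 4^-1 x; have := f_in (3 / 4) x.
  have I1 : 4^-1 \in `]0, 1 : R] by rewrite in_itv/=; apply/andP; split; lra.
  have I3 : 3 / 4 \in `]0, 1 : R] by rewrite in_itv/=; apply/andP; split; lra.
  move=> /(_ I3 xI) + /(_ I1 xI); rewrite /quad_fiber /= sin1 sin3 !in_itv/=.
  by move=> /andP[? ?] /andP[? ?]; apply/andP; split; lra.
have alpha2_gt0 : 0 < alpha1 / 2 by lra.
have [eta eta0 SRB] := near_quadratic_SRB hlr alpha2_gt0 margin hh.
(* One half of eta is for alpha, the other for eps. *)
exists (Num.min alpha1 (eta / 2)); first by rewrite lt_min alpha1_gt0 divr_gt0.
move=> alpha; rewrite lt_min => /andP[alpha0 /andP[alpha_lt1 alpha_eta]].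
have pi2 : 0 <= 2%:R * pi :> R by rewrite mulr_ge0// pi_ge0.
split.
  apply: (SRB _ _ _ _ _ _ _ _ (alpha * (2%:R * pi)) (times_mod1_map R hd)).
  - by rewrite mulr_ge0// ltW.
  - by apply: cylinder_fiber_in; apply: hI1; rewrite alpha0.
  - by move=> t x _ _; apply: le_trans (quad_fiber_near _ alpha0 _ _) _; lra.
  - move=> t x y _ _ _; rewrite /quad_fiber /= (_ : _ - _ = 0); last by ring.
    by rewrite normr0 mulr_ge0// ltW.
  - by move=> i t t' x _ _ _; exact: quad_fiber_theta.
  - by move=> i t x _ _; exact: quad_fiber_diff.
exists (eta / 2); first by rewrite divr_gt0.
move=> g' f' [f'_in [a' [b' [expanding' Cf' _ close]]]].
have [G [dG [K B']]] := markov_expanding_map expanding'.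
have ab (i : 'I_d) : i%:R / d%:R < i.+1%:R / d%:R :> R := mm_ab (times_mod1_map R hd) i.
have piece t : t \in `]0, 1] -> exists i, t \in `]a' i, b' i].
  move=> t01; have : (`]0, 1]%classic : set R) t by [].
  by rewrite -(mm_cover B') => -[i _ ti]; exists i.
(* The Lipschitz constant in the base direction is multiplied by the ratio of the
   lengths of corresponding pieces; the sum over the pieces bounds all of them. *)
pose M (i : 'I_d) : R := (alpha * (2%:R * pi) + eta / 2) * ((i.+1%:R / d%:R - i%:R / d%:R) / (b' i - a' i)).
have M0 (i : 'I_d) : 0 <= M i.
  apply: mulr_ge0; first by rewrite addr_ge0 ?divr_ge0 ?mulr_ge0 ?(ltW alpha0) ?(ltW eta0)// pi_ge0.
  by rewrite divr_ge0// subr_ge0 ltW// (mm_ab B').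
apply: (SRB _ _ _ _ _ _ _ _ (\sum_i M i) B').
- by rewrite sumr_ge0.
- exact: cylinder_fiber_in f'_in.
- move=> t x t01 _; have [i ti] := piece t t01.
  have C0 := perturbed_branch_C0 (ab i) (mm_ab B' i) (Cf' i) (close i)
    (h := fun x => a0 - x ^+ 2) (fun t => quad_fiber_near a0 alpha0 t x) ti.
  apply: le_trans C0 _.
  by lra.
- move=> t x y t01 _ _; have [i ti] := piece t t01.
  apply: le_trans (perturbed_branch_fiber (ab i) (mm_ab B' i) (@quad_fiber_diff _ a0 alpha)
    (Cf' i) (close i) (h := fun x => a0 - x ^+ 2) (x := x) (y := y) _ ti) _.
    by move=> s; rewrite /quad_fiber /=; ring.
  by rewrite ler_wpM2r//; lra.
- move=> i t t' x ti t'i _.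
  apply: le_trans (perturbed_branch_theta (ab i) (mm_ab B' i) (@quad_fiber_diff _ a0 alpha)
    (Cf' i) (close i) (fun t t' => quad_fiber_theta a0 alpha0 t t' x) ti t'i) _.
  by rewrite ler_wpM2r// (bigD1 i)//= lerDl sumr_ge0.
- move=> i t x ti _.
  by apply: (@perturbed_branch_diff _ f' (a' i) (b' i)) => //; exact: Cf'.
Qed.
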